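(* Let $m\ge 0$. For any initial data $\psi=(\psi_1,\psi_2)\in L^2(\mathbb{R})$ (complex-valued components) and $a_\mu=(a_\mu^0,a_\mu^1)\in C(\mathbb{R})$, $\mu=0,1$ (real-valued components), there exists a unique global strong solution $(\Psi,A)$ to the system $$\begin{cases} \partial_t\Psi_1+\partial_x\Psi_2=im\Psi_1+iA_0\Psi_1+iA_1\Psi_2,\\ \partial_t\Psi_2+\partial_x\Psi_1=-im\Psi_2+iA_0\Psi_2+iA_1\Psi_1,\\ \Box A_0=|\Psi_1|^2+|\Psi_2|^2,\\ \Box A_1=-(\overline{\Psi_2}\Psi_1+\overline{\Psi_1}\Psi_2), \end{cases}$$ with initial data $$\Psi_j(x,0)=\psi_j(x)\ (j=1,2),\qquad A_\nu(x,0)=a_\nu^0(x),\quad \partial_tA_\nu(x,0)=a_\nu^1(x)\ (\nu=0,1),$$ which satisfies $$\Psi=(\Psi_1,\Psi_2)\in C([0,\infty);L^2(\mathbb{R})),\qquad A=(A_0,A_1)\in C(\mathbb{R}\times[0,\infty)).$$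
   Context: Here $(x,t)\in\mathbb{R}\times[0,\infty)$, $\Psi_1,\Psi_2$ are complex-valued, $A_0,A_1$ are real-valued, and $\Box=\partial_t^2-\partial_x^2$. Definition (strong solution). A pair $(\Psi,A)$ with $\Psi=(\Psi_1,\Psi_2)\in L^2_{loc}(\mathbb{R}\times(0,+\infty))$ and $A=(A_0,A_1)\in C(\mathbb{R}\times[0,+\infty))$ is called a strong solution to the system $$\begin{cases} \partial_t\Psi_1+\partial_x\Psi_2=im\Psi_1+iA_0\Psi_1+iA_1\Psi_2,\\ \partial_t\Psi_2+\partial_x\Psi_1=-im\Psi_2+iA_0\Psi_2+iA_1\Psi_1,\\ \Box A_0=|\Psi_1|^2+|\Psi_2|^2,\\ \Box A_1=-(\overline{\Psi_2}\Psi_1+\overline{\Psi_1}\Psi_2), \end{cases}$$ with the initial data $$\Psi_j(x,0)=\psi_j(x)\ (j=1,2),\qquad A_\nu(x,0)=a_\nu^0(x),\quad \partial_tA_\nu(x,0)=a_\nu^1(x)\ (\nu=0,1),$$ if there exists a sequence of smooth solutions $\{(\Psi^n,A_\mu^n)\}_{n=1}^\infty$ of the system (on $\mathbb{R}\times[0,\infty)$) such that $$\|\Psi^n-\Psi\|_{L^2(K)}+\|A_0^n-A_0\|_{C(K)}+\|A_1^n-A_1\|_{C(K)}\to0\quad\text{as } n\to\infty$$ for every compact set $K\subset\mathbb{R}\times[0,\infty)$, and $$\|\Psi^n(\cdot,0)-\psi\|_{L^2([a,b])}+\|A_\mu^n(\cdot,0)-a_\mu^0\|_{C([a,b])}+\|\partial_tA_\mu^n(\cdot,0)-a_\mu^1\|_{C([a,b])}\to0\quad\text{as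 } n\to\infty$$ for $\mu=0,1$ and every bounded interval $[a,b]$. *)

(* Defs.v *)
From mathcomp Require Import all_boot all_order all_algebra.
From mathcomp Require Import all_classical all_reals all_analysis.
From mathcomp Require Export complex.

Set Implicit Arguments.
Unset Strict Implicit.
Unset Printing Implicit Defensive.

Import Order.TTheory GRing.Theory Num.Theory.
Import numFieldNormedType.Exports.

Local Open Scope classical_set_scope.
Local Open Scope ring_scope.
Local Open Scope complex_scope.

(* Values (Psi_1, Psi_2) of a spinor field. *)
Notation spinor R := (R[i] * R[i])%type.

Definition spinor_norm (R : realType) (z : spinor R) : R :=
  Num.sqrt (complex.Re z.1 ^+ 2 + complex.Im z.1 ^+ 2
            + (complex.Re z.2 ^+ 2 + complex.Im z.2 ^+ 2)).

(* Points of R * R are (x, t).  Fields are total functions on R * R; every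
   condition below only depends on their values for t >= 0. *)
Definition halfplane (R : realType) : set (R * R) := [set p | 0 <= p.2].
Arguments halfplane R : clear implicits.

Definition open_halfplane (R : realType) : set (R * R) := [set p | 0 < p.2].
Arguments open_halfplane R : clear implicits.

(* measurableTypeR R is R with its Borel sigma-algebra. *)
Definition leb1 (R : realType) : {measure set (measurableTypeR R) -> \bar R} :=
  @lebesgue_measure R.

Definition leb2 (R : realType) :
    {measure set (measurableTypeR R * measurableTypeR R)%type -> \bar R} :=
  (@lebesgue_measure R \x @lebesgue_measure R)%E.

Section Norms.
Context {R : realType}.

Definition spinor_measurable {d} {T : measurableType d} (D : set T)
    (u : T -> spinor R) : Prop :=
  [/\ measurable_fun D (fun x => complex.Re (u x).1),
      measurable_fun D (fun x => complex.Im (u x).1),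
      measurable_fun D (fun x => complex.Re (u x).2) &
      measurable_fun D (fun x => complex.Im (u x).2)].

Definition L2norm {d} {T : measurableType d} (mu : {measure set T -> \bar R})
    (D : set T) (u : T -> spinor R) : \bar R :=
  ('N[mu]_2%:E[(fun x => (spinor_norm (u x))%:E) \_ D])%E.

Definition inL2 (u : R -> spinor R) : Prop :=
  spinor_measurable (T := measurableTypeR R) setT u /\
  (L2norm (leb1 R) setT u < +oo)%E.

Definition inL2loc (u : R * R -> spinor R) : Prop :=
  spinor_measurable (T := (measurableTypeR R * measurableTypeR R)%type)
    (open_halfplane R) u /\
  forall K : set (R * R), compact K -> K `<=` open_halfplane R ->
    (L2norm (leb2 R) K u < +oo)%E.

(* C([0, +oo); L^2(R)) *)
Definition inCL2 (u : R * R -> spinor R) : Prop :=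
  (forall t : R, 0 <= t -> inL2 (fun x => u (x, t))) /\
  (forall t0 : R, 0 <= t0 ->
    L2norm (leb1 R) setT (fun x : R => u (x, t) - u (x, t0))
      @[t --> within [set t | 0 <= t] (nbhs t0)] --> 0%E).

(* The point 0 is added so that the norm over the empty set is 0, not -oo. *)
Definition supnorm {T : Type} (D : set T) (f : T -> R) : \bar R :=
  ereal_sup (0%E |` [set `|f x|%:E | x in D]).

End Norms.

Section Smoothness.
Context {R : realType}.
Implicit Types (f : R * R -> R) (F : R * R -> R[i]) (p : R * R).

Definition derivable_x f p : Prop := derivable (fun x => f (x, p.2)) p.1 1.
Definition dx f p : R := derive1 (fun x => f (x, p.2)) p.1.

(* On the line t = 0 the derivative in t is one-sided; for t > 0 the
   restriction on h is void near h = 0. *)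
Definition t_quotients f p :=
  (fun h : R => h^-1 * (f (p.1, p.2 + h) - f p))
    @ within [set h | 0 <= p.2 + h] 0^'.
Definition derivable_t f p : Prop := cvg (t_quotients f p).
Definition dt f p : R := lim (t_quotients f p).

Definition box f p : R := dt (dt f) p - dx (dx f) p.

Fixpoint Ck (k : nat) f : Prop :=
  if k is k'.+1 then
    [/\ forall p, halfplane R p -> derivable_x f p /\ derivable_t f p,
        Ck k' (dx f) & Ck k' (dt f)]
  else {within halfplane R, continuous f}.

Definition smooth f : Prop := forall k, Ck k f.

Definition smoothC F : Prop :=
  smooth (fun p => complex.Re (F p)) /\ smooth (fun p => complex.Im (F p)).
Definition dxC F p : R[i] :=
  dx (fun q => complex.Re (F q)) p +i* dx (fun q => complex.Im (F q)) p.
Definition dtC F p : R[i] :=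
  dt (fun q => complex.Re (F q)) p +i* dt (fun q => complex.Im (F q)) p.

End Smoothness.

Section MaxwellDirac.
Context {R : realType}.
Implicit Types (Psi : R * R -> spinor R) (A : 'I_2 -> R * R -> R).

Definition smooth_solution (m : R) Psi A : Prop :=
  let Psi1 p := (Psi p).1 in
  let Psi2 p := (Psi p).2 in
  [/\ smoothC Psi1 /\ smoothC Psi2,
      forall mu, smooth (A mu) &
      forall p, halfplane R p ->
      [/\ dtC Psi1 p + dxC Psi2 p =
            'i%C * m%:C * Psi1 p + 'i%C * (A 0 p)%:C * Psi1 p
            + 'i%C * (A 1 p)%:C * Psi2 p,
          dtC Psi2 p + dxC Psi1 p =
            - 'i%C * m%:C * Psi2 p + 'i%C * (A 0 p)%:C * Psi2 p
            + 'i%C * (A 1 p)%:C * Psi1 p,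
          (box (A 0) p)%:C = `|Psi1 p| ^+ 2 + `|Psi2 p| ^+ 2 &
          (box (A 1) p)%:C =
            - ((Psi2 p)^*%C * Psi1 p + (Psi1 p)^*%C * Psi2 p)]].

(* a0 mu and a1 mu are the initial values of A mu and of its t-derivative. *)
Definition strong_solution (m : R) (psi : R -> spinor R)
    (a0 a1 : 'I_2 -> R -> R) Psi A : Prop :=
  [/\ inL2loc Psi,
      forall mu, {within halfplane R, continuous (A mu)} &
      exists (Psin : nat -> R * R -> spinor R)
             (An : nat -> 'I_2 -> R * R -> R),
      [/\ forall n, smooth_solution m (Psin n) (An n),
          forall K : set (R * R), compact K -> K `<=` halfplane R ->
            (L2norm (leb2 R) K (fun p : R * R => Psin n p - Psi p)%R
             + supnorm K (fun p => An n 0 p - A 0 p)%R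
             + supnorm K (fun p => An n 1 p - A 1 p)%R)%E @[n --> \oo] --> 0%E &
          forall (mu : 'I_2) (a b : R),
            (L2norm (leb1 R) `[a, b]%classic (fun x : R => Psin n (x, 0) - psi x)%R
             + supnorm `[a, b]%classic (fun x => An n mu (x, 0) - a0 mu x)%R
             + supnorm `[a, b]%classic
                 (fun x => dt (An n mu) (x, 0) - a1 mu x)%R)%E
              @[n --> \oo] --> 0%E]].

End MaxwellDirac.

(* Main.v *)
Require Import Defs.
From mathcomp Require Import all_boot all_order all_algebra.
From mathcomp Require Import all_classical all_reals all_analysis.
From mathcomp Require Import measurable_realfun ring lra.

(** The Maxwell-Dirac system in one space dimension is hyperbolic with speed one, and its spinor
    has a conserved charge. Three consequences carry the proof.

    Smooth data have global smooth solutions. In the characteristic unknowns [Psi_1 + Psi_2],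
    [Psi_1 - Psi_2], [A_0 + A_1], [A_0 - A_1] the system consists of transport equations with
    quadratic right-hand sides. The potentials enter the Dirac equation through the factor [i]
    and only rotate phases, so the spinor obeys an a priori bound on light cones that ignores
    them; a capped, globally Lipschitz version of the system is solved by Picard iteration
    ([picard]) and the caps turn out to be inactive ([md_quad_solution]). Derivatives solve the
    linearised system, which is again quadratic together with the original one, whence
    smoothness ([quad_solution_smooth]). Polynomial data are general enough
    ([smooth_solution_exists]).

    Solutions are stable in the charge norm ([stability]). The charge on the sections of a
    shrinking light cone does not increase ([charge_le]). For two solutions, the energy [E] of
    the difference of the spinors grows only through the difference of the potentials acting on
    a spinor of bounded charge, hence at a rate bounded by the square of the uniform norm of
    that difference. d'Alembert's formula in turn bounds the square of the difference of the
    potentials by the data and by the charge times the time integral of [E]; in one dimension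
    its kernel is bounded, so no derivative is lost. The two bounds close in a Gronwall argument
    whose constant depends on the charge and on the height of the cone alone.

    Existence and uniqueness follow. Data in L^2 and continuous potentials are approximated by
    polynomials on growing intervals at a geometric rate ([fast_data_exists]). By stability the
    smooth solutions converge geometrically, uniformly in time, so they converge almost
    everywhere at each time and Fatou's lemma keeps the rate ([fast_limit]); integration over
    time gives convergence on compact sets ([limit_strong_solution]). Continuity in time with
    values in L^2 of the whole line needs in addition that the charge far out is small uniformly
    in time, which is finite speed of propagation ([limit_charge], [limit_inCL2]). Any strong
    solution is by definition a limit of smooth ones with convergent data; stability merges the
    approximants of two strong solutions with equal data ([strong_solution_unique]). *)

Set Implicit Arguments.
Unset Strict Implicit.
Unset Printing Implicit Defensive.

Import Order.TTheory GRing.Theory Num.Theory.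
Import numFieldNormedType.Exports.
Local Open Scope classical_set_scope.
Local Open Scope ring_scope.

(** * Calculus on the line *)

Section Calculus.
Context {R : realType}.
Implicit Types f g F G : R -> R.

(** Differentiability as a two-sided linear approximation: unlike the difference quotient, this
    form adds up and needs no division. *)
Lemma is_derive_epsP f (x l : R) :
  is_derive x (1:R) f l <->
  (forall e : R, 0 < e -> exists2 d : R, 0 < d &
     forall h : R, `|h| < d -> `|f (x + h) - f x - h * l| <= e * `|h|).
Proof.
split=> [[dfx <-] e e0|H].
  have /cvgrPdist_le/(_ _ e0) : (fun h => h^-1 *: (f (h *: (1:R) + x) - f x)) @ 0^' --> 'D_1 f x.
    exact: dfx.
  move=> /nbhs_ballP[d /= d0 Hd]; exists d => // h hd.
  have [->|h0] := eqVneq h 0; first by rewrite addr0 subrr mul0r subrr normr0 mulr0.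
  have := Hd h; rewrite /ball/= sub0r normrN => /(_ hd h0).
  rewrite /= [h *: _]mulr1 [h + x]addrC [_ *: _]/(_ * _) => H.
  rewrite -(ler_pM2r (_ : 0 < `|h^-1|)); last by rewrite normr_gt0 invr_neq0.
  rewrite -[leRHS]mulrA -normrM -normrM mulfV// normr1 mulr1.
  rewrite distrC in H; apply: le_trans H; rewrite mulrBl (mulrAC h) mulfV// mul1r.
  by rewrite (mulrC _ h^-1).
have C : (fun h => h^-1 *: (f (h *: (1:R) + x) - f x)) @ 0^' --> l.
  apply/cvgrPdist_le => e e0; have [d d0 Hd] := H _ e0.
  apply/nbhs_ballP; exists d => //= h; rewrite /ball/= sub0r normrN => hd h0.
  rewrite [h *: _]mulr1 [h + x]addrC [_ *: _]/(_ * _).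
  rewrite -(ler_pM2r (_ : 0 < `|h|)); last by rewrite normr_gt0.
  apply: le_trans (Hd h hd); rewrite -normrM mulrBl (mulrAC h^-1) mulVf// mul1r.
  by rewrite distrC (mulrC l).
split; first by apply/cvg_ex; exists l.
exact/cvg_lim.
Qed.

Lemma is_derive_cvg f (x l : R) : is_derive x (1:R) f l -> {for x, continuous f}.
Proof. by case=> /derivable1_diffP/differentiable_continuous. Qed.

Lemma derive_continuous f df : (forall x, is_derive x (1:R) f (df x)) -> continuous f.
Proof. by move=> H x; apply: is_derive_cvg (H x). Qed.

(** The mean value theorem applied to [g - f] and to [g + f]. *)
Lemma le_deriv f g df dg a b : a <= b ->
  {within `[a, b], continuous f} -> {within `[a, b], continuous g} ->
  (forall x, x \in `]a, b[ -> is_derive x (1:R) f (df x)) ->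
  (forall x, x \in `]a, b[ -> is_derive x (1:R) g (dg x)) ->
  (forall x, x \in `]a, b[ -> `|df x| <= dg x) ->
  `|f b - f a| <= g b - g a.
Proof.
move=> ab cf cg df_ dg_ H.
move: ab; rewrite le_eqVlt => /predU1P[->|ab]; first by rewrite !subrr normr0.
have M1 x : x \in `]a, b[ -> is_derive x (1:R) (g - f) (dg x - df x).
  by move=> xab; apply: is_deriveB; [exact: dg_|exact: df_].
have M2 x : x \in `]a, b[ -> is_derive x (1:R) (g + f) (dg x + df x).
  by move=> xab; apply: is_deriveD; [exact: dg_|exact: df_].
have [c1 c1ab E1] := @MVT _ _ _ a b ab M1 (fun x => cvgB (cg x) (cf x)).
have [c2 c2ab E2] := @MVT _ _ _ a b ab M2 (fun x => cvgD (cg x) (cf x)).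
have := H _ c1ab; have := H _ c2ab; rewrite !ler_norml => /andP[h1 h2] /andP[h3 h4].
have ba : 0 <= b - a by lra.
have e1 : 0 <= (dg c1 - df c1) * (b - a) by rewrite mulr_ge0//; lra.
have e2 : 0 <= (dg c2 + df c2) * (b - a) by rewrite mulr_ge0//; lra.
rewrite -E1 in e1; rewrite -E2 in e2; move: e1 e2; rewrite /= => e1 e2.
change (is_true (0 <= (g b - f b) - (g a - f a))) in e1.
change (is_true (0 <= (g b + f b) - (g a + f a))) in e2.
by apply/andP; split; lra.
Qed.

Lemma const_deriv0 f a b : a <= b -> {within `[a, b], continuous f} ->
  (forall x, x \in `]a, b[ -> is_derive x (1:R) f 0) -> f b = f a.
Proof.
move=> ab cf H; apply/eqP; rewrite -subr_eq0 -normr_le0.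
have := @le_deriv f (cst 0) (cst 0) (cst 0) a b ab cf.
rewrite subrr; apply=> //.
  by move=> x; apply: cvg_cst.
by move=> x _; rewrite normr0.
Qed.

Lemma continuous_primitive_local f (n : R) : continuous f -> forall x, `|x| < n ->
  is_derive x (1:R) (fun y => \int[lebesgue_measure]_(t in `[- n, y]) f t)%R (f x).
Proof.
move=> cf x xn; have := xn; rewrite ltr_norml => /andP[nx xn'].
have := @continuous_FTC1 R f (BLeft (- n)) x n xn'.
case.
- apply: continuous_compact_integrable; first exact: segment_compact.
  exact: continuous_subspaceT.
- by rewrite /= lte_fin.
- exact: cf.
- move=> dF FE; split; first exact: dF.
  by rewrite -FE derive1E.
Qed.

(** The fundamental theorem of calculus gives a primitive on each interval of radius [n];
    normalised to vanish at [0], these agree on overlaps and glue to a primitive on the line. *)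
Lemma exists_primitive f : continuous f -> exists F, forall x, is_derive x (1:R) F (f x).
Proof.
move=> cf.
pose G (n : nat) y := (\int[lebesgue_measure]_(t in `[- n%:R, y]) f t)%R.
pose H n y := G n y - G n 0.
have dH n x : `|x| < n%:R -> is_derive x (1:R) (H n) (f x).
  move=> xn; rewrite -[f x]subr0; apply: is_deriveB.
  exact: continuous_primitive_local.
have agree n m x : `|x| < n%:R -> `|x| < m%:R -> H n x = H m x.
  move=> xn xm.
  have d0 y : `|y| <= `|x| -> is_derive y (1:R) (H n - H m) 0.
    move=> yx; rewrite -(subrr (f y)); apply: is_deriveB; apply: dH.
      exact: le_lt_trans xn.
    exact: le_lt_trans xm.
  have wc a b : (forall y, a <= y <= b -> `|y| <= `|x|) -> {within `[a, b], continuous (H n - H m)}.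
    move=> ab; apply: derivable_within_continuous => y; rewrite in_itv/= => yab.
    by have [] := d0 y (ab y yab).
  have E0 : (H n - H m) 0 = 0.
    by change (H n 0 - H m 0 = 0); rewrite /H !subrr.
  suff : (H n - H m) x = (H n - H m) 0.
    by rewrite E0 => /eqP; rewrite subr_eq0 => /eqP.
  have [x0|x0] := leP 0 x.
    apply: const_deriv0 => //.
      apply: wc => y /andP[y0 yx]; by rewrite !ger0_norm.
    move=> y; rewrite in_itv/= => /andP[y0 yx]; apply: d0; rewrite !ger0_norm//; exact: ltW.
  apply/esym; apply: const_deriv0; first exact: ltW.
    apply: wc => y /andP[y0 yx]; rewrite !ler0_norm//; [lra|exact: ltW].
  move=> y; rewrite in_itv/= => /andP[y0 yx]; apply: d0; rewrite !ltr0_norm//; lra.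
pose N (x : R) := (Num.truncn `|x|).+1.
have NP (x : R) : `|x| < (N x)%:R by apply: truncnS_gt.
exists (fun x => H (N x) x) => x.
have xN : `|x| < (N x).+1%:R by apply: lt_trans (NP x) _; rewrite ltr_nat.
have := dH _ _ xN => /is_derive_epsP D.
apply/is_derive_epsP => e e0; have [d d0 Hd] := D e e0.
exists (Num.min d 1); first by rewrite lt_min d0/=.
move=> h; rewrite lt_min => /andP[hd h1].
rewrite (agree _ (N x).+1 x)//.
rewrite (agree _ (N x).+1 (x + h))//; first exact: Hd.
rewrite (le_lt_trans (ler_normD _ _))// -[(N x).+1%:R]natr1 ltrD//.
Qed.

(** The oriented integral of a continuous function is encoded as the increment of a chosen
    primitive: additivity over intervals and the sign rule are then plain algebra. *)
Definition primitive f : R -> R :=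
  match pselect (exists F, forall x, is_derive x (1:R) F (f x)) with
  | left e => projT1 (cid e)
  | right _ => fun=> 0
  end.

Definition RI f (a b : R) : R := primitive f b - primitive f a.

Lemma primitiveP f : continuous f -> forall x, is_derive x (1:R) (primitive f) (f x).
Proof.
move=> /exists_primitive e x; rewrite /primitive; case: pselect => // e'.
exact: (projT2 (cid e')).
Qed.

Lemma primitive_continuous f : continuous f -> continuous (primitive f).
Proof. by move=> /primitiveP/derive_continuous. Qed.

Lemma RIxx f a : RI f a a = 0.
Proof. exact: subrr. Qed.

Lemma RI_opp f a b : RI f b a = - RI f a b.
Proof. by rewrite /RI opprB. Qed.

Lemma RI_split f c a b : RI f a b = RI f a c + RI f c b.
Proof. by rewrite /RI [RHS]addrC addrA subrK. Qed.

Lemma RI_eq f F a b : continuous f -> (forall x, is_derive x (1:R) F (f x)) ->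
  RI f a b = F b - F a.
Proof.
move=> cf dF.
have cF := derive_continuous dF; have cP := primitive_continuous cf.
suff aux u v : u <= v -> RI f u v = F v - F u.
  case: (leP a b) => [|/ltW] /aux //.
  by rewrite (RI_opp f b a) => ->; rewrite opprB.
move=> uv; apply/eqP; rewrite /RI -subr_eq0; apply/eqP.
have : (primitive f - F) v = (primitive f - F) u.
  apply: const_deriv0 => //.
    by apply: continuous_subspaceT => x; apply: cvgB; [exact: cP|exact: cF].
  move=> x _; rewrite -(subrr (f x)); apply: is_deriveB; exact: primitiveP.
change (primitive f v - F v = primitive f u - F u -> primitive f v - primitive f u - (F v - F u) = 0); lra.
Qed.

Lemma RI_le f g a b : a <= b -> continuous f -> continuous g ->
  (forall x, a <= x <= b -> `|f x| <= g x) -> `|RI f a b| <= RI g a b.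
Proof.
move=> ab cf cg H; apply: (@le_deriv _ _ f g) => //.
- exact/continuous_subspaceT/primitive_continuous.
- exact/continuous_subspaceT/primitive_continuous.
- by move=> x _; exact: primitiveP.
- by move=> x _; exact: primitiveP.
- move=> x; rewrite in_itv/= => /andP[ax xb]; apply: H; apply/andP; split; exact: ltW.
Qed.

Lemma RI_ge0 f a b : a <= b -> continuous f -> (forall x, a <= x <= b -> 0 <= f x) ->
  0 <= RI f a b.
Proof.
move=> ab cf H; apply: le_trans (normr_ge0 _) (RI_le ab cf cf _).
by move=> x xab; rewrite ger0_norm// H.
Qed.

Lemma RI_lin f g (k l a b : R) : continuous f -> continuous g ->
  RI (fun x => k * f x + l * g x) a b = k * RI f a b + l * RI g a b.
Proof.
move=> cf cg.
have c : continuous (fun x => k * f x + l * g x).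
  move=> x; apply: cvgD; apply: cvgM; [exact: cvg_cst|exact: cf|exact: cvg_cst|exact: cg].
have d (x : R) : is_derive x (1:R) (fun x => k * primitive f x + l * primitive g x) (k * f x + l * g x).
  apply: is_deriveD; apply: is_deriveZ; exact: primitiveP.
by rewrite (RI_eq a b c d) /RI; ring.
Qed.

Lemma RI_ext f g a b : f =1 g -> RI f a b = RI g a b.
Proof. by move=> /funext ->. Qed.

Lemma RID f g a b : continuous f -> continuous g ->
  RI (fun x => f x + g x) a b = RI f a b + RI g a b.
Proof.
move=> cf cg; rewrite -[RI f a b]mul1r -[RI g a b]mul1r -RI_lin//.
by apply: RI_ext => x; rewrite !mul1r.
Qed.

Lemma RIZ f k a b : continuous f -> RI (fun x => k * f x) a b = k * RI f a b.
Proof.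
move=> cf; rewrite -[RHS]addr0 -(mul0r (RI f a b)) -RI_lin//.
by apply: RI_ext => x; rewrite mul0r addr0.
Qed.

Lemma RIN f a b : continuous f -> RI (fun x => - f x) a b = - RI f a b.
Proof. by move=> cf; rewrite -mulN1r -RIZ//; apply: RI_ext => x; rewrite mulN1r. Qed.

Lemma RIB f g a b : continuous f -> continuous g ->
  RI (fun x => f x - g x) a b = RI f a b - RI g a b.
Proof.
move=> cf cg; rewrite -RIN// -RID//.
by move=> x; apply: cvgN; exact: cg.
Qed.

Lemma RI_cst k a b : RI (fun=> k) a b = k * (b - a).
Proof.
have c : continuous (fun _ : R => k) by move=> x; exact: cvg_cst.
have d (x : R) : is_derive x (1:R) (fun x => k * x) k.
  by rewrite -[X in is_derive _ _ _ X]mulr1; apply: is_deriveZ.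
by rewrite (RI_eq a b c d); ring.
Qed.

Lemma RI_mono f g a b : a <= b -> continuous f -> continuous g ->
  (forall x, a <= x <= b -> f x <= g x) -> RI f a b <= RI g a b.
Proof.
move=> ab cf cg H; rewrite -subr_ge0 -RIB//; apply: RI_ge0 => //.
  by move=> x; apply: cvgB; [exact: cg|exact: cf].
by move=> x /H; rewrite subr_ge0.
Qed.

Lemma RI_bound f (M a b : R) : continuous f ->
  (forall s, Num.min a b <= s <= Num.max a b -> `|f s| <= M) -> `|RI f a b| <= M * `|b - a|.
Proof.
move=> cf; have cM : continuous (fun _ : R => M) by move=> x; exact: cvg_cst.
case: (leP a b) => ab H.
  rewrite (ger0_norm (x := b - a)) ?subr_ge0// -RI_cst; apply: RI_le => //.
rewrite RI_opp normrN (distrC b a) (ger0_norm (x := a - b)) ?subr_ge0 ?(ltW ab)// -RI_cst.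
by apply: RI_le => //; exact: ltW.
Qed.

Lemma RI_derive f a b : continuous f -> is_derive b (1:R) (RI f a) (f b).
Proof.
by move=> cf; rewrite -[f b]subr0; apply: is_deriveB; exact: primitiveP.
Qed.

(** This bridge turns the pointwise calculus of the integrals of smooth solutions into
    statements on L^2 norms. *)
Lemma RI_lebesgue f a b : a <= b -> continuous f ->
  (\int[lebesgue_measure]_(x in `[a, b]) (f x)%:E = (RI f a b)%:E)%E.
Proof.
move=> + cf; rewrite le_eqVlt => /predU1P[->|ab].
  by rewrite RIxx set_itv1 integral_set1.
rewrite (@continuous_FTC2 _ _ (primitive f))//.
- exact: continuous_subspaceT.
- split.
  + by move=> x _; have [] := primitiveP cf x.
  + apply: cvg_at_right_filter; exact: primitive_continuous.
  + apply: cvg_at_left_filter; exact: primitive_continuous.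
- by move=> x _; rewrite derive1E; have [_] := primitiveP cf x.
Qed.

Lemma deriveZid (k x : R) : is_derive x (1:R) (fun s : R => k * s) k.
Proof. by rewrite -[X in is_derive _ _ _ X]mulr1; apply: is_deriveZ. Qed.

(** Remainder estimate in which only the size of [dF - l] near [t] enters; with [l] the
    derivative at [t] it serves first and second order expansions alike. *)
Lemma taylor_bound (F dF : R -> R) (t h l e : R) :
  (forall s : R, `|s - t| <= `|h| -> is_derive s (1:R) F (dF s)) ->
  (forall s : R, `|s - t| <= `|h| -> `|dF s - l| <= e) ->
  `|F (t + h) - F t - h * l| <= e * `|h|.
Proof.
move=> dF_ H.
pose G (s : R) := F s - l * s.
have dG (s : R) : `|s - t| <= `|h| -> is_derive s (1:R) G (dF s - l).
  by move=> /dF_ d; apply: is_deriveB; exact: deriveZid.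
have -> : F (t + h) - F t - h * l = G (t + h) - G t by rewrite /G; ring.
have main (u v : R) : u <= v -> (forall s : R, u <= s <= v -> `|s - t| <= `|h|) ->
    `|G v - G u| <= e * v - e * u.
  move=> uv sub; apply: (@le_deriv G (fun s : R => e * s) (fun s => dF s - l) (fun=> e)) => //.
  - apply: derivable_within_continuous => y; rewrite in_itv/= => /sub/dG[//].
  - by apply: continuous_subspaceT; apply: derive_continuous (deriveZid e).
  - by move=> y; rewrite in_itv/= => /andP[y1 y2]; apply: dG; apply: sub; rewrite !ltW.
  - by move=> y _; exact: deriveZid.
  - by move=> y; rewrite in_itv/= => /andP[y1 y2]; apply: H; apply: sub; rewrite !ltW.
have [h0|h0] := leP 0 h.
  move: main; rewrite (ger0_norm h0) => main.
  have := main t (t + h) _ _; rewrite (_ : e * (t + h) - e * t = e * h); last by ring.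
  apply; first by lra.
  by move=> s /andP[s1 s2]; rewrite ler_norml; apply/andP; split; lra.
move: main; rewrite (ltr0_norm h0) => main.
have := main (t + h) t _ _; rewrite (_ : e * t - e * (t + h) = e * - h); last by ring.
rewrite distrC; apply; first by lra.
by move=> s /andP[s1 s2]; rewrite ler_norml; apply/andP; split; lra.
Qed.

End Calculus.

(** * Continuous functions of two variables *)

Section Plane.
Context {R : realType}.

Lemma between_bound (a b s T : R) : `|a| <= T -> `|b| <= T ->
  Num.min a b <= s <= Num.max a b -> `|s| <= T.
Proof.
rewrite !ler_norml ge_min le_max => /andP[? ?] /andP[? ?] /andP[] /orP[?|?] /orP[?|?]; apply/andP; split; lra.
Qed.

Implicit Types (f g h : R * R -> R) (p q : R * R) (K : set (R * R)).

Lemma continuous2P f p : {for p, continuous f} <->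
  (forall e : R, 0 < e -> exists2 d : R, 0 < d &
     forall q, `|q.1 - p.1| < d -> `|q.2 - p.2| < d -> `|f q - f p| <= e).
Proof.
split=> [cf e e0|H].
  have /cvgrPdist_le/(_ _ e0) := cf.
  move=> /nbhs_ballP[d /= d0 Hd]; exists d => // q q1 q2.
  by rewrite distrC; apply: Hd; split; rewrite /ball/= distrC.
apply/cvgrPdist_le => e e0; have [d d0 Hd] := H _ e0.
exists (ball p.1 d, ball p.2 d); first by split; exact: nbhsx_ballx.
by move=> q [/= q1 q2]; rewrite distrC; apply: Hd; rewrite distrC.
Qed.

Lemma continuous1P (f : R -> R) (x : R) : {for x, continuous f} <->
  (forall e : R, 0 < e -> exists2 d : R, 0 < d &
     forall y : R, `|y - x| < d -> `|f y - f x| <= e).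
Proof.
split=> [cf e e0|H].
  have /cvgrPdist_le/(_ _ e0) := cf.
  move=> /nbhs_ballP[d /= d0 Hd]; exists d => // q q1.
  by rewrite distrC; apply: Hd; rewrite /ball/= distrC.
apply/cvgrPdist_le => e e0; have [d d0 Hd] := H _ e0.
apply/nbhs_ballP; exists d => //= q q1.
by rewrite distrC; apply: Hd; rewrite distrC.
Qed.

(** Uniform continuity that also compares points of [K] with nearby points outside [K]; that is
    what moving domains of integration need. *)
Lemma heine f K (e : R) : continuous f -> compact K -> 0 < e ->
  exists2 d : R, 0 < d & forall p q, K p ->
    `|q.1 - p.1| < d -> `|q.2 - p.2| < d -> `|f q - f p| <= e.
Proof.
move=> cf /compact_near_coveringP cK e0.
pose P (d : R) p := forall q, `|q.1 - p.1| < d -> `|q.2 - p.2| < d -> `|f q - f p| <= e.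
have : \forall d \near (0 : R)^'+, K `<=` P d.
  apply: cK => p Kp.
  have e20 : 0 < e / 2 by lra.
  have [d d0 Hd] := (continuous2P f p).1 (cf p) _ e20.
  exists (ball p (d / 2), [set d' | d' < d / 2]).
    split => /=; first by apply: nbhsx_ballx; lra.
    by apply: nbhs_right_lt; lra.
  move=> [p' d'] /= [[p1 p2] d'd] q q1 q2.
  rewrite /ball/= in p1 p2; rewrite distrC in p1; rewrite distrC in p2.
  have A : `|f p' - f p| <= e / 2 by apply: Hd; [apply: lt_trans p1 _|apply: lt_trans p2 _]; lra.
  have B : `|f q - f p| <= e / 2.
    apply: Hd.
      have := ler_normD (q.1 - p'.1) (p'.1 - p.1); rewrite addrA subrK; lra.
    have := ler_normD (q.2 - p'.2) (p'.2 - p.2); rewrite addrA subrK; lra.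
  have := ler_normB (f q - f p) (f p' - f p).
  by rewrite (_ : f q - f p - (f p' - f p) = f q - f p'); [lra|ring].
move=> H; have : \forall d \near (0 : R)^'+, 0 < d /\ K `<=` P d.
  by near=> d; split; near: d => //; exact: nbhs_right_gt.
move=> /filter_ex[d [d0 Hd]]; exists d => // p q Kp; exact: Hd.
Unshelve. all: by end_near. Qed.

Lemma compact_bound f K : continuous f -> compact K ->
  exists2 M : R, 0 <= M & forall p, K p -> `|f p| <= M.
Proof.
move=> cf cK.
have /compact_bounded[M [_ HM]] := continuous_compact (continuous_subspaceT cf) cK.
exists (`|M| + 1) => [|p Kp]; first by rewrite addr_ge0.
apply: HM; first by rewrite (le_lt_trans (ler_norm M)) ?ltrDl.
by exists p.
Qed.

Definition box_set (a b c d : R) : set (R * R) := `[a, b]%classic `*` `[c, d]%classic.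

Lemma box_compact a b c d : compact (box_set a b c d).
Proof. by apply: compact_setX; exact: segment_compact. Qed.

Arguments box_compact a b c d : clear implicits.

Lemma box_setP a b c d p : box_set a b c d p <-> (a <= p.1 <= b) /\ (c <= p.2 <= d).
Proof. by rewrite /box_set /setX/= !in_itv. Qed.

Lemma continuous_pair (T : topologicalType) f (u v : T -> R) : continuous f ->
  continuous u -> continuous v -> continuous (fun x => f (u x, v x)).
Proof.
move=> cf cu cv x; apply: (@continuous_comp _ _ _ (fun x => (u x, v x)) f x); last exact: cf.
by apply: (@cvg_pair _ _ _ _ (nbhs (u x)) (nbhs (v x))); [exact: cu|exact: cv].
Qed.

Lemma continuous_slice1 f (t : R) : continuous f -> continuous (fun x => f (x, t)).
Proof. by move=> cf; apply: continuous_pair => // x; [exact: cvg_id|exact: cvg_cst]. Qed.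

Lemma continuous_slice2 f (x : R) : continuous f -> continuous (fun t => f (x, t)).
Proof. by move=> cf; apply: continuous_pair => // t; [exact: cvg_cst|exact: cvg_id]. Qed.

Lemma continuous_line f (x c : R) : continuous f -> continuous (fun t : R => f (x + c * t, t)).
Proof.
move=> cf; apply: continuous_pair => // t; last exact: cvg_id.
by apply: cvgD; [exact: cvg_cst|apply: cvgM; [exact: cvg_cst|exact: cvg_id]].
Qed.

(** The integrand is uniformly continuous on a compact box and the length of the interval moves
    continuously. *)
Lemma RI_param_continuous h : continuous h ->
  continuous (fun p => RI (fun s => h (p.1, s)) 0 p.2).
Proof.
move=> ch p; apply/continuous2P => e e0.
pose T := `|p.2| + 1.
have T0 : 0 < T by rewrite ltr_wpDl.
have cb := box_compact p.1 p.1 (- T) T.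
have [M M0 HM] := compact_bound ch cb.
have e1 : 0 < e / 2 / T by rewrite divr_gt0//; lra.
have [d d0 Hd] := heine ch cb e1.
have M1 : 0 < M + 1 by lra.
exists (Num.min d (Num.min 1 (e / 2 / (M + 1)))).
  by rewrite !lt_min d0 ltr01/= divr_gt0//; lra.
move=> q; rewrite !lt_min => /andP[q1 _] /andP[q2 /andP[q2' q2'']].
have cs x : continuous (fun s => h (x, s)) by exact: continuous_slice2.
have q2T : `|q.2| <= T.
  have := ler_normD (q.2 - p.2) p.2; rewrite subrK /T; lra.
have p2T : `|p.2| <= T by rewrite /T; lra.
have A : `|RI (fun s => h (q.1, s)) 0 q.2 - RI (fun s => h (p.1, s)) 0 q.2| <= e / 2.
  rewrite -RIB//.
  apply: (@le_trans _ _ (e / 2 / T * `|q.2 - 0|)).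
    apply: RI_bound; first by move=> x; apply: cvgB; exact: cs.
    move=> s sq; apply: (Hd (p.1, s) (q.1, s)) => //=; last by rewrite subrr normr0.
    apply/box_setP; split => /=; first by rewrite lexx.
    by rewrite -ler_norml; apply: between_bound sq => //; rewrite normr0 ltW.
  rewrite subr0 -[leRHS](divfK (lt0r_neq0 T0)); apply: ler_wpM2l => //; exact: ltW.
have B : `|RI (fun s => h (p.1, s)) 0 q.2 - RI (fun s => h (p.1, s)) 0 p.2| <= e / 2.
  rewrite (RI_split _ p.2 0 q.2) addrAC subrr add0r.
  apply: (@le_trans _ _ (M * `|q.2 - p.2|)).
    apply: RI_bound => // s sq; apply: (HM (p.1, s)); apply/box_setP; split => /=.
      by rewrite lexx.
    by rewrite -ler_norml; apply: between_bound sq.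
  apply: (@le_trans _ _ ((M + 1) * `|q.2 - p.2|)); first by rewrite ler_wpM2r//; lra.
  by rewrite mulrC -ler_pdivlMr// ltW.
have := ler_normD (RI (fun s => h (q.1, s)) 0 q.2 - RI (fun s => h (p.1, s)) 0 q.2)
 (RI (fun s => h (p.1, s)) 0 q.2 - RI (fun s => h (p.1, s)) 0 p.2).
by rewrite addrA subrK; lra.
Qed.

Lemma RI_slice_continuous g (u v : R -> R) : continuous g -> continuous u -> continuous v ->
  continuous (fun t => RI (fun x => g (x, t)) (u t) (v t)).
Proof.
move=> cg cu cv.
pose h := fun p : R * R => g (p.2, p.1).
have ch : continuous h.
  apply: (@continuous_pair _ g snd fst) => // x; [exact: cvg_snd|exact: cvg_fst].
have cH := RI_param_continuous ch.
have -> : (fun t => RI (fun x => g (x, t)) (u t) (v t)) =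
  (fun t => RI (fun s => h (t, s)) 0 (v t) - RI (fun s => h (t, s)) 0 (u t)).
  by apply/funext => t; rewrite /RI /h/=; ring.
move=> t; apply: cvgB.
  by apply: (@continuous_pair _ _ id v cH) => // x; exact: cvg_id.
by apply: (@continuous_pair _ _ id u cH) => // x; exact: cvg_id.
Qed.

(** The increment splits into the motion of the end points at fixed integrand, the effect of
    that motion on the integral of [gt], and the Taylor remainder of the integrand. *)
Lemma leibniz_cone g gt (a b t : R) : continuous g -> continuous gt ->
  (forall x s : R, 0 < s -> is_derive s (1:R) (fun s => g (x, s)) (gt (x, s))) -> 0 < t ->
  is_derive t (1:R) (fun t => RI (fun x => g (x, t)) (a + t) (b - t))
   (RI (fun x => gt (x, t)) (a + t) (b - t) - g (b - t, t) - g (a + t, t)).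
Proof.
move=> cg cgt dg t0.
have cs s : continuous (fun x => g (x, s)) by exact: continuous_slice1.
have cst_ s : continuous (fun x => gt (x, s)) by exact: continuous_slice1.
have cbt : continuous (fun s : R => b - s).
  by move=> x; apply: cvgB; [exact: cvg_cst|exact: cvg_id].
have cat_ : continuous (fun s : R => a + s).
  by move=> x; apply: cvgD; [exact: cvg_cst|exact: cvg_id].
apply/is_derive_epsP => e e0.
have D1 : is_derive t (1:R) (fun s => RI (fun x => g (x, t)) (a + s) (b - s)) (- g (b - t, t) - g (a + t, t)).
  rewrite /RI; apply: is_deriveB.
    rewrite -[- _]mulrN1.
    apply: (@is_derive1_comp _ (primitive (fun x => g (x, t))) (fun s => b - s)).
      exact: primitiveP.
    by rewrite -[-1]add0r; apply: is_deriveB.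
  rewrite -[g (a + t, t)]mulr1.
  apply: (@is_derive1_comp _ (primitive (fun x => g (x, t))) (fun s => a + s)).
    exact: primitiveP.
  by rewrite -[X in is_derive _ _ _ X]add0r; apply: is_deriveD.
pose Lg := `|b| + `|a| + 2 * t + 2.
have Lg0 : 0 < Lg by rewrite /Lg; have := normr_ge0 a; have := normr_ge0 b; lra.
have e3 : 0 < e / 3 by lra.
have [d1 d10 H1] := (is_derive_epsP _ _ _).1 D1 _ e3.
have C2 : continuous (fun s => RI (fun x => gt (x, t)) (a + s) (b - s)).
  apply: (@RI_slice_continuous (fun p => gt (p.1, t))) => //.
  apply: (@continuous_pair _ gt fst (fun=> t)) => // x; [exact: cvg_fst|exact: cvg_cst].
have [d2 d20 H2] := (continuous1P _ _).1 (C2 t) _ e3.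
have e4 : 0 < e / 3 / Lg by rewrite divr_gt0.
have [d3 d30 H3] := heine cgt (box_compact (- Lg) Lg t t) e4.
exists (Num.min (Num.min d1 d2) (Num.min d3 (Num.min 1 t))).
  by rewrite !lt_min d10 d20 d30 ltr01 t0.
move=> h; rewrite !lt_min -!andbA => /and5P[h1 h2 h3 h4 h5].
have ct s : continuous (fun x => g (x, s) - g (x, t) - (s - t) * gt (x, t)).
  move=> x; apply: cvgB; first by apply: cvgB; exact: cs.
  by apply: cvgM; [exact: cvg_cst|exact: cst_].
have B3 : `|RI (fun x => g (x, t + h) - g (x, t) - (t + h - t) * gt (x, t)) (a + (t + h)) (b - (t + h))| <= e / 3 * `|h|.
  apply: (@le_trans _ _ (e / 3 / Lg * `|h| * `|b - (t + h) - (a + (t + h))|)).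
    apply: RI_bound; first exact: ct.
    move=> x xab.
    have bx : forall s, `|s - t| < `|h| + d3 - `|h| -> `|gt (x, s) - gt (x, t)| <= e / 3 / Lg.
      move=> s sh; apply: (H3 (x, t) (x, s)) => //=.
      - apply/box_setP; split => /=; last by rewrite lexx.
        rewrite -ler_norml; apply: between_bound xab.
          apply: le_trans (ler_normD _ _) _; apply: le_trans (lerD (lexx _) (ler_normD _ _)) _.
          rewrite (gtr0_norm t0) /Lg; have := normr_ge0 b; lra.
        apply: le_trans (ler_normB _ _) _; apply: le_trans (lerD (lexx _) (ler_normD _ _)) _.
        rewrite (gtr0_norm t0) /Lg; have := normr_ge0 a; lra.
      - by rewrite subrr normr0.
      - by move: sh; lra.
    rewrite (_ : t + h - t = h); last by ring.
    apply: (@taylor_bound _ (fun s : R => g (x, s)) (fun s => gt (x, s))) => s sh.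
      apply: dg; move: sh h5; rewrite ler_norml => /andP[]; lra.
    by apply: bx; lra.
  rewrite mulrAC ler_wpM2r// -[leRHS](divfK (lt0r_neq0 Lg0)).
  apply: ler_wpM2l; first exact: ltW.
  move: h4; rewrite ltr_norml => /andP[ha hb].
  have := ler_norm a; have := ler_norm b; have := ler_norm (- a); have := ler_norm (- b).
  by rewrite !normrN => i1 i2 i3 i4; rewrite /Lg ler_norml; apply/andP; split; lra.
have {}H1 := H1 h h1.
have B2 : `|h * (RI (fun x => gt (x, t)) (a + (t + h)) (b - (t + h)) - RI (fun x => gt (x, t)) (a + t) (b - t))| <= e / 3 * `|h|.
  rewrite normrM mulrC ler_wpM2r//; apply: (H2 (t + h)).
  by rewrite addrAC subrr add0r.
move: B3; rewrite RIB//; last 2 first.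
- by move=> x; apply: cvgB; exact: cs.
- by move=> x; apply: cvgM; [exact: cvg_cst|exact: cst_].
rewrite RIB// RIZ// (_ : t + h - t = h); last by ring.
move=> B3.
move: H1 B2 B3.
set X1 := RI _ _ _; set X2 := RI _ _ _; set X3 := RI _ _ _; set X4 := RI _ _ _; set X5 := RI _ _ _.
move=> H1 B2 B3.
have -> : X5 - X2 - h * (X4 - g (b - t, t) - g (a + t, t)) =
   (X1 - X2 - h * (- g (b - t, t) - g (a + t, t))) + h * (X3 - X4) + (X5 - X1 - h * X3) by ring.
apply: le_trans (ler_normD _ _) _; rewrite (_ : e * `|h| = e / 3 * `|h| + e / 3 * `|h| + e / 3 * `|h|); last by field.
apply: lerD => //; apply: le_trans (ler_normD _ _) _; exact: lerD.
Qed.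

End Plane.
Arguments box_compact {R} a b c d.

(** * Transport along characteristics *)

Section Characteristics.
Context {R : realType}.
Implicit Types (f g h : R * R -> R) (p q : R * R).

(** [h] is the derivative of [f] along every line of speed [c]; no partial derivative of [f] is
    required, so that the notion passes to limits. *)
Definition chard (c : R) f h := forall y s : R,
  is_derive s (1:R) (fun s : R => f (y + c * s, s)) (h (y + c * s, s)).

(** The diamond with base [- L, L] on the line [t = 0]: it contains the characteristic from each
    of its points down to that line, for all speeds at most [1]. *)
Definition cone (L : R) : set (R * R) := [set p | `|p.1| + `|p.2| <= L].

Definition char_int (c : R) h p := RI (fun s => h (p.1 - c * p.2 + c * s, s)) 0 p.2.

Lemma char_int_continuous c h : continuous h -> continuous (char_int c h).
Proof.
move=> ch.
pose k := fun p : R * R => h (p.1 + c * p.2, p.2).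
have ck : continuous k.
  apply: (@continuous_pair _ _ h (fun p : R * R => p.1 + c * p.2) snd) => // p.
    by apply: cvgD; [exact: cvg_fst|apply: cvgM; [exact: cvg_cst|exact: cvg_snd]].
  exact: cvg_snd.
apply: (@continuous_pair _ _ _ (fun p : R * R => p.1 - c * p.2) snd (RI_param_continuous ck)) => p.
  by apply: cvgB; [exact: cvg_fst|apply: cvgM; [exact: cvg_cst|exact: cvg_snd]].
exact: cvg_snd.
Qed.

Lemma char_int_chard c h : continuous h -> chard c (char_int c h) h.
Proof.
move=> ch y s.
have -> : (fun s : R => char_int c h (y + c * s, s)) = RI (fun r => h (y + c * r, r)) 0.
  by apply/funext => r; rewrite /char_int/= addrK.
by apply: (@RI_derive _ (fun r => h (y + c * r, r))); exact: continuous_line.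
Qed.

Lemma char_int0 c h y : char_int c h (y, 0) = 0.
Proof. exact: RIxx. Qed.

Lemma chardD c f f' h h' : chard c f h -> chard c f' h' ->
  chard c (fun p => f p + f' p) (fun p => h p + h' p).
Proof. by move=> H H' y s; apply: is_deriveD. Qed.

Lemma chardB c f f' h h' : chard c f h -> chard c f' h' ->
  chard c (fun p => f p - f' p) (fun p => h p - h' p).
Proof. by move=> H H' y s; apply: is_deriveB. Qed.

Lemma chardZ c k f h : chard c f h -> chard c (fun p => k * f p) (fun p => k * h p).
Proof. by move=> H y s; apply: is_deriveZ. Qed.

Lemma chardM c f f' h h' : chard c f h -> chard c f' h' ->
  chard c (fun p => f p * f' p) (fun p => f p * h' p + f' p * h p).
Proof. by move=> H H' y s; apply: is_deriveM. Qed.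

Lemma chard_ext c f f' h h' : chard c f h -> f =1 f' -> h =1 h' -> chard c f' h'.
Proof. by move=> H /funext <- /funext <-. Qed.

Lemma chard_transport c (d : R -> R) : chard c (fun p => d (p.1 - c * p.2)) (fun=> 0).
Proof.
move=> y s; rewrite (_ : (fun s : R => _) = cst (d y)); last by apply/funext => r/=; rewrite addrK.
exact: is_derive_cst.
Qed.

Lemma chard_shift c f h z : chard c f h ->
  chard c (fun p => f (p.1 + z, p.2)) (fun p => h (p.1 + z, p.2)).
Proof.
move=> H y s /=; rewrite addrAC.
rewrite (_ : (fun s : R => _) = (fun s : R => f (y + z + c * s, s))); first exact: H.
by apply/funext => r; rewrite addrAC.
Qed.

Lemma chard_const c f (k : R) : chard c f (fun=> 0) -> (forall y, f (y, 0) = k) -> forall p, f p = k.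
Proof.
move=> fh f0 p.
have c0 : continuous (fun _ : R => 0 : R) by move=> x; exact: cvg_cst.
have := RI_eq 0 p.2 c0 (fh (p.1 - c * p.2)).
by rewrite RI_cst mul0r subrK -surjective_pairing f0 => /eqP; rewrite eq_sym subr_eq0 => /eqP.
Qed.

(** The weights [expR (lam * s)] absorb one factor [1 / lam] at each integration, which makes
    iterations contract on domains of any height. *)
Lemma exp_growth_pos (F dF : R -> R) (t A lam e : R) : 0 <= t -> 0 < lam -> 0 <= A ->
  (forall s : R, is_derive s (1:R) F (dF s)) ->
  (forall s : R, 0 <= s <= t -> `|dF s| <= A * expR (lam * s) + e) ->
  `|F t - F 0| <= A / lam * expR (lam * t) + e * t.
Proof.
move=> t0 lam0 A0 dF_ H.
pose G (s : R) := A / lam * expR (lam * s) + e * s.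
have dG (s : R) : is_derive s (1:R) G (A * expR (lam * s) + e).
  apply: is_deriveD; last exact: deriveZid.
  have -> : A * expR (lam * s) = A / lam * (expR (lam * s) * lam) by field; exact: lt0r_neq0.
  apply: (@is_deriveZ _ _ _ (fun s : R => expR (lam * s))).
  apply: (@is_derive1_comp _ expR (fun s : R => lam * s)); exact: deriveZid.
have := @le_deriv _ F G dF (fun s => A * expR (lam * s) + e) 0 t t0.
have -> : G t - G 0 = A / lam * expR (lam * t) + e * t - A / lam.
  by rewrite /G !mulr0 expR0; ring.
move=> K; apply: le_trans (K _ _ _ _ _) _.
- exact/continuous_subspaceT/derive_continuous.
- exact/continuous_subspaceT/derive_continuous.
- by move=> s; rewrite in_itv/= => /andP[s0 st]; apply: H; rewrite !ltW.
- by rewrite gerBl divr_ge0// ltW.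
Qed.

Lemma exp_growth (F dF : R -> R) (t A lam e : R) : 0 < lam -> 0 <= A ->
  (forall s : R, is_derive s (1:R) F (dF s)) ->
  (forall s : R, Num.min 0 t <= s <= Num.max 0 t -> `|dF s| <= A * expR (lam * `|s|) + e) ->
  `|F t - F 0| <= A / lam * expR (lam * `|t|) + e * `|t|.
Proof.
move=> lam0 A0 dF_ H; case: (leP 0 t) H => t0 H.
  rewrite (ger0_norm t0); apply: exp_growth_pos => // s /[dup] st /H.
  by rewrite (@ger0_norm _ s); case/andP: (st).
rewrite (ltr0_norm t0).
have := @exp_growth_pos (fun s => F (- s)) (fun s => - dF (- s)) (- t) A lam e.
rewrite opprK oppr0; apply=> //; first by lra.
  move=> s; rewrite -[- dF _]mulrN1.
  by apply: (@is_derive1_comp _ F -%R).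
move=> s /andP[s1 s2]; rewrite normrN.
have := H (- s); rewrite normrN (ger0_norm s1); apply; apply/andP; split; lra.
Qed.

Lemma cone_char (c L s : R) p : `|c| <= 1 -> cone L p ->
  Num.min 0 p.2 <= s <= Num.max 0 p.2 -> cone L (p.1 - c * p.2 + c * s, s).
Proof.
rewrite /cone/= => c1 pL sp.
have H : `|p.2 - s| + `|s| = `|p.2|.
  move: sp; case: (leP 0 p.2) => p0 /andP[s1 s2].
    by rewrite (ger0_norm s1) (ger0_norm p0) ger0_norm; lra.
  by rewrite (ler0_norm s2) (ltr0_norm p0) ler0_norm; lra.
have -> : p.1 - c * p.2 + c * s = p.1 - c * (p.2 - s) by ring.
apply: le_trans pL; rewrite -H addrA lerD2r.
apply: le_trans (ler_normB _ _) _; rewrite lerD2l normrM.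
by rewrite -[leRHS]mul1r ler_wpM2r.
Qed.

Lemma cone_base (c L : R) p : `|c| <= 1 -> cone L p -> `|p.1 - c * p.2| <= L.
Proof.
move=> c1 pL; have := @cone_char c L 0 p c1 pL.
rewrite /cone/= mulr0 addr0 normr0 addr0; apply.
by rewrite ge_min le_max lexx.
Qed.

Lemma cone_time (L : R) p : cone L p -> `|p.2| <= L.
Proof. by rewrite /cone/=; have := normr_ge0 p.1; lra. Qed.

(** Integration of the source along the characteristic, which stays in the cone, against the
    exponential weight. *)
Lemma chard_bound c f h (L A lam e e0 : R) : `|c| <= 1 -> 0 < lam -> 0 <= A -> 0 <= e ->
  chard c f h ->
  (forall q, cone L q -> `|h q| <= A * expR (lam * `|q.2|) + e) ->
  (forall y, `|y| <= L -> `|f (y, 0)| <= e0) ->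
  forall p, cone L p -> `|f p| <= e0 + e * L + A / lam * expR (lam * `|p.2|).
Proof.
move=> c1 lam0 A0 e_0 fh H H0 p pL.
have := @exp_growth (fun s => f (p.1 - c * p.2 + c * s, s)) (fun s => h (p.1 - c * p.2 + c * s, s)) p.2 A lam e lam0 A0 (fh _).
rewrite /= subrK mulr0 addr0 -surjective_pairing => K.
have {}K : `|f p - f (p.1 - c * p.2, 0)| <= A / lam * expR (lam * `|p.2|) + e * `|p.2|.
  by apply: K => s sp; have := H _ (cone_char c1 pL sp).
have := H0 _ (cone_base c1 pL).
have : e * `|p.2| <= e * L by rewrite ler_wpM2l// (cone_time pL).
have := ler_normD (f p - f (p.1 - c * p.2, 0)) (f (p.1 - c * p.2, 0)); rewrite subrK; lra.
Qed.

Lemma cone_bound (I : finType) (f : I -> R * R -> R) L : (forall i, continuous (f i)) ->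
  exists2 M : R, 0 <= M & forall i p, cone L p -> `|f i p| <= M.
Proof.
move=> cf.
have /choice[M HM] i : exists M : R, 0 <= M /\ forall p, cone L p -> `|f i p| <= M.
  have [M M0 HM] := compact_bound (cf i) (box_compact (- L) L (- L) L).
  exists M; split => // p pL; apply: HM; apply/box_setP; rewrite -!ler_norml.
  by move: pL; rewrite /cone/=; have := normr_ge0 p.1; have := normr_ge0 p.2; split; lra.
exists (\sum_i M i); first by apply: sumr_ge0 => i _; case: (HM i).
move=> i p pL; apply: le_trans (proj2 (HM i) p pL) _.
by rewrite (bigD1 i)//= lerDl sumr_ge0// => j _; case: (HM j).
Qed.

Lemma half_pow_small (C e : R) : 0 < e -> exists n : nat, C * (2^-1) ^+ n <= e.
Proof.
move=> e0.
have : (fun n : nat => C * (2^-1) ^+ n) @ \oo --> (0:R).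
  rewrite -[X in _ --> X](mulr0 C); apply: cvgM; first exact: cvg_cst.
  by apply: cvg_expr; rewrite ger0_norm ?invr_ge0 ?ler0n// invf_lt1// ltr1n.
move=> /cvgrPdist_le/(_ _ e0)[n _ Hn]; exists n.
have := Hn n (leqnn n); rewrite sub0r normrN; apply: le_trans; exact: ler_norm.
Qed.

Lemma le_half_pow (x y C : R) : (forall n : nat, x <= y + C * (2^-1) ^+ n) -> x <= y.
Proof.
move=> H; apply/ler_addgt0Pr => e e0; have [n Hn] := half_pow_small C e0.
by apply: le_trans (H n) _; rewrite lerD2l.
Qed.

Lemma half_pow_ge0 n : 0 <= (2^-1 : R) ^+ n.
Proof. by rewrite exprn_ge0// invr_ge0. Qed.

Lemma geometric_cauchy (u : nat -> R) (C : R) :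
  (forall n, `|u n.+1 - u n| <= C * (2^-1) ^+ n) ->
  forall n m, (n <= m)%N -> `|u m - u n| <= 2 * C * (2^-1) ^+ n.
Proof.
move=> H.
have C0 : 0 <= C by have := le_trans (normr_ge0 _) (H 0); rewrite expr0 mulr1.
have K n k : `|u (n + k)%N - u n| <= 2 * C * (2^-1) ^+ n - 2 * C * (2^-1) ^+ (n + k).
  elim: k => [|k IH]; first by rewrite addn0 !subrr normr0.
  rewrite addnS; have := H (n + k)%N.
  have := ler_normD (u (n + k).+1 - u (n + k)%N) (u (n + k)%N - u n); rewrite addrA subrK exprS.
  move: IH; set z := _ ^+ (n + k); have -> : 2 * C * (2^-1 * z) = C * z by field.
  lra.
move=> n m nm; rewrite -(subnKC nm); apply: le_trans (K _ _) _.
by rewrite gerBl mulr_ge0 ?mulr_ge0 ?half_pow_ge0.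
Qed.

Lemma geometric_is_cvg (u : nat -> R) (C : R) :
  (forall n, `|u n.+1 - u n| <= C * (2^-1) ^+ n) -> cvgn u.
Proof.
move=> /geometric_cauchy K; apply/cauchy_cvgP/cauchy_exP => e e0.
have [N HN] : exists n : nat, 2 * C * (2^-1) ^+ n <= e / 4 by apply: half_pow_small; lra.
exists (u N); exists N => // m /= /K; rewrite /ball/= (distrC (u N)); lra.
Qed.

Lemma geometric_cvg (u : nat -> R) (C : R) :
  (forall n, `|u n.+1 - u n| <= C * (2^-1) ^+ n) ->
  forall n, `|u n - lim (u @ \oo)| <= 2 * C * (2^-1) ^+ n.
Proof.
move=> H n; have K := geometric_cauchy H; have cu := geometric_is_cvg H.
apply/ler_addgt0Pr => e e0.
have /cvgrPdist_le/(_ _ e0)[m _ Hm] := cu.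
have := Hm (maxn n m) (leq_maxr n m); have := K n (maxn n m) (leq_maxl n m).
have := ler_normD (u n - u (maxn n m)) (u (maxn n m) - lim (u @ \oo)); rewrite addrA subrK.
rewrite (distrC (u n) (u (maxn n m))) (distrC (lim _)); lra.
Qed.

Lemma uniform_limit_continuous (W : nat -> R * R -> R) (w : R * R -> R) :
  (forall n, continuous (W n)) ->
  (forall L, exists (C : R) (N : nat), forall n p, (N <= n)%N -> cone L p ->
     `|W n p - w p| <= C * (2^-1) ^+ n) ->
  continuous w.
Proof.
move=> cW H p; apply/continuous2P => e e0.
have [C [N HC]] := H (`|p.1| + `|p.2| + 2).
have e3 : 0 < e / 3 by lra.
have [k] := half_pow_small (C * (2^-1) ^+ N) e3; rewrite -mulrA -exprD.
set n := (N + k)%N => Hn; have Nn : (N <= n)%N by exact: leq_addr.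
have [d d0 Hd] := (continuous2P _ _).1 (cW n p) _ e3.
exists (Num.min d 1); first by rewrite lt_min d0/=.
move=> q; rewrite !lt_min => /andP[q1 q1'] /andP[q2 q2'].
have A : `|W n q - w q| <= e / 3.
  apply: le_trans (HC n q Nn _) Hn; rewrite /cone/=.
  have := ler_normD (q.1 - p.1) p.1; have := ler_normD (q.2 - p.2) p.2; rewrite !subrK; lra.
have B : `|W n p - w p| <= e / 3 by apply: le_trans (HC n p Nn _) Hn; rewrite /cone/=; lra.
have := Hd q q1 q2.
have := ler_normD (w q - W n q) (W n p - w p); have := ler_normD (w q - W n q + (W n p - w p)) (W n q - W n p).
rewrite (_ : w q - W n q + (W n p - w p) + (W n q - W n p) = w q - w p); last by ring.
rewrite (distrC (w q) (W n q)); lra.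
Qed.

(** A bootstrap replaces the integral inequality: if the bound holds with constant [A + S],
    integrating along characteristics improves it to [A + S / 2], and a first finite constant
    comes from compactness. *)
Lemma cone_gronwall (I : finType) (c : I -> R) (f h : I -> R * R -> R) (L K e e0 : R) :
  (forall i, `|c i| <= 1) -> 0 < K -> 0 <= e -> 0 <= e0 -> 0 <= L ->
  (forall i, continuous (f i)) -> (forall i, chard (c i) (f i) (h i)) ->
  (forall i p D, cone L p -> (forall j, `|f j p| <= D) -> `|h i p| <= K * D + e) ->
  (forall i y, `|y| <= L -> `|f i (y, 0)| <= e0) ->
  forall i p, cone L p -> `|f i p| <= 2 * (e0 + e * L) * expR (2 * K * `|p.2|).
Proof.
move=> c1 K0 e_0 e00 L0 cf fh H H0 i p pL.
have [M M0 HM] := cone_bound L cf.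
pose A := 2 * (e0 + e * L).
have A0 : 0 <= A by rewrite /A mulr_ge0// addr_ge0// mulr_ge0.
have ex (q : R * R) : 1 <= expR (2 * K * `|q.2|).
  by rewrite -expR0 ler_expR !mulr_ge0//; exact: ltW.
have main n : forall j q, cone L q -> `|f j q| <= (A + M * (2^-1) ^+ n) * expR (2 * K * `|q.2|).
  elim: n => [|n IH] j q qL.
    apply: le_trans (HM j q qL) _; rewrite expr0 mulr1.
    by rewrite mulrDl; have := ler_peMr M0 (ex q); have := mulr_ge0 A0 (le_trans ler01 (ex q)); lra.
  have K20 : 0 < 2 * K by lra.
  have := @chard_bound (c j) (f j) (h j) L (K * (A + M * (2^-1) ^+ n)) (2 * K) e e0 (c1 j) K20.
  move=> /(_ _ e_0 (fh j) _ (H0 j) q qL) B; apply: le_trans (B _ _) _.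
  - by rewrite mulr_ge0 ?(ltW K0)// addr_ge0// mulr_ge0// half_pow_ge0.
  - move=> r rL; rewrite -mulrA; apply: (H j r _ rL) => k; exact: IH.
  have -> : K * (A + M * 2^-1 ^+ n) / (2 * K) = A / 2 + M * 2^-1 ^+ n.+1.
    by rewrite exprS; field; lra.
  have -> : e0 + e * L = A / 2 by rewrite /A; field.
  have A20 : 0 <= A / 2 by lra.
  have := ler_peMr A20 (ex q); set E := expR _; lra.
set E := expR _; apply: (@le_half_pow _ _ (M * E)) => n.
by apply: le_trans (main n i p pL) _; rewrite -/E -/A; lra.
Qed.

Section Picard.
Context {I : finType}.
Context (c : I -> R) (F : I -> R * R -> (I -> R) -> R) (d : I -> R -> R).
Context (c1 : forall i, `|c i| <= 1).
Context (F_continuous : forall w : I -> R * R -> R, (forall j, continuous (w j)) ->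
  forall i, continuous (fun p => F i p (fun j => w j p))).
Context (F_lipschitz : forall L, exists2 K : R, 0 < K & forall i p (a b : I -> R) (D : R),
  cone L p -> (forall j, `|a j - b j| <= D) -> `|F i p a - F i p b| <= K * D).
Context (d_continuous : forall i, continuous (d i)).

Let source (w : I -> R * R -> R) i p := F i p (fun j => w j p).

Let step (w : I -> R * R -> R) i p := d i (p.1 - c i * p.2) + char_int (c i) (source w i) p.

Let W n := iter n step (fun _ _ => 0).

Let stepP w : (forall j, continuous (w j)) ->
  forall i, [/\ continuous (step w i), chard (c i) (step w i) (source w i) &
              forall y, step w i (y, 0) = d i y].
Proof.
move=> cw i; have cs : continuous (source w i) by exact: F_continuous.
split.
- move=> p; apply: cvgD; last exact: char_int_continuous.
  apply: (@continuous_comp _ _ _ (fun p : R * R => p.1 - c i * p.2) (d i)); last exact: d_continuous.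
  by apply: cvgB; [exact: cvg_fst|apply: cvgM; [exact: cvg_cst|exact: cvg_snd]].
- rewrite (_ : source w i = fun p => 0 + source w i p); last by apply/funext => p; rewrite add0r.
  change (chard (c i) (fun p => d i (p.1 - c i * p.2) + char_int (c i) (source w i) p) (fun p => 0 + source w i p)).
  by apply: chardD; [exact: chard_transport|exact: char_int_chard].
- by move=> y; rewrite /step char_int0/= mulr0 subr0 addr0.
Qed.

Let W_continuous n : forall i, continuous (W n i).
Proof.
elim: n => [|n IH] i; first by move=> p; exact: cvg_cst.
by have [] := stepP IH i.
Qed.

(** Integration along characteristics contracts by [1 / 2] in the norm weighted by [expR (- 2 K
    |t|)] on each cone, so the iterates converge at a geometric rate on cones of any size: the
    solution is global because the source is globally Lipschitz on cones. *)
Theorem picard : exists w : I -> R * R -> R,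
  [/\ forall i, continuous (w i),
      forall i, chard (c i) (w i) (fun p => F i p (fun j => w j p)) &
      forall i y, w i (y, 0) = d i y].
Proof.
have cW n i : continuous (W n i) by exact: W_continuous.
have contract L K w w' (D : R) : 0 < K ->
   (forall i p (a b : I -> R) (D : R),
     cone L p -> (forall j, `|a j - b j| <= D) -> `|F i p a - F i p b| <= K * D) ->
   (forall j, continuous (w j)) -> (forall j, continuous (w' j)) -> 0 <= D ->
   (forall i p, cone L p -> `|w i p - w' i p| <= D * expR (2 * K * `|p.2|)) ->
   (forall i p, cone L p -> `|step w i p - step w' i p| <= D / 2 * expR (2 * K * `|p.2|)).
  move=> K0 HK cw cw' D0 H i p pL.
  have [_ s1 s0] := stepP cw i; have [_ s1' s0'] := stepP cw' i.
  have K20 : 0 < 2 * K by lra.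
  have := @chard_bound (c i) _ _ L (K * D) (2 * K) 0 0 (c1 i) K20 _ (lexx _) (chardB s1 s1').
  rewrite mul0r !add0r (_ : K * D / (2 * K) = D / 2); last by field; exact: lt0r_neq0.
  move=> /(_ _ _ _ p pL) B; rewrite -[leRHS]add0r; apply: B; first by rewrite mulr_ge0// ltW.
    by move=> q qL; rewrite addr0 -mulrA; apply: HK => // j; exact: H.
  by move=> y _; rewrite s0 s0' subrr normr0.
pose w i p := lim (W n i p @[n --> \oo]).
have W_w L : exists2 C : R, 0 <= C & forall n i p, cone L p -> `|W n i p - w i p| <= C * (2^-1) ^+ n.
  have [K K0 HK] := F_lipschitz L.
  have [S S0 HS] := cone_bound L (cW 1%N).
  have H n : forall i p, cone L p -> `|W n.+1 i p - W n i p| <= S * (2^-1) ^+ n * expR (2 * K * `|p.2|).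
    elim: n => [|n IH] i p pL.
      rewrite expr0 mulr1 [W 0 i p]/(0) subr0; apply: le_trans (HS i p pL) _.
      by rewrite ler_peMr// -expR0 ler_expR !mulr_ge0//; exact: ltW.
    have := contract L K (W n.+1) (W n) (S * (2^-1) ^+ n) K0 HK (cW _) (cW _) _ IH i p pL.
    rewrite exprS (_ : S * 2^-1 ^+ n / 2 = S * (2^-1 * 2^-1 ^+ n)); last by ring.
    by apply; rewrite mulr_ge0 ?half_pow_ge0.
  exists (2 * (S * expR (2 * K * L))).
    by rewrite !mulr_ge0// expR_ge0.
  move=> n i p pL; apply: geometric_cvg => {}n.
  apply: le_trans (H n i p pL) _; rewrite -!mulrA ler_wpM2l// mulrC ler_wpM2r ?half_pow_ge0//.
  by rewrite ler_expR !ler_wpM2l ?(cone_time pL)// ltW.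
have cw i : continuous (w i).
  apply: (@uniform_limit_continuous (fun n => W n i)) => [n|L]; first exact: cW.
  by have [C _ HC] := W_w L; exists C, 0%N => n p _; exact: HC.
have fix_ i : w i = step w i.
  apply/funext => p; apply/eqP; rewrite -subr_eq0 -normr_le0.
  pose L := `|p.1| + `|p.2|.
  have pL : cone L p by rewrite /cone/=.
  have [C C0 HC] := W_w L; have [K K0 HK] := F_lipschitz L.
  apply: (@le_half_pow _ _ (C + C / 2 * expR (2 * K * `|p.2|))) => n; rewrite add0r.
  have A : `|w i p - W n.+1 i p| <= C * (2^-1) ^+ n.
    rewrite distrC; apply: le_trans (HC _ _ _ pL) _.
    by rewrite exprS ler_wpM2l// ler_piMl ?half_pow_ge0// invf_le1// ler1n.
  have B := contract L K (W n) w (C * (2^-1) ^+ n) K0 HK (cW n) cw _ _ i p pL.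
  have {}B : `|W n.+1 i p - step w i p| <= C * 2^-1 ^+ n / 2 * expR (2 * K * `|p.2|).
    apply: B; first by rewrite mulr_ge0 ?half_pow_ge0.
    move=> j q qL; apply: le_trans (HC n j q qL) _.
    rewrite ler_peMr ?mulr_ge0 ?half_pow_ge0// -expR0 ler_expR !mulr_ge0//; exact: ltW.
  have := ler_normD (w i p - W n.+1 i p) (W n.+1 i p - step w i p); rewrite addrA subrK.
  move: A B; set z := 2^-1 ^+ n; set E := expR _; lra.
exists w; split => // [i|i y].
- by have [_ + _] := stepP cw i; rewrite -fix_.
- by rewrite fix_; have [_ _] := stepP cw i; apply.
Qed.

End Picard.
End Characteristics.

(** * Semilinear systems with quadratic nonlinearity *)

Section Forms.
Context {R : realType} {I : Type}.
Implicit Types (l : seq (R * (I * I))) (w z a b : I -> R).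

(** A list of monomials [k * w_i * w_j], given as [(k, (i, j))]. *)
Definition quad l w : R := \sum_(m <- l) m.1 * (w m.2.1 * w m.2.2).
(** The linearisation of the quadratic form [quad l] at [w], applied to [z]. *)
Definition polar l w z : R := \sum_(m <- l) m.1 * (w m.2.1 * z m.2.2 + z m.2.1 * w m.2.2).
Definition coef_norm l : R := \sum_(m <- l) `|m.1|.

Lemma coef_norm_ge0 l : 0 <= coef_norm l.
Proof. by apply: sumr_ge0. Qed.

Lemma quad_add l w z : quad l (fun j => w j + z j) - quad l w = polar l w z + quad l z.
Proof.
apply/eqP; rewrite subr_eq; apply/eqP; rewrite /quad /polar -!big_split/=.
by apply: eq_bigr => m _; ring.
Qed.

Lemma polar_lin l w a b (k : R) : polar l w (fun j => a j - k * b j) = polar l w a - k * polar l w b.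
Proof.
rewrite /polar mulr_sumr -sumrN -big_split/=.
by apply: eq_bigr => m _; ring.
Qed.

Lemma sum_bound l (T : R * (I * I) -> R) (D : R) : (forall m, `|T m| <= `|m.1| * D) ->
  `|\sum_(m <- l) T m| <= coef_norm l * D.
Proof.
move=> H; apply: le_trans (ler_norm_sum _ _ _) _; rewrite /coef_norm mulr_suml.
by apply: ler_sum => m _; exact: H.
Qed.

Lemma quad_bound l w (D : R) : (forall j, `|w j| <= D) -> `|quad l w| <= coef_norm l * D ^+ 2.
Proof.
move=> H; apply: sum_bound => m; rewrite !normrM ler_wpM2l//.
by apply: ler_pM.
Qed.

Lemma polar_bound l w z (M D : R) : (forall j, `|w j| <= M) -> (forall j, `|z j| <= D) ->
  `|polar l w z| <= coef_norm l * (2 * M * D).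
Proof.
move=> H H'; apply: sum_bound => m; rewrite normrM ler_wpM2l//.
apply: le_trans (ler_normD _ _) _; rewrite !normrM.
rewrite (_ : 2 * M * D = M * D + D * M); last by ring.
by apply: lerD; apply: ler_pM.
Qed.

Lemma quad_lip l a b (M D : R) : (forall j, `|a j| <= M) -> (forall j, `|b j| <= M) ->
  (forall j, `|a j - b j| <= D) -> `|quad l a - quad l b| <= coef_norm l * (2 * M * D).
Proof.
move=> Ha Hb H; rewrite /quad -sumrB; apply: sum_bound => m; rewrite -mulrBr normrM ler_wpM2l//.
rewrite (_ : _ - _ = a m.2.1 * (a m.2.2 - b m.2.2) + (a m.2.1 - b m.2.1) * b m.2.2); last by ring.
apply: le_trans (ler_normD _ _) _; rewrite !normrM.
rewrite (_ : 2 * M * D = M * D + D * M); last by ring.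
by apply: lerD; apply: ler_pM.
Qed.

Lemma sum_continuous (T : topologicalType) (E : eqType) (s : seq E) (f : E -> T -> R) :
  (forall m, continuous (f m)) -> continuous (fun p => \sum_(m <- s) f m p).
Proof.
move=> H; elim: s => [|m s IH].
  rewrite (_ : (fun p => _) = cst 0); first by move=> p; exact: cvg_cst.
  by apply/funext => p; rewrite big_nil.
rewrite (_ : (fun p => _) = (fun p => f m p + \sum_(m <- s) f m p)).
  by move=> p; apply: cvgD; [exact: H|exact: IH].
by apply/funext => p; rewrite big_cons.
Qed.

End Forms.

Section FormContinuity.
Context {R : realType} {I : finType}.
Implicit Types (l : seq (R * (I * I))) (w z : I -> R * R -> R).

Lemma polar_continuous l w z : (forall j, continuous (w j)) -> (forall j, continuous (z j)) ->
  continuous (fun p => polar l (fun j => w j p) (fun j => z j p)).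
Proof.
move=> cw cz; apply: sum_continuous => m p.
apply: cvgM; first exact: cvg_cst.
by apply: cvgD; apply: cvgM; [exact: cw|exact: cz|exact: cz|exact: cw].
Qed.

End FormContinuity.

Definition quad_solution (R : realType) (I : finType) (c : I -> R)
    (l : I -> seq (R * (I * I))) (d : I -> R -> R) (w : I -> R * R -> R) :=
  [/\ forall i, continuous (w i),
      forall i, chard (c i) (w i) (fun p => quad (l i) (fun j => w j p)) &
      forall i y, w i (y, 0) = d i y].

Definition join_fun (I T : Type) (f g : I -> T) (i : I + I) : T :=
  match i with inl i => f i | inr i => g i end.

(** The quadratic system for the pair formed by a solution and its x-derivative: the right-hand
    side of the latter is the polarised form, which is quadratic in the pair. *)
Definition prolong (R : realType) (I : Type) (l : I -> seq (R * (I * I))) (i : I + I) :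
    seq (R * ((I + I) * (I + I))) :=
  match i with
  | inl i => [seq (m.1, (inl m.2.1, inl m.2.2)) | m <- l i]
  | inr i => [seq (m.1, (inl m.2.1, inr m.2.2)) | m <- l i] ++
             [seq (m.1, (inr m.2.1, inl m.2.2)) | m <- l i]
  end.

Section Prolongation.
Context {R : realType}.

Lemma quad_prolong_inl (I : Type) (l : I -> seq (R * (I * I))) (w z : I -> R) i :
  quad (prolong l (inl i)) (join_fun w z) = quad (l i) w.
Proof. by rewrite /quad big_map. Qed.

Lemma quad_prolong_inr (I : Type) (l : I -> seq (R * (I * I))) (w z : I -> R) i :
  quad (prolong l (inr i)) (join_fun w z) = polar (l i) w z.
Proof.
rewrite /quad big_cat !big_map/= /polar -big_split/=.
by apply: eq_bigr => m _; rewrite mulrDr.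
Qed.

Lemma derive_lipschitz (d d' : R -> R) (L : R) : continuous d' ->
  (forall x : R, is_derive x (1:R) d (d' x)) ->
  exists2 C : R, 0 <= C & forall y h : R, `|y| <= L -> `|h| <= 1 -> `|d (y + h) - d y| <= C * `|h|.
Proof.
move=> cd' dd.
have [C C0 HC] := @compact_bound R (fun p => d' p.1) _
  (fun p => continuous_comp (cvg_fst) (cd' p.1)) (box_compact (- (L + 1)) (L + 1) 0 0).
exists C => // y h yL h1.
have := @taylor_bound R d d' y h 0 C; rewrite mulr0 subr0; apply => s sy.
rewrite subr0; apply: (HC (s, 0)); apply/box_setP; rewrite /= lexx -ler_norml; split => //.
by have := ler_normD (s - y) y; rewrite subrK; lra.
Qed.

Lemma derive_quadratic (d d' d'' : R -> R) (L : R) : continuous d'' ->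
  (forall x : R, is_derive x (1:R) d (d' x)) ->
  (forall x : R, is_derive x (1:R) d' (d'' x)) ->
  exists2 C : R, 0 <= C & forall y h : R, `|y| <= L -> `|h| <= 1 ->
    `|d (y + h) - d y - h * d' y| <= C * `|h| ^+ 2.
Proof.
move=> cd'' dd dd'.
have [C C0 HC] := derive_lipschitz L cd'' dd'.
exists C => // y h yL h1.
rewrite expr2 mulrA; apply: (@taylor_bound R d d' y h (d' y)) => s sy.
have := HC y (s - y) yL (le_trans sy h1); rewrite (addrC y) subrK => K.
by apply: le_trans K _; rewrite ler_wpM2l.
Qed.

Lemma cone_sub (L L' : R) p : L <= L' -> cone L p -> cone L' p.
Proof. by rewrite /cone/= => LL' pL; exact: le_trans pL LL'. Qed.

Lemma cone_shift (L h : R) p : `|h| <= 1 -> cone L p -> cone (L + 1) (p.1 + h, p.2).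
Proof. by rewrite /cone/= => h1 pL; have := ler_normD p.1 h; lra. Qed.

(** The candidate [z] for the x-derivative solves the linearised system, a linear problem solved
    by [picard]. Gronwall's inequality for the increment [w (x + h) - w x] bounds it by a
    multiple of [h], and then for [w (x + h) - w x - h * z] by a multiple of [h ^+ 2], so that
    [z] is the derivative. *)
Lemma quad_solution_prolong (I : finType) (c : I -> R) (l : I -> seq (R * (I * I)))
    (d d' d'' : I -> R -> R) (w : I -> R * R -> R) :
  (forall i, `|c i| <= 1) ->
  (forall i (x : R), is_derive x (1:R) (d i) (d' i x)) ->
  (forall i (x : R), is_derive x (1:R) (d' i) (d'' i x)) ->
  (forall i, continuous (d'' i)) ->
  quad_solution c l d w ->
  exists2 z : I -> R * R -> R,
    forall i p, is_derive p.1 (1:R) (fun x => w i (x, p.2)) (z i p) &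
    quad_solution (join_fun c c) (prolong l) (join_fun d d') (join_fun w z).
Proof.
move=> c1 dd dd' cd'' [cw chw w0].
pose N := \sum_i coef_norm (l i).
have N0 : 0 <= N by apply: sumr_ge0 => i _; exact: coef_norm_ge0.
have leN i : coef_norm (l i) <= N.
  by rewrite /N (bigD1 i)//= lerDl sumr_ge0// => j _; exact: coef_norm_ge0.
have [z [cz chz z0]] : exists z : I -> R * R -> R,
  [/\ forall i, continuous (z i),
      forall i, chard (c i) (z i) (fun p => polar (l i) (fun j => w j p) (fun j => z j p)) &
      forall i y, z i (y, 0) = d' i y].
  apply: (@picard R I c (fun i p a => polar (l i) (fun j => w j p) a) d' c1).
  - by move=> z cz i; exact: polar_continuous.
  - move=> L; have [M M0 HM] := cone_bound L cw.
    exists (N * (2 * M) + 1); first by have := mulr_ge0 N0 (mulr_ge0 (ler0n R 2) M0); lra.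
    move=> i p a b D pL H.
    have D0 : 0 <= D by exact: le_trans (normr_ge0 _) (H i).
    have -> : polar (l i) (w^~ p) a - polar (l i) (w^~ p) b = polar (l i) (w^~ p) (fun j => a j - 1 * b j).
      by rewrite polar_lin mul1r.
    apply: le_trans (@polar_bound _ _ _ _ _ M D (fun j => HM j p pL) _) _.
      by move=> j; rewrite mul1r.
    apply: (@le_trans _ _ (N * (2 * M * D))).
      by rewrite ler_wpM2r// !mulr_ge0.
    by rewrite (_ : (N * (2 * M) + 1) * D = N * (2 * M * D) + D) ?lerDl//; ring.
  - by move=> i; exact: derive_continuous (dd' i).
have key L : 0 <= L -> exists2 C : R, 0 <= C & forall i p h, cone L p -> `|h| <= 1 ->
    `|w i (p.1 + h, p.2) - w i p - h * z i p| <= C * `|h| ^+ 2.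
  move=> L0.
  have [M M0 HM] := cone_bound (L + 1) cw.
  pose K := N * (2 * M) + 1.
  have K0 : 0 < K by rewrite /K; have := mulr_ge0 N0 (mulr_ge0 (ler0n R 2) M0); lra.
  have sumC (P : I -> R -> Prop) : (forall i (C C' : R), C <= C' -> P i C -> P i C') ->
      (forall i, exists2 C : R, 0 <= C & P i C) -> exists2 C : R, 0 <= C & forall i, P i C.
    move=> mono ex.
    have /choice[C HC] i : exists C : R, 0 <= C /\ P i C by have [C C0 PC] := ex i; exists C.
    exists (\sum_i C i); first by apply: sumr_ge0 => i _; case: (HC i).
    move=> i; apply: (mono i (C i)); last by case: (HC i).
    by rewrite (bigD1 i)//= lerDl sumr_ge0// => j _; case: (HC j).
  have [C1 C10 HC1] : exists2 C : R, 0 <= C & forall i, forall y h : R, `|y| <= L -> `|h| <= 1 ->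
     `|d i (y + h) - d i y| <= C * `|h|.
    apply: sumC => [i C C' CC' H y h yL h1|i].
      by apply: le_trans (H y h yL h1) _; rewrite ler_wpM2r.
    exact: derive_lipschitz (derive_continuous (dd' i)) (dd i).
  have [C2 C20 HC2] : exists2 C : R, 0 <= C & forall i, forall y h : R, `|y| <= L -> `|h| <= 1 ->
     `|d i (y + h) - d i y - h * d' i y| <= C * `|h| ^+ 2.
    apply: sumC => [i C C' CC' H y h yL h1|i].
      by apply: le_trans (H y h yL h1) _; rewrite ler_wpM2r ?exprn_ge0.
    exact: derive_quadratic (cd'' i) (dd i) (dd' i).
  pose E := expR (2 * K * L).
  have E1 p : cone L p -> expR (2 * K * `|p.2|) <= E.
    by move=> pL; rewrite ler_expR -!mulrA !ler_wpM2l ?(cone_time pL)// ltW.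
  have E0 : 0 <= E by exact: expR_ge0.
  have leK i (D : R) : 0 <= D -> coef_norm (l i) * (2 * M * D) <= K * D.
    move=> D0; apply: (@le_trans _ _ (N * (2 * M * D))).
      by rewrite ler_wpM2r// !mulr_ge0.
    by rewrite (_ : K * D = N * (2 * M * D) + D) ?lerDl// /K; ring.
  pose C3 := 2 * C1 * E.
  have C30 : 0 <= C3 by rewrite !mulr_ge0.
  have stepA i p h : `|h| <= 1 -> cone L p -> `|w i (p.1 + h, p.2) - w i p| <= C3 * `|h|.
    move=> h1 pL.
    have := @cone_gronwall R I c (fun i p => w i (p.1 + h, p.2) - w i p)
       (fun i p => quad (l i) (fun j => w j (p.1 + h, p.2)) - quad (l i) (fun j => w j p))
       L K 0 (C1 * `|h|) c1 K0 (lexx _) (mulr_ge0 C10 (normr_ge0 h)) L0 _ _ _ _ i p pL.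
    rewrite mul0r addr0 => B.
    apply: le_trans (B _ _ _ _) _.
    - move=> j; move=> q; apply: cvgB; last exact: cw.
      apply: (@continuous_pair _ _ (w j) (fun q : R * R => q.1 + h) snd (cw j)) => r.
        by apply: cvgD; [exact: cvg_fst|exact: cvg_cst].
      exact: cvg_snd.
    - by move=> j; apply: chardB => //; exact: chard_shift (chw j).
    - move=> j q D qL HD; rewrite addr0.
      have D0 : 0 <= D by exact: le_trans (normr_ge0 _) (HD j).
      apply: le_trans (leK j D D0); apply: quad_lip => // k; apply: HM.
        exact: cone_shift.
      by apply: cone_sub qL; rewrite lerDl.
    - by move=> j y yL; rewrite /= !w0; exact: HC1.
    - rewrite (_ : C3 * `|h| = 2 * (C1 * `|h|) * E); last by rewrite /C3; ring.
      by rewrite ler_wpM2l ?mulr_ge0// E1.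
  pose C4 := 2 * (C2 + N * C3 ^+ 2 * L) * E.
  exists C4; first by rewrite !mulr_ge0 ?addr_ge0 ?mulr_ge0 ?exprn_ge0.
  move=> i p h pL h1.
  have e0 : 0 <= N * C3 ^+ 2 * `|h| ^+ 2 by rewrite !mulr_ge0 ?exprn_ge0.
  have := @cone_gronwall R I c (fun i p => w i (p.1 + h, p.2) - w i p - h * z i p)
     (fun i p => quad (l i) (fun j => w j (p.1 + h, p.2)) - quad (l i) (fun j => w j p)
        - h * polar (l i) (fun j => w j p) (fun j => z j p))
     L K (N * C3 ^+ 2 * `|h| ^+ 2) (C2 * `|h| ^+ 2) c1 K0 e0 (mulr_ge0 C20 (exprn_ge0 _ (normr_ge0 h))) L0 _ _ _ _ i p pL.
  move=> B; apply: le_trans (B _ _ _ _) _.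
  - move=> j; move=> q; apply: cvgB; last by apply: cvgM; [exact: cvg_cst|exact: cz].
    apply: cvgB; last exact: cw.
    apply: (@continuous_pair _ _ (w j) (fun q : R * R => q.1 + h) snd (cw j)) => r.
      by apply: cvgD; [exact: cvg_fst|exact: cvg_cst].
    exact: cvg_snd.
  - move=> j; apply: chardB; last exact: chardZ.
    by apply: chardB => //; exact: chard_shift (chw j).
  - move=> j q D qL HD.
    have D0 : 0 <= D by exact: le_trans (normr_ge0 _) (HD j).
    have -> : quad (l j) (fun k => w k (q.1 + h, q.2)) =
       quad (l j) (fun k => w k q + (w k (q.1 + h, q.2) - w k q)).
      by congr quad; apply/funext => k; rewrite (addrC (w k q)) subrK.
    rewrite quad_add addrAC -polar_lin.
    apply: le_trans (ler_normD _ _) _; apply: lerD.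
      apply: le_trans (leK j D D0); apply: polar_bound => // k; apply: HM.
      by apply: cone_sub qL; rewrite lerDl.
    apply: le_trans (@quad_bound _ _ _ _ (C3 * `|h|) _) _; first by move=> k; exact: stepA.
    by rewrite exprMn mulrA ler_wpM2r ?exprn_ge0// ler_wpM2r ?exprn_ge0.
  - by move=> j y yL; rewrite /= !w0 z0; exact: HC2.
  - rewrite (_ : C4 * `|h| ^+ 2 = 2 * (C2 * `|h| ^+ 2 + N * C3 ^+ 2 * `|h| ^+ 2 * L) * E); last by rewrite /C4; ring.
    rewrite ler_wpM2l ?E1// mulr_ge0// addr_ge0//; first by rewrite mulr_ge0 ?exprn_ge0.
    by rewrite !mulr_ge0 ?exprn_ge0.
exists z.
  move=> i p; apply/is_derive_epsP => e e0.
  have [C C0 HC] := key (`|p.1| + `|p.2|) (addr_ge0 (normr_ge0 _) (normr_ge0 _)).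
  have C1 : 0 < C + 1 by lra.
  exists (Num.min 1 (e / (C + 1))); first by rewrite lt_min ltr01/= divr_gt0.
  move=> h; rewrite lt_min => /andP[h1 he].
  have := HC i p h (lexx _) (ltW h1); rewrite -surjective_pairing => K.
  apply: le_trans K _; rewrite expr2 mulrA ler_wpM2r//.
  apply: (@le_trans _ _ ((C + 1) * `|h|)); first by rewrite ler_wpM2r//; lra.
  by rewrite mulrC -ler_pdivlMr// ltW.
split.
- by case.
- case=> i /=.
    rewrite (_ : (fun p => _) = (fun p => quad (l i) (fun j => w j p))); first exact: chw.
    apply/funext => p; rewrite -(quad_prolong_inl l _ (fun j => z j p)); congr quad.
    by apply/funext; case.
  rewrite (_ : (fun p => _) = (fun p => polar (l i) (fun j => w j p) (fun j => z j p))); first exact: chz.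
  apply/funext => p; rewrite -quad_prolong_inr; congr quad.
  by apply/funext; case.
- by case=> i y /=; [exact: w0|exact: z0].
Qed.

End Prolongation.

Section PlaneSmooth.
Context {R : realType}.
Implicit Types (f g h : R * R -> R).

(** Smoothness on the whole plane with explicitly given partial derivatives, which suits
    induction; it implies [Ck] by [PCk_Ck]. *)
Fixpoint PCk (k : nat) f : Prop :=
  continuous f /\
  if k is k'.+1 then
    exists fx ft : R * R -> R,
      [/\ forall p, is_derive p.1 (1:R) (fun x => f (x, p.2)) (fx p),
          forall p, is_derive p.2 (1:R) (fun t => f (p.1, t)) (ft p),
          PCk k' fx & PCk k' ft]
  else True.

Lemma PCk_continuous k f : PCk k f -> continuous f.
Proof. by case: k => [|k] []. Qed.

Lemma PCk_weaken k f : PCk k.+1 f -> PCk k f.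
Proof.
elim: k f => [|k IH] f; first by case.
by move=> [cf [fx [ft [H1 H2 H3 H4]]]]; split => //; exists fx, ft; split => //; exact: IH.
Qed.

Lemma PCk_cst k (a : R) : PCk k (fun=> a).
Proof.
elim: k a => [|k IH] a; split; try by move=> p; exact: cvg_cst.
by [].
by exists (fun=> 0), (fun=> 0); split => // p; exact: is_derive_cst.
Qed.

Lemma PCkD k f g : PCk k f -> PCk k g -> PCk k (fun p => f p + g p).
Proof.
elim: k f g => [|k IH] f g [cf Hf] [cg Hg]; split; try by move=> p; apply: cvgD; [exact: cf|exact: cg].
by [].
move: Hf Hg => [fx [ft [f1 f2 f3 f4]]] [gx [gt [g1 g2 g3 g4]]].
exists (fun p => fx p + gx p), (fun p => ft p + gt p); split; last 2 first.
- exact: IH.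
- exact: IH.
- by move=> p; apply: is_deriveD.
- by move=> p; apply: is_deriveD.
Qed.

Lemma PCkM k f g : PCk k f -> PCk k g -> PCk k (fun p => f p * g p).
Proof.
elim: k f g => [|k IH] f g Pf Pg.
  by split => // p; apply: cvgM; [exact: (PCk_continuous Pf)|exact: (PCk_continuous Pg)].
have Pf' := PCk_weaken Pf; have Pg' := PCk_weaken Pg.
have [cf Hf] := Pf; have [cg Hg] := Pg.
split; first by move=> p; apply: cvgM; [exact: cf|exact: cg].
move: Hf Hg => [fx [ft [f1 f2 f3 f4]]] [gx [gt [g1 g2 g3 g4]]].
exists (fun p => f p * gx p + g p * fx p), (fun p => f p * gt p + g p * ft p); split; last 2 first.
- by apply: PCkD; exact: IH.
- by apply: PCkD; exact: IH.
- move=> p.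
  have := @is_deriveM _ _ (fun x => f (x, p.2)) (fun x => g (x, p.2)) p.1 1 (fx p) (gx p) (f1 p) (g1 p).
  by rewrite -!surjective_pairing.
- move=> p.
  have := @is_deriveM _ _ (fun x => f (p.1, x)) (fun x => g (p.1, x)) p.2 1 (ft p) (gt p) (f2 p) (g2 p).
  by rewrite -!surjective_pairing.
Qed.

Lemma PCkZ k (a : R) f : PCk k f -> PCk k (fun p => a * f p).
Proof. by apply: PCkM; exact: PCk_cst. Qed.

Lemma PCk_quad k (I : eqType) (l : seq (R * (I * I))) (w : I -> R * R -> R) :
  (forall j, PCk k (w j)) -> PCk k (fun p => quad l (fun j => w j p)).
Proof.
move=> H; elim: l => [|m l IH].
  rewrite (_ : (fun p => _) = cst 0); first exact: PCk_cst.
  by apply/funext => p; rewrite /quad big_nil.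
rewrite (_ : (fun p => _) = (fun p => m.1 * (w m.2.1 p * w m.2.2 p) + quad l (fun j => w j p))).
  by apply: PCkD => //; apply: PCkZ; apply: PCkM.
by apply/funext => p; rewrite /quad big_cons.
Qed.

(** A derivative along a characteristic and a continuous x-derivative give the t-derivative. *)
Lemma chard_dt (c : R) f fx h : `|c| <= 1 -> continuous fx ->
  (forall p, is_derive p.1 (1:R) (fun x => f (x, p.2)) (fx p)) ->
  chard c f h ->
  forall p, is_derive p.2 (1:R) (fun t => f (p.1, t)) (h p - c * fx p).
Proof.
move=> c1 cfx dfx ch p; apply/is_derive_epsP => e e0.
have e20 : 0 < e / 2 by lra.
have := ch (p.1 - c * p.2) p.2; rewrite subrK -surjective_pairing.
move=> /is_derive_epsP/(_ _ e20)[d1 d10 H1].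
have [d2 d20 H2] := (continuous2P fx p).1 (cfx p) _ e20.
exists (Num.min d1 d2); first by rewrite lt_min d10.
move=> k; rewrite lt_min => /andP[k1 k2].
have := H1 k k1.
rewrite (_ : p.1 - c * p.2 + c * (p.2 + k) = p.1 + c * k); last by ring.
rewrite subrK -surjective_pairing => A.
have ck : `|c * k| <= `|k| by rewrite normrM -[leRHS]mul1r ler_wpM2r.
have B : `|f (p.1 + c * k, p.2 + k) - f (p.1, p.2 + k) - c * k * fx p| <= e / 2 * `|c * k|.
  apply: (@taylor_bound R (fun x => f (x, p.2 + k)) (fun x => fx (x, p.2 + k)) p.1 (c * k)) => s sp.
    exact: (dfx (s, p.2 + k)).
  apply: H2 => /=; first by apply: le_lt_trans sp _; exact: le_lt_trans k2.
  by rewrite addrAC subrr add0r.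
have {}B : `|f (p.1 + c * k, p.2 + k) - f (p.1, p.2 + k) - c * k * fx p| <= e / 2 * `|k|.
  by apply: le_trans B _; rewrite ler_wpM2l// ltW.
have -> : f (p.1, p.2 + k) - f p - k * (h p - c * fx p) =
  (f (p.1 + c * k, p.2 + k) - f p - k * h p) - (f (p.1 + c * k, p.2 + k) - f (p.1, p.2 + k) - c * k * fx p).
  by ring.
by apply: le_trans (ler_normB _ _) _; rewrite (_ : e * `|k| = e / 2 * `|k| + e / 2 * `|k|); [exact: lerD|field].
Qed.

(** Induction on the order of smoothness, over all quadratic systems at once: the x-derivatives
    solve the prolonged system, and the equation expresses t-derivatives by x-derivatives. *)
Lemma quad_solution_smooth k (I : finType) (c : I -> R) (l : I -> seq (R * (I * I)))
    (d : nat -> I -> R -> R) (w : I -> R * R -> R) :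
  (forall i, `|c i| <= 1) ->
  (forall n i (x : R), is_derive x (1:R) (d n i) (d n.+1 i x)) ->
  quad_solution c l (d 0%N) w -> forall i, PCk k (w i).
Proof.
elim: k I c l d w => [|k IH] I c l d w c1 dd sol i.
  by split => //; case: sol.
have [z zx sol'] := quad_solution_prolong c1 (dd 0%N) (dd 1%N) (fun i => derive_continuous (dd 2%N i)) sol.
have S (j : I + I) : PCk k (join_fun w z j).
  apply: (IH _ _ _ (fun n => join_fun (d n) (d n.+1)) _ _ _ sol').
    by case.
  by move=> n [] a x /=; exact: dd.
have [cw chw _] := sol.
split; first exact: cw.
exists (z i), (fun p => quad (l i) (fun j => w j p) - c i * z i p); split.
- exact: zx.
- by apply: chard_dt => //; exact: PCk_continuous (S (inr i)).
- exact: (S (inr i)).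
- rewrite (_ : (fun p => _) = (fun p => quad (l i) (fun j => w j p) + - c i * z i p)).
    apply: PCkD; first by apply: PCk_quad => j; exact: (S (inl j)).
    by apply: PCkZ; exact: (S (inr i)).
  by apply/funext => p; rewrite mulNr.
Qed.

End PlaneSmooth.

(** * One-sided derivatives and cut-off functions *)

Section Halfplane.
Context {R : realType}.
Implicit Types (f g : R * R -> R) (p : R * R).

Let up_filter p : set_system R := within [set h : R | 0 <= p.2 + h] (0 : R)^'.

(** On the closed half plane increments of time may be restricted to one side, yet never vanish
    altogether. *)
Lemma up_filter_proper p : halfplane R p -> ProperFilter (up_filter p).
Proof.
rewrite /halfplane/= => p0; split; last exact: within_filter.
rewrite /up_filter /within /= => /nbhs_ballP[e /= e0 He].
apply: (He (e / 2)).
- by rewrite /ball/= sub0r normrN ger0_norm; lra.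
- by rewrite lt0r_neq0// divr_gt0.
- by rewrite addr_ge0// ltW// divr_gt0.
Qed.

Lemma t_quotients_ext f g p : halfplane R p -> (forall q, halfplane R q -> f q = g q) ->
  t_quotients f p = t_quotients g p.
Proof.
move=> p0 fg.
suff aux (f' g' : R * R -> R) : (forall q, halfplane R q -> f' q = g' q) ->
    t_quotients f' p `<=` t_quotients g' p.
  by apply/seteqP; split; apply: aux => // q q0; rewrite fg.
move=> f'g' A; rewrite /t_quotients /= /within/= => HA.
apply: (@filterS _ ((0 : R)^') _ _ _ _ HA) => h H h0.
by rewrite /= -!f'g'//; exact: H.
Qed.

Lemma dt_ext f g p : halfplane R p -> (forall q, halfplane R q -> f q = g q) -> dt f p = dt g p.
Proof. by move=> p0 fg; rewrite /dt (t_quotients_ext p0 fg). Qed.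

Lemma dx_ext f g p : halfplane R p -> (forall q, halfplane R q -> f q = g q) -> dx f p = dx g p.
Proof.
by move=> p0 fg; rewrite /dx (_ : (fun x => f (x, p.2)) = (fun x => g (x, p.2)))//; apply/funext => x; exact: fg.
Qed.

Lemma is_derive_t_quotients f p (l : R) : is_derive p.2 (1:R) (fun t => f (p.1, t)) l ->
  t_quotients f p --> l.
Proof.
move=> [df <-]; rewrite /t_quotients.
have : (fun h : R => h^-1 * (f (p.1, p.2 + h) - f p)) @ (0 : R)^' --> 'D_1 (fun t => f (p.1, t)) p.2.
  rewrite (_ : (fun h => _) = (fun h : R => h^-1 *: (f (p.1, h *: (1:R) + p.2) - f (p.1, p.2)))).
    exact: df.
  by apply/funext => h; rewrite [h *: _]mulr1 (addrC h) -surjective_pairing.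
apply: cvg_trans; apply: cvg_app; exact: cvg_within.
Qed.

Lemma is_derive_dt f p (l : R) : halfplane R p ->
  is_derive p.2 (1:R) (fun t => f (p.1, t)) l -> derivable_t f p /\ dt f p = l.
Proof.
move=> p0 /is_derive_t_quotients H.
have PF : ProperFilter (t_quotients f p) by apply: fmap_proper_filter; exact: up_filter_proper.
split; first by apply/cvg_ex; exists l.
by move: H PF; rewrite /dt /t_quotients => H PF; apply: (@cvg_lim _ (@Rhausdorff R) _ _ _ _ _ H); exact: up_filter_proper.
Qed.

Lemma is_derive_dx f p (l : R) :
  is_derive p.1 (1:R) (fun x => f (x, p.2)) l -> derivable_x f p /\ dx f p = l.
Proof. by move=> [H <-]; split => //; rewrite /dx derive1E. Qed.

Lemma Ck_ext k f g : (forall p, halfplane R p -> f p = g p) -> Ck k f -> Ck k g.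
Proof.
elim: k f g => [|k IH] f g fg.
  rewrite /Ck; apply: subspace_eq_continuous => p; rewrite inE; exact: fg.
move=> [H Hx Ht]; split.
- move=> p p0; have [Hx' Ht'] := H p p0; split.
    move: Hx'; rewrite /derivable_x (_ : (fun x => f (x, p.2)) = (fun x => g (x, p.2)))//.
    by apply/funext => x; exact: fg.
  by rewrite /derivable_t -(t_quotients_ext p0 fg).
- by apply: IH Hx => p p0; apply: dx_ext.
- by apply: IH Ht => p p0; apply: dt_ext.
Qed.

(** Two-sided derivatives on the plane agree with the possibly one-sided ones on the closed half
    plane. *)
Lemma PCk_Ck k f : PCk k f -> Ck k f.
Proof.
elim: k f => [|k IH] f [cf H]; first exact: continuous_subspaceT.
have [fx [ft [dfx dft Px Pt]]] := H.
split.
- by move=> p p0; split; [have [] := is_derive_dx (dfx p)|have [] := is_derive_dt p0 (dft p)].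
- rewrite (_ : dx f = fx); first exact: IH.
  by apply/funext => p; have [] := is_derive_dx (dfx p).
- apply: Ck_ext (IH _ Pt) => p p0.
  by have [_ ->] := is_derive_dt p0 (dft p).
Qed.

End Halfplane.

Section Truncation.
Context {R : realType}.

Definition clip (N x : R) : R := Num.max (- N) (Num.min N x).

Lemma clip_id (N x : R) : `|x| <= N -> clip N x = x.
Proof.
rewrite ler_norml => /andP[h1 h2]; rewrite /clip.
by rewrite (min_idPr h2) (max_idPr h1).
Qed.

Lemma clip_bound (N x : R) : 0 <= N -> `|clip N x| <= N.
Proof.
move=> N0; rewrite /clip ler_norml le_max lexx/= ge_max ge_min lexx/= andbT.
lra.
Qed.

Lemma max_lip (a x y : R) : `|Num.max a x - Num.max a y| <= `|x - y|.
Proof.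
have := ler_norm (x - y); have := ler_norm (y - x); rewrite (distrC y) => h1 h2.
rewrite ler_norml; case: (leP a x); case: (leP a y) => h3 h4; apply/andP; split; lra.
Qed.

Lemma min_lip (a x y : R) : `|Num.min a x - Num.min a y| <= `|x - y|.
Proof.
have := ler_norm (x - y); have := ler_norm (y - x); rewrite (distrC y) => h1 h2.
rewrite ler_norml; case: (leP a x); case: (leP a y) => h3 h4; apply/andP; split; lra.
Qed.

Lemma clip_lip (N x y : R) : `|clip N x - clip N y| <= `|x - y|.
Proof. exact: le_trans (max_lip _ _ _) (min_lip _ _ _). Qed.

(** A real factor that makes [damp M x y * x] and [damp M x y * y] bounded by [M] while it
    preserves the phase of [x + i y]. *)
Definition damp (M x y : R) : R := M / Num.max M (`|x| + `|y|).

Lemma damp_id (M x y : R) : 0 < M -> `|x| + `|y| <= M -> damp M x y = 1.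
Proof. by move=> M0 H; rewrite /damp (max_idPl H) divff// lt0r_neq0. Qed.

Lemma damp_bound (M x y : R) : 0 < M -> `|damp M x y * x| <= M.
Proof.
move=> M0; rewrite /damp.
have m0 : 0 < Num.max M (`|x| + `|y|) by rewrite lt_max M0.
rewrite normrM normrM normfV (gtr0_norm M0) (gtr0_norm m0) mulrAC -mulrA.
rewrite -[leRHS]mulr1 ler_wpM2l ?(ltW M0)// ler_pdivrMr// mul1r le_max.
by apply/orP; right; rewrite lerDl.
Qed.

Lemma dampC (M x y : R) : damp M x y = damp M y x.
Proof. by rewrite /damp addrC. Qed.

Lemma damp_lip (M x y x' y' D : R) : 0 < M -> `|x - x'| <= D -> `|y - y'| <= D ->
  `|damp M x y * x - damp M x' y' * x'| <= 3 * D.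
Proof.
move=> M0 hx hy; rewrite /damp.
set m := Num.max M (`|x| + `|y|); set m' := Num.max M (`|x'| + `|y'|).
have m0 : 0 < m by rewrite lt_max M0.
have m0' : 0 < m' by rewrite lt_max M0.
have Mm : M <= m by rewrite le_max lexx.
have x'm' : `|x'| <= m' by rewrite le_max lerDl normr_ge0 orbT.
have dm : `|m - m'| <= 2 * D.
  apply: le_trans (max_lip _ _ _) _.
  have := ler_dist_dist x x'; have := ler_dist_dist y y' => h1 h2.
  have := ler_normD (`|x| - `|x'|) (`|y| - `|y'|).
  rewrite (_ : `|x| - `|x'| + (`|y| - `|y'|) = `|x| + `|y| - (`|x'| + `|y'|)); last by ring.
  lra.
have -> : M / m * x - M / m' * x' = (M / m) * (x - x') + (M / m) * (x' / m') * (m' - m).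
  by field; rewrite !lt0r_neq0.
have r1 : `|M / m| <= 1.
  by rewrite normrM normfV (gtr0_norm M0) (gtr0_norm m0) ler_pdivrMr// mul1r.
have r2 : `|x' / m'| <= 1.
  by rewrite normrM normfV (gtr0_norm m0') ler_pdivrMr// mul1r.
apply: le_trans (ler_normD _ _) _; rewrite (_ : 3 * D = D + 2 * D); last by ring.
apply: lerD.
  rewrite normrM; apply: le_trans hx; rewrite -[leRHS]mul1r; exact: ler_wpM2r.
rewrite normrM distrC; apply: le_trans dm; rewrite -[leRHS]mul1r; apply: ler_wpM2r => //.
by rewrite normrM -[leRHS]mul1r; apply: ler_pM.
Qed.

Lemma mul_lip (x y x' y' X Y D E : R) : `|x| <= X -> `|y'| <= Y -> `|x - x'| <= D -> `|y - y'| <= E ->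
  `|x * y - x' * y'| <= X * E + Y * D.
Proof.
move=> hx hy hd he.
have -> : x * y - x' * y' = x * (y - y') + y' * (x - x') by ring.
by apply: le_trans (ler_normD _ _) _; rewrite !normrM; apply: lerD; apply: ler_pM.
Qed.

Lemma clip_continuous (T : topologicalType) (N f : T -> R) : continuous N -> continuous f ->
  continuous (fun p => clip (N p) (f p)).
Proof.
move=> cN cf p.
apply: (@continuous_max _ _ (fun p => - N p) (fun p => Num.min (N p) (f p))).
  by apply: cvgN; exact: cN.
by apply: (@continuous_min _ _ N f); [exact: cN|exact: cf].
Qed.

Lemma damp_continuous (T : topologicalType) (M f g : T -> R) : continuous M -> (forall p, 0 < M p) ->
  continuous f -> continuous g -> continuous (fun p => damp (M p) (f p) (g p)).
Proof.
move=> cM M0 cf cg p; apply: cvgM; first exact: cM.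
apply: cvgV; first by rewrite lt0r_neq0// lt_max M0.
apply: (@continuous_max _ _ M (fun p => `|f p| + `|g p|)); first exact: cM.
by apply: cvgD; apply: cvg_norm; [exact: cf|exact: cg].
Qed.

End Truncation.

Local Open Scope complex_scope.

(** * The Maxwell-Dirac system in characteristic form *)

Lemma sqr_le (R : realDomainType) (x y : R) : `|x| <= y -> x ^+ 2 <= y ^+ 2.
Proof.
move=> h; have y0 : 0 <= y by exact: le_trans h.
by rewrite -(real_normK (num_real x)) lerXn2r ?nnegrE.
Qed.

Section DiracSystem.
Context {R : realType}.
Context (m : R).

(** The unknowns in characteristic form. For a sign [s], the components [iRe s] and [iIm s] are
    the real and imaginary part of [u_s = Psi_1 + s Psi_2], the component [iB s] is [B_s = A_0 +
    s A_1], and [iP s] is the derivative of [B_s] along the lines of speed [- s], so that the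
    wave equation splits into two transport equations. The constant component [iOne] makes
    linear terms quadratic. *)
Definition idx : finType := option (bool * (bool * bool)).
Definition iRe (s : bool) : idx := Some (s, (false, false)).
Definition iIm (s : bool) : idx := Some (s, (false, true)).
Definition iB (s : bool) : idx := Some (s, (true, false)).
Definition iP (s : bool) : idx := Some (s, (true, true)).
Definition iOne : idx := None.

Definition sg (s : bool) : R := if s then 1 else -1.

Lemma sg_norm s : `|sg s| <= 1.
Proof. by case: s; rewrite /sg ?normrN normr1. Qed.

(** [u_s] and [iP s] travel with speed [s], and [B_s] with speed [- s]. *)
Definition speed (i : idx) : R :=
  match i with
  | Some (s, (false, _)) => sg s
  | Some (s, (true, b)) => if b then sg s else - sg s
  | None => 0
  end.

Lemma speed_norm i : `|speed i| <= 1.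
Proof.
case: i => [[s [[] b]]|] /=; last by rewrite normr0.
  by case: b; rewrite ?normrN sg_norm.
exact: sg_norm.
Qed.

(** The equations are [(dt + s dx) u_s = i m u_(-s) + i B_s u_s], [(dt - s dx) B_s = P_s] and
    [(dt + s dx) P_s = |u_(-s)| ^ 2]. *)
Definition md_form (i : idx) : seq (R * (idx * idx)) :=
  match i with
  | Some (s, (false, false)) => [:: (- m, (iOne, iIm (~~ s))); (- 1, (iB s, iIm s))]
  | Some (s, (false, true)) => [:: (m, (iOne, iRe (~~ s))); (1, (iB s, iRe s))]
  | Some (s, (true, false)) => [:: (1, (iOne, iP s))]
  | Some (s, (true, true)) => [:: (1, (iRe (~~ s), iRe (~~ s))); (1, (iIm (~~ s), iIm (~~ s)))]
  | None => [::]
  end.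

Section Existence.
Context (d : idx -> R -> R) (G : R -> R).
Context (d_continuous : forall i, continuous (d i)) (d1 : forall y, d iOne y = 1).
Context (G_continuous : continuous G) (G_ge0 : forall L, 0 <= L -> 0 <= G L).
Context (G_mono : forall L L', 0 <= L -> L <= L' -> G L <= G L').
Context (G_bound : forall i L y, `|y| <= L -> `|d i y| <= G L).

(* [rate] is the growth rate of the squares of the spinor; [spinor_cap L] exceeds the resulting
   bound on [|Re u_s| + |Im u_s|] in the cone of radius [L], and [potential_cap L] comes from
   integrating the equations of [P_s] and of [B_s] over times up to [L]. *)
Let rate := 2 * `|m| + 1.
Let spinor_cap (L : R) := 1 + 4 * G L ^+ 2 * expR (2 * rate * L).
Let potential_cap (L : R) := G L + (G L + 2 * spinor_cap L ^+ 2 * L) * L.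
Let radius (p : R * R) := `|p.1| + `|p.2|.

Let damped (p : R * R) (a : idx -> R) (s : bool) (i : idx) : R :=
  damp (spinor_cap (radius p)) (a (iRe s)) (a (iIm s)) * a i.

Let capped_source (i : idx) (p : R * R) (a : idx -> R) : R :=
  match i with
  | Some (s, (false, false)) =>
      - m * a (iIm (~~ s)) - clip (potential_cap (radius p)) (a (iB s)) * damped p a s (iIm s)
  | Some (s, (false, true)) =>
      m * a (iRe (~~ s)) + clip (potential_cap (radius p)) (a (iB s)) * damped p a s (iRe s)
  | Some (s, (true, false)) => a (iP s)
  | Some (s, (true, true)) =>
      damped p a (~~ s) (iRe (~~ s)) ^+ 2 + damped p a (~~ s) (iIm (~~ s)) ^+ 2
  | None => 0
  end.

Lemma rate_gt0 : 0 < rate.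
Proof. by rewrite /rate; have := normr_ge0 m; lra. Qed.

Lemma radius_ge0 p : 0 <= radius p.
Proof. by rewrite addr_ge0. Qed.

Lemma spinor_cap_ge1 L : 1 <= spinor_cap L.
Proof. by rewrite lerDl mulr_ge0 ?expR_ge0// mulr_ge0// sqr_ge0. Qed.

Lemma spinor_cap_gt0 L : 0 < spinor_cap L.
Proof. exact: lt_le_trans (spinor_cap_ge1 L). Qed.

Lemma spinor_cap_mono L L' : 0 <= L -> L <= L' -> spinor_cap L <= spinor_cap L'.
Proof.
move=> L0 LL'; rewrite lerD2l; apply: ler_pM.
- by rewrite mulr_ge0 ?sqr_ge0.
- exact: expR_ge0.
- by rewrite ler_wpM2l// lerXn2r ?nnegrE ?G_ge0 ?G_mono//; exact: le_trans LL'.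
- by rewrite ler_expR ler_wpM2l// mulr_ge0// ltW// rate_gt0.
Qed.

Lemma potential_cap_ge0 L : 0 <= L -> 0 <= potential_cap L.
Proof.
move=> L0; have g0 := G_ge0 L0.
by rewrite /potential_cap !(addr_ge0, mulr_ge0)// sqr_ge0.
Qed.

Lemma potential_cap_mono L L' : 0 <= L -> L <= L' -> potential_cap L <= potential_cap L'.
Proof.
move=> L0 LL'; have g0 := G_ge0 L0; have L0' : 0 <= L' by exact: le_trans LL'.
have m0 := ltW (spinor_cap_gt0 L).
have gg := G_mono L0 LL'.
rewrite /potential_cap lerD//; apply: ler_pM => //.
  by rewrite !(addr_ge0, mulr_ge0)// sqr_ge0.
rewrite lerD//; apply: ler_pM => //; first by rewrite mulr_ge0// sqr_ge0.
by rewrite ler_wpM2l// lerXn2r ?nnegrE ?spinor_cap_mono// ltW// spinor_cap_gt0.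
Qed.

Lemma radius_continuous : continuous radius.
Proof. by move=> p; apply: cvgD; apply: cvg_norm; [exact: cvg_fst|exact: cvg_snd]. Qed.

Lemma spinor_cap_continuous : continuous spinor_cap.
Proof.
move=> x; apply: cvgD; first exact: cvg_cst.
apply: cvgM.
  by apply: cvgM; [exact: cvg_cst|apply: cvgM; exact: G_continuous].
apply: (@continuous_comp _ _ _ (fun x => 2 * rate * x) expR); last exact: continuous_expR.
by apply: cvgM; [exact: cvg_cst|exact: cvg_id].
Qed.

Lemma potential_cap_continuous : continuous potential_cap.
Proof.
move=> x; apply: cvgD; first exact: G_continuous.
apply: cvgM; last exact: cvg_id.
apply: cvgD; first exact: G_continuous.
apply: cvgM; last exact: cvg_id.
by apply: cvgM; [exact: cvg_cst|apply: cvgM; exact: spinor_cap_continuous].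
Qed.

Lemma capped_source_continuous (w : idx -> R * R -> R) : (forall j, continuous (w j)) ->
  forall i, continuous (fun p => capped_source i p (fun j => w j p)).
Proof.
move=> cw.
have cM : continuous (fun p => spinor_cap (radius p)).
  by move=> p; apply: (@continuous_comp _ _ _ radius spinor_cap); [exact: radius_continuous|exact: spinor_cap_continuous].
have cN : continuous (fun p => potential_cap (radius p)).
  by move=> p; apply: (@continuous_comp _ _ _ radius potential_cap); [exact: radius_continuous|exact: potential_cap_continuous].
have cD s : continuous (fun p => damp (spinor_cap (radius p)) (w (iRe s) p) (w (iIm s) p)).
  by apply: damp_continuous => //; move=> q; exact: spinor_cap_gt0.
have cT s i : continuous (fun p => damped p (fun j => w j p) s i).
  by move=> p; apply: cvgM; [exact: cD|exact: cw].
have cC s : continuous (fun p => clip (potential_cap (radius p)) (w (iB s) p)) by exact: clip_continuous.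
case=> [[s [[] []]]|] p; rewrite /capped_source.
- by apply: cvgD; apply: cvgM; exact: cT.
- exact: cw.
- apply: cvgD; apply: cvgM; [exact: cvg_cst|exact: cw|exact: cC|exact: cT].
- apply: cvgB; apply: cvgM; [exact: cvg_cst|exact: cw|exact: cC|exact: cT].
- exact: cvg_cst.
Qed.

Lemma capped_source_lipschitz L : exists2 C : R, 0 < C & forall i p (a b : idx -> R) (D : R),
  cone L p -> (forall j, `|a j - b j| <= D) -> `|capped_source i p a - capped_source i p b| <= C * D.
Proof.
exists (`|m| + 1 + 3 * `|potential_cap L| + 13 * `|spinor_cap L|).
  by have := normr_ge0 m; have := normr_ge0 (potential_cap L); have := normr_ge0 (spinor_cap L); lra.
move=> i p a b D pL H.
have D0 : 0 <= D by exact: le_trans (normr_ge0 _) (H i).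
have r0 := radius_ge0 p.
have rL : radius p <= L by exact: pL.
have M0 := spinor_cap_gt0 (radius p); have N0 := potential_cap_ge0 r0.
have MM : spinor_cap (radius p) <= `|spinor_cap L| by apply: le_trans (spinor_cap_mono r0 rL) (ler_norm _).
have NN : potential_cap (radius p) <= `|potential_cap L| by apply: le_trans (potential_cap_mono r0 rL) (ler_norm _).
have tb (x : idx -> R) s : `|damped p x s (iRe s)| <= spinor_cap (radius p) /\ `|damped p x s (iIm s)| <= spinor_cap (radius p).
  by split; rewrite /damped; [|rewrite dampC]; exact: damp_bound.
have tl s : `|damped p a s (iRe s) - damped p b s (iRe s)| <= 3 * D /\
            `|damped p a s (iIm s) - damped p b s (iIm s)| <= 3 * D.
  by split; rewrite /damped; [|rewrite dampC (dampC _ (b _))]; exact: damp_lip.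
have cl s : `|clip (potential_cap (radius p)) (a (iB s)) - clip (potential_cap (radius p)) (b (iB s))| <= D.
  exact: le_trans (clip_lip _ _ _) (H _).
have cb s : `|clip (potential_cap (radius p)) (a (iB s))| <= potential_cap (radius p) by exact: clip_bound.
have mD : 0 <= `|m| * D by rewrite mulr_ge0.
have MD : spinor_cap (radius p) * D <= `|spinor_cap L| * D by rewrite ler_wpM2r.
have ND : potential_cap (radius p) * D <= `|potential_cap L| * D by rewrite ler_wpM2r.
have MD0 : 0 <= spinor_cap (radius p) * D by rewrite mulr_ge0// ltW.
have ND0 : 0 <= potential_cap (radius p) * D by rewrite mulr_ge0.
have mm s (k : bool -> idx) : `|m * a (k s) - m * b (k s)| <= `|m| * D.
  by rewrite -mulrBr normrM ler_wpM2l.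
case: i => [[s [[] []]]|]; rewrite /capped_source.
- have [t1 t2] := tb a (~~ s); have [t1' t2'] := tb b (~~ s); have [l1 l2] := tl (~~ s).
  have := mul_lip t1 t1' l1 l1; have := mul_lip t2 t2' l2 l2; rewrite -!expr2.
  set x := damped _ _ _ _; set y := damped _ _ _ _; set x' := damped _ _ _ _; set y' := damped _ _ _ _.
  move=> h1 h2; have := ler_normD (x' ^+ 2 - y' ^+ 2) (x ^+ 2 - y ^+ 2).
  rewrite (_ : _ - _ + (_ - _) = x' ^+ 2 + x ^+ 2 - (y' ^+ 2 + y ^+ 2)); last by ring.
  lra.
- have := H (iP s); lra.
- have [t1 t2] := tb b s; have [l1 l2] := tl s.
  have := mul_lip (cb s) t1 (cl s) l1.
  set x := clip _ _ * _; set y := clip _ _ * _ => h1.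
  have := ler_normD (m * a (iRe (~~ s)) - m * b (iRe (~~ s))) (x - y).
  rewrite (_ : _ - _ + (_ - _) = m * a (iRe (~~ s)) + x - (m * b (iRe (~~ s)) + y)); last by ring.
  have := mm (~~ s) iRe; lra.
- have [t1 t2] := tb b s; have [l1 l2] := tl s.
  have := mul_lip (cb s) t2 (cl s) l2.
  set x := clip _ _ * _; set y := clip _ _ * _ => h1.
  have := ler_normD (m * a (iIm (~~ s)) - m * b (iIm (~~ s))) (x - y).
  rewrite (_ : _ - _ + (_ - _) = - (- m * a (iIm (~~ s)) - x - (- m * b (iIm (~~ s)) - y))); last by ring.
  rewrite normrN; have := mm (~~ s) iIm; lra.
- by rewrite subrr normr0 mulr_ge0// !addr_ge0// mulr_ge0.
Qed.

(** The source is capped so that it is globally Lipschitz on cones and [picard] applies. The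
    damping factor is real, so the capped potential still only rotates the phase of [u_s]: in
    the equations for the squares [|u_s| ^ 2] only the coupling by [m] remains, and Gronwall's
    inequality bounds them in terms of the data alone. Two integrations then bound [P_s] and
    [B_s]. The caps are chosen above these bounds, so they are never active and the capped
    solution solves the original system. *)
Lemma md_quad_solution : exists w, quad_solution speed md_form d w.
Proof.
have [w [cw chw w0]] := picard speed_norm capped_source_continuous capped_source_lipschitz d_continuous.
pose e s p := w (iRe s) p ^+ 2 + w (iIm s) p ^+ 2.
have ce s : continuous (e s) by move=> p; apply: cvgD; apply: cvgM; exact: cw.
have che s : chard (sg s) (e s)
    (fun p => 2 * m * (w (iIm s) p * w (iRe (~~ s)) p - w (iRe s) p * w (iIm (~~ s)) p)).
  have := chardD (chardM (chw (iRe s)) (chw (iRe s))) (chardM (chw (iIm s)) (chw (iIm s))).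
  move=> H; apply: chard_ext H _ _ => p; first by rewrite /e !expr2.
  by rewrite /capped_source/= /damped; ring.
have e_bound L p s : 0 <= L -> cone L p -> e s p <= 4 * G L ^+ 2 * expR (2 * rate * L).
  move=> L0 pL; have G20 : 0 <= G L ^+ 2 by exact: sqr_ge0.
  have := @cone_gronwall R bool sg e _ L rate 0 (2 * G L ^+ 2) sg_norm rate_gt0 (lexx _) _ L0 ce che _ _ s p pL.
  rewrite mul0r addr0 => B; apply: (le_trans (ler_norm _)); apply: le_trans (B _ _ _) _.
  - by rewrite mulr_ge0.
  - move=> j q D qL HD; rewrite addr0 /rate.
    have D0 : 0 <= D by exact: le_trans (normr_ge0 _) (HD j).
    have h1 := le_trans (ler_norm _) (HD j); have h2 := le_trans (ler_norm _) (HD (~~ j)).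
    rewrite -mulrA normrM normrM (ger0_norm (x := 2))//.
    apply: (@le_trans _ _ (2 * (`|m| * D))); last by lra.
    rewrite ler_wpM2l// ler_wpM2l//.
    move: h1 h2; rewrite /e; set x := w (iRe j) q; set y := w (iIm j) q; set x' := w _ q; set y' := w _ q => h1 h2.
    have := sqr_ge0 (y - x'); have := sqr_ge0 (y + x'); have := sqr_ge0 (x - y'); have := sqr_ge0 (x + y').
    rewrite !sqrrD !sqrrN !mulrN => a1 a2 a3 a4.
    by rewrite ler_norml; apply/andP; split; lra.
  - move=> j y yL; rewrite /e !w0 ger0_norm ?addr_ge0 ?sqr_ge0//.
    have g0 : 0 <= G L by exact: G_ge0.
    have sq i : d i y ^+ 2 <= G L ^+ 2.
      by apply: sqr_le; exact: G_bound.
    by have := sq (iRe j); have := sq (iIm j); lra.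
  - rewrite mulrA (_ : 2 * 2 = 4); last by ring.
    apply: ler_wpM2l; first by rewrite mulr_ge0 ?G20.
    by rewrite ler_expR ler_wpM2l ?(cone_time pL)// mulr_ge0// ltW// rate_gt0.
have amp p s : `|w (iRe s) p| + `|w (iIm s) p| <= spinor_cap (radius p).
  have := e_bound (radius p) p s (radius_ge0 p) (lexx _); rewrite /spinor_cap /e.
  set E := _ * expR _; rewrite -(real_normK (num_real (w (iRe s) p))) -(real_normK (num_real (w (iIm s) p))).
  have := sqr_ge0 (`|w (iRe s) p| - 1); have := sqr_ge0 (`|w (iIm s) p| - 1).
  rewrite !sqrrB1 => h1 h2 h3.
  have := sqr_ge0 (`|w (iIm s) p|); have := sqr_ge0 (`|w (iRe s) p|); lra.
have tid p s i : damped p (fun j => w j p) s i = w i p.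
  by rewrite /damped damp_id ?mul1r ?spinor_cap_gt0// amp.
have P_bound L p s : 0 <= L -> cone L p -> `|w (iP s) p| <= G L + 2 * spinor_cap L ^+ 2 * L.
  move=> L0 pL.
  have := @chard_bound R (sg s) (w (iP s)) _ L 0 1 (2 * spinor_cap L ^+ 2) (G L) (sg_norm s) ltr01 (lexx _) _ (chw (iP s)).
  move=> B; have := B _ _ _ p pL; rewrite !mul0r addr0; apply.
  - by rewrite mulr_ge0// sqr_ge0.
  - move=> q qL; rewrite mul0r add0r /capped_source/= ger0_norm ?addr_ge0 ?sqr_ge0//.
    have sq i : `|damped q (fun j => w j q) (~~ s) i| <= spinor_cap (radius q) ->
       damped q (fun j => w j q) (~~ s) i ^+ 2 <= spinor_cap L ^+ 2.
      move=> h; apply: sqr_le; apply: le_trans h _; apply: spinor_cap_mono; [exact: radius_ge0|exact: qL].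
    have s1 : damped q (fun j => w j q) (~~ s) (iRe (~~ s)) ^+ 2 <= spinor_cap L ^+ 2.
      by apply: sq; apply: damp_bound; exact: spinor_cap_gt0.
    have s2 : damped q (fun j => w j q) (~~ s) (iIm (~~ s)) ^+ 2 <= spinor_cap L ^+ 2.
      by apply: sq; rewrite /damped dampC; apply: damp_bound; exact: spinor_cap_gt0.
    lra.
  - by move=> y yL; rewrite w0 G_bound.
have B_bound p s : `|w (iB s) p| <= potential_cap (radius p).
  have L0 := radius_ge0 p; set L := radius p in L0 *.
  have s1 : `|- sg s| <= 1 by rewrite normrN sg_norm.
  have := @chard_bound R (- sg s) (w (iB s)) _ L 0 1 (G L + 2 * spinor_cap L ^+ 2 * L) (G L) s1 ltr01 (lexx _) _ (chw (iB s)).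
  move=> B; have := B _ _ _ p (lexx _); rewrite !mul0r addr0; apply.
  - by rewrite addr_ge0 ?G_ge0// mulr_ge0// mulr_ge0// sqr_ge0.
  - by move=> q qL; rewrite mul0r add0r /capped_source/=; exact: P_bound.
  - by move=> y yL; rewrite w0 G_bound.
have one : forall p, w iOne p = 1.
  by apply: (chard_const (chw iOne)) => y; rewrite w0.
exists w; split => // i; apply: chard_ext (chw i) _ _ => // p.
case: i => [[s [[] []]]|]; rewrite /capped_source /quad /= ?big_cons ?big_nil/= ?tid ?one ?clip_id ?B_bound//; ring.
Qed.

End Existence.
End DiracSystem.

(** * Smooth solutions with polynomial data *)

Section PolynomialMajorant.
Context {R : realType}.

(** The caps must be continuous and monotone in the radius of the cone; replacing [sup |p|] by
    the polynomial with absolute coefficients achieves that. *)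
Lemma poly_majorant (p : {poly R}) : exists G : R -> R,
  [/\ continuous G, forall L, 0 <= L -> 0 <= G L,
      forall L L', 0 <= L -> L <= L' -> G L <= G L' &
      forall L y, `|y| <= L -> `|p.[y]| <= G L].
Proof.
elim/poly_ind: p => [|p c [G [cG G0 Gm Gb]]].
  by exists (fun=> 0); split => // [L|L y _]; [exact: cvg_cst|rewrite horner0 normr0].
exists (fun L => G L * L + `|c|); split.
- move=> L; apply: cvgD; last exact: cvg_cst.
  by apply: cvgM; [exact: cG|exact: cvg_id].
- by move=> L L0; rewrite addr_ge0// mulr_ge0// G0.
- move=> L L' L0 LL'; rewrite lerD2r; apply: ler_pM => //; [exact: G0|exact: Gm].
- move=> L y yL; rewrite hornerD hornerM hornerX hornerC.
  apply: le_trans (ler_normD _ _) _; rewrite lerD2r normrM; apply: ler_pM => //; exact: Gb.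
Qed.

Lemma poly_majorant_fin (I : finType) (p : I -> {poly R}) : exists G : R -> R,
  [/\ continuous G, forall L, 0 <= L -> 0 <= G L,
      forall L L', 0 <= L -> L <= L' -> G L <= G L' &
      forall i L y, `|y| <= L -> `|(p i).[y]| <= G L].
Proof.
have /choice[G HG] := fun i => poly_majorant (p i).
exists (fun L => \sum_i G i L); split.
- apply: sum_continuous => i; by case: (HG i).
- by move=> L L0; apply: sumr_ge0 => i _; case: (HG i) => _ + _ _; apply.
- by move=> L L' L0 LL'; apply: ler_sum => i _; case: (HG i) => _ _ + _; apply.
- move=> i L y yL; have [_ _ _ +] := HG i => /(_ L y yL) => H; apply: le_trans H _.
  have L0 : 0 <= L by exact: le_trans yL.
  by rewrite (bigD1 i)//= lerDl sumr_ge0// => j _; case: (HG j) => _ + _ _; apply.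
Qed.

End PolynomialMajorant.

Section SmoothExistence.
Context {R : realType}.
Context (m : R).

(** The solution in characteristic form together with its first and second x-derivatives,
    obtained by prolonging the system twice. *)
Lemma md_regular (q : idx -> {poly R}) : q iOne = 1%:P ->
  exists (w z y : idx -> R * R -> R),
  [/\ forall k i, PCk k (w i),
      forall i p, is_derive p.1 (1:R) (fun x => w i (x, p.2)) (z i p) /\
        is_derive p.2 (1:R) (fun t => w i (p.1, t)) (quad (md_form m i) (fun j => w j p) - speed i * z i p),
      forall i p, is_derive p.1 (1:R) (fun x => z i (x, p.2)) (y i p) /\
        is_derive p.2 (1:R) (fun t => z i (p.1, t))
          (polar (md_form m i) (fun j => w j p) (fun j => z j p) - speed i * y i p),
      forall i x, w i (x, 0) = (q i).[x] &
      (forall p, w iOne p = 1) /\ (forall p, z iOne p = 0)].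
Proof.
move=> q1.
pose d n i (x : R) := (q i)^`(n).[x].
have dd n i (x : R) : is_derive x (1:R) (d n i) (d n.+1 i x).
  by rewrite /d derivnS; exact: is_derive_poly.
have [G [cG G0 Gm Gb]] := poly_majorant_fin q.
have cd0 i : continuous (d 0%N i) by exact: derive_continuous (dd 0%N i).
have one y : d 0%N iOne y = 1 by rewrite /d derivn0 q1 hornerC.
have bd i L y : `|y| <= L -> `|d 0%N i y| <= G L by rewrite /d derivn0; exact: Gb.
have [w sol] := md_quad_solution m cd0 one cG G0 Gm bd.
have c1 : forall i, `|speed i| <= 1 :> R := @speed_norm R.
have [z zx sol1] := quad_solution_prolong c1 (dd 0%N) (dd 1%N) (fun i => derive_continuous (dd 2%N i)) sol.
have c2 i : `|join_fun speed speed i| <= 1 :> R by case: i => i; exact: speed_norm.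
have dd1 n i (x : R) : is_derive x (1:R) (join_fun (d n) (d n.+1) i) (join_fun (d n.+1) (d n.+2) i x).
  by case: i => i; exact: dd.
have [y yx sol2] := quad_solution_prolong c2 (dd1 0%N) (dd1 1%N) (fun i => derive_continuous (dd1 2%N i)) sol1.
have Pw k i : PCk k (w i) by exact: (quad_solution_smooth k c1 dd sol).
have [cw chw w0] := sol; have [cz chz z0] := sol1; have [cy _ _] := sol2.
have w1 : forall p, w iOne p = 1.
  apply: (@chard_const _ 0) => [|x]; last by rewrite w0 one.
  by apply: chard_ext (chw iOne) _ _ => // r; rewrite /quad big_nil.
exists w, z, (fun i => y (inr i)); split => //.
- move=> i p; split; first exact: zx.
  by apply: (chard_dt (c1 i) (cz (inr i)) (zx i) (chw i)).
- move=> i p; split; first exact: (yx (inr i)).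
  have := chard_dt (c1 i) (cy (inr (inr i))) (yx (inr i)) (chz (inr i)) p.
  rewrite /= (_ : quad _ _ = polar (md_form m i) (w^~ p) (z^~ p))//.
  rewrite -quad_prolong_inr; congr quad; by apply/funext; case.
- split => // p.
  have [_ <-] := zx iOne p.
  rewrite (_ : (fun x => w iOne (x, p.2)) = cst 1); first by rewrite derive_cst.
  by apply/funext => x; rewrite w1.
Qed.

Lemma is_derive_comb (f g : R -> R) (k l x a b : R) : is_derive x (1:R) f a -> is_derive x (1:R) g b ->
  is_derive x (1:R) (fun y => k * f y + l * g y) (k * a + l * b).
Proof. by move=> df dg; apply: is_deriveD; exact: is_deriveZ. Qed.

Lemma PCk_comb n (f g : R * R -> R) (k l : R) : PCk n f -> PCk n g -> PCk n (fun p => k * f p + l * g p).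
Proof. by move=> Pf Pg; apply: PCkD; exact: PCkZ. Qed.

(** Return from characteristic variables: [Psi_1], [Psi_2] are half the sum and half the
    difference of [u_+] and [u_-], and likewise for the potentials. *)
Theorem smooth_solution_exists (qa qb qc qd : {poly R}) (q0 q1 : 'I_2 -> {poly R}) :
  exists (Psi : R * R -> spinor R) (A : 'I_2 -> R * R -> R),
  [/\ smooth_solution m Psi A,
      forall x, Psi (x, 0) = (qa.[x] +i* qb.[x], qc.[x] +i* qd.[x]),
      forall mu x, A mu (x, 0) = (q0 mu).[x] &
      forall mu x, dt (A mu) (x, 0) = (q1 mu).[x]].
Proof.
pose h : R := 2^-1.
have hE : h = 2^-1 by [].
pose e (s : bool) : R := sg s.
pose q (i : idx) : {poly R} :=
  match i with
  | Some (s, (false, false)) => qa + e s *: qc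
  | Some (s, (false, true)) => qb + e s *: qd
  | Some (s, (true, false)) => q0 0 + e s *: q0 1
  | Some (s, (true, true)) => q1 0 + e s *: q1 1 - e s *: (q0 0 + e s *: q0 1)^`()
  | None => 1%:P
  end.
have [w [z [y [Pw dw dz w0 [w1 z1]]]]] := @md_regular q (erefl _).
pose comb (l : R) (k : bool -> idx) (p : R * R) := h * w (k true) p + l * h * w (k false) p.
pose Psi p : spinor R := (comb 1 iRe p +i* comb 1 iIm p, comb (-1) iRe p +i* comb (-1) iIm p).
pose sgn (mu : 'I_2) : R := if mu == 0 then 1 else -1.
pose A (mu : 'I_2) := comb (sgn mu) iB.
have Pc n l k : PCk n (comb l k) by apply: PCk_comb; exact: Pw.
have cdx l k p : dx (comb l k) p = h * z (k true) p + l * h * z (k false) p.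
  by have [_ ->] := @is_derive_dx _ (comb l k) p _ (is_derive_comb h (l * h) (proj1 (dw (k true) p)) (proj1 (dw (k false) p))).
have cdt l k p : halfplane R p -> dt (comb l k) p =
    h * (quad (md_form m (k true)) (fun j => w j p) - speed (k true) * z (k true) p)
    + l * h * (quad (md_form m (k false)) (fun j => w j p) - speed (k false) * z (k false) p).
  move=> p0.
  by have [_ ->] := @is_derive_dt _ (comb l k) p _ p0 (is_derive_comb h (l * h) (proj2 (dw (k true) p)) (proj2 (dw (k false) p))).
have quadB s p : quad (md_form m (iB s)) (fun j => w j p) = w (iP s) p.
  by rewrite /quad/= big_cons big_nil/= w1; ring.
have box_comb l p : halfplane R p -> box (comb l iB) p =
    h * (w (iRe false) p ^+ 2 + w (iIm false) p ^+ 2) + l * h * (w (iRe true) p ^+ 2 + w (iIm true) p ^+ 2).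
  move=> p0; rewrite /box.
  have E1 r : halfplane R r -> dt (comb l iB) r =
      (h * w (iP true) r + l * h * w (iP false) r) + (h * z (iB true) r + - (l * h) * z (iB false) r).
    by move=> r0; rewrite cdt// !quadB /=; ring.
  rewrite (dt_ext p0 E1).
  have D1 := is_derive_comb h (l * h) (proj2 (dw (iP true) p)) (proj2 (dw (iP false) p)).
  have D2 := is_derive_comb h (- (l * h)) (proj2 (dz (iB true) p)) (proj2 (dz (iB false) p)).
  have [_ ->] := @is_derive_dt _ (fun r => (h * w (iP true) r + l * h * w (iP false) r) +
    (h * z (iB true) r + - (l * h) * z (iB false) r)) p _ p0 (is_deriveD D1 D2).
  have -> : dx (dx (comb l iB)) p = h * y (iB true) p + l * h * y (iB false) p.
    rewrite (_ : dx (comb l iB) = (fun r => h * z (iB true) r + l * h * z (iB false) r)).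
      by have [_ ->] := @is_derive_dx _ (fun r => h * z (iB true) r + l * h * z (iB false) r) p _ (is_derive_comb h (l * h) (proj1 (dz (iB true) p)) (proj1 (dz (iB false) p))).
    by apply/funext => r; rewrite cdx.
  rewrite /quad /polar /= !big_cons !big_nil/= w1 z1; ring.
exists Psi, A; split.
- split.
  + by split; split => k /=; apply: PCk_Ck; exact: Pc.
  + by move=> mu k; apply: PCk_Ck; exact: Pc.
  + move=> p p0.
    have A0 : A 0 p = comb 1 iB p by [].
    have A1 : A 1 p = comb (-1) iB p by [].
    have b0 : box (A 0) p = _ := box_comb 1 p p0.
    have b1 : box (A 1) p = _ := box_comb (-1) p p0.
    split.
    * rewrite A0 A1 /dtC /dxC /= !cdt// !cdx /quad /= !big_cons !big_nil/= !w1 /comb.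
      by apply/eqP; rewrite eq_complex /=; apply/andP; split; apply/eqP; rewrite hE; field.
    * rewrite A0 A1 /dtC /dxC /= !cdt// !cdx /quad /= !big_cons !big_nil/= !w1 /comb.
      by apply/eqP; rewrite eq_complex /=; apply/andP; split; apply/eqP; rewrite hE; field.
    * rewrite b0 !normCK /= /comb.
      by apply/eqP; rewrite eq_complex /=; apply/andP; split; apply/eqP; rewrite hE; field.
    * rewrite b1 /= /comb.
      by apply/eqP; rewrite eq_complex /=; apply/andP; split; apply/eqP; rewrite hE; field.
- move=> x; rewrite /Psi /comb !w0 /q /e /sg !hornerE.
  by congr (_ +i* _, _ +i* _); rewrite hE; field.
- move=> mu x; rewrite /A /comb !w0 /q /e /sg !hornerE /sgn.
  have [->|mu0] := eqVneq mu 0; first by rewrite hE; field.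
  have -> : mu = 1 by apply/val_inj; case: mu mu0 => [[|[|]]].
  by rewrite hE; field.
- move=> mu x; rewrite /A cdt; last by rewrite /halfplane/=.
  have dwx i : z i (x, 0) = (q i)^`().[x].
    have [_ <-] := proj1 (dw i (x, 0)).
    rewrite (_ : (fun x0 => _) = (fun x0 => (q i).[x0])); last by apply/funext => r; rewrite w0.
    by have [_] := is_derive_poly (q i) x.
  rewrite !quadB !w0 !dwx /q /e /sg /= !hornerE /sgn.
  have [->|mu0] := eqVneq mu 0; first by rewrite hE; field.
  have -> : mu = 1 by apply/val_inj; case: mu mu0 => [[|[|]]].
  by rewrite hE; field.
Qed.

End SmoothExistence.

(** * Energy and d'Alembert identities on backward cones *)

Section C1Functions.
Context {R : realType}.

(** Functions of class C^1 on the open half plane that extend continuously, with their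
    derivatives, to the whole plane: a global extension replaces one-sided continuity at [t = 0]
    by plain continuity. *)
Record c1fun := C1Fun {
  c1val :> R * R -> R;
  c1x : R * R -> R;
  c1t : R * R -> R;
  c1_continuous : continuous c1val;
  c1x_continuous : continuous c1x;
  c1t_continuous : continuous c1t;
  c1x_derive : forall p : R * R, 0 < p.2 -> is_derive p.1 (1:R) (fun x => c1val (x, p.2)) (c1x p);
  c1t_derive : forall p : R * R, 0 < p.2 -> is_derive p.2 (1:R) (fun t => c1val (p.1, t)) (c1t p) }.

Implicit Types (f g : c1fun) (p : R * R).

Lemma plane_continuousD (f g : R * R -> R) : continuous f -> continuous g -> continuous (fun p => f p + g p).
Proof. by move=> cf cg p; apply: cvgD; [exact: cf|exact: cg]. Qed.

Lemma plane_continuousB (f g : R * R -> R) : continuous f -> continuous g -> continuous (fun p => f p - g p).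
Proof. by move=> cf cg p; apply: cvgB; [exact: cf|exact: cg]. Qed.

Lemma plane_continuousM (f g : R * R -> R) : continuous f -> continuous g -> continuous (fun p => f p * g p).
Proof. by move=> cf cg p; apply: cvgM; [exact: cf|exact: cg]. Qed.

Lemma plane_continuous_cst (k : R) : continuous (fun _ : R * R => k).
Proof. by move=> p; exact: cvg_cst. Qed.

Definition c1D f g : c1fun.
Proof.
refine (@C1Fun (fun p => f p + g p) (fun p => c1x f p + c1x g p) (fun p => c1t f p + c1t g p) _ _ _ _ _).
- exact: plane_continuousD (@c1_continuous f) (@c1_continuous g).
- exact: plane_continuousD (@c1x_continuous f) (@c1x_continuous g).
- exact: plane_continuousD (@c1t_continuous f) (@c1t_continuous g).
- by move=> p p0; apply: is_deriveD; exact: c1x_derive.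
- by move=> p p0; apply: is_deriveD; exact: c1t_derive.
Defined.

Definition c1B f g : c1fun.
Proof.
refine (@C1Fun (fun p => f p - g p) (fun p => c1x f p - c1x g p) (fun p => c1t f p - c1t g p) _ _ _ _ _).
- exact: plane_continuousB (@c1_continuous f) (@c1_continuous g).
- exact: plane_continuousB (@c1x_continuous f) (@c1x_continuous g).
- exact: plane_continuousB (@c1t_continuous f) (@c1t_continuous g).
- by move=> p p0; apply: is_deriveB; exact: c1x_derive.
- by move=> p p0; apply: is_deriveB; exact: c1t_derive.
Defined.

Definition c1M f g : c1fun.
Proof.
refine (@C1Fun (fun p => f p * g p) (fun p => f p * c1x g p + g p * c1x f p)
   (fun p => f p * c1t g p + g p * c1t f p) _ _ _ _ _).
- exact: plane_continuousM (@c1_continuous f) (@c1_continuous g).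
- apply: plane_continuousD; apply: plane_continuousM; try exact: c1_continuous; exact: c1x_continuous.
- apply: plane_continuousD; apply: plane_continuousM; try exact: c1_continuous; exact: c1t_continuous.
- move=> p p0; have := is_deriveM (c1x_derive f p0) (c1x_derive g p0).
  by rewrite -!surjective_pairing.
- move=> p p0; have := is_deriveM (c1t_derive f p0) (c1t_derive g p0).
  by rewrite -!surjective_pairing.
Defined.

Lemma c1_line_derive f (c y t : R) : `|c| <= 1 -> 0 < t ->
  is_derive t (1:R) (fun t : R => f (y + c * t, t)) (c1t f (y + c * t, t) + c * c1x f (y + c * t, t)).
Proof.
move=> c1 t0; apply/is_derive_epsP => e e0.
have e20 : 0 < e / 2 by lra.
set x := y + c * t.
have := @c1t_derive f (x, t) t0 => /is_derive_epsP/(_ _ e20)[d1 d10 H1].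
have [d2 d20 H2] := (continuous2P (c1x f) (x, t)).1 (@c1x_continuous f (x, t)) _ e20.
exists (Num.min t (Num.min d1 d2)); first by rewrite !lt_min t0 d10.
move=> h; rewrite !lt_min => /and3P[ht h1 h2].
have th0 : 0 < t + h by move: ht; rewrite ltr_norml; lra.
have A := H1 h h1; rewrite /= in A.
have ch : `|c * h| <= `|h| by rewrite normrM -[leRHS]mul1r ler_wpM2r.
have B : `|f (x + c * h, t + h) - f (x, t + h) - c * h * c1x f (x, t)| <= e / 2 * `|c * h|.
  apply: (@taylor_bound R (fun x => f (x, t + h)) (fun x => c1x f (x, t + h)) x (c * h)) => s sp.
    exact: (@c1x_derive f (s, t + h)).
  apply: H2 => /=; first by apply: le_lt_trans sp _; exact: le_lt_trans h2.
  by rewrite addrAC subrr add0r.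
have {}B : `|f (x + c * h, t + h) - f (x, t + h) - c * h * c1x f (x, t)| <= e / 2 * `|h|.
  by apply: le_trans B _; rewrite ler_wpM2l// ltW.
have -> : y + c * (t + h) = x + c * h by rewrite /x; ring.
have -> : f (x + c * h, t + h) - f (x, t) - h * (c1t f (x, t) + c * c1x f (x, t)) =
  (f (x, t + h) - f (x, t) - h * c1t f (x, t)) +
  (f (x + c * h, t + h) - f (x, t + h) - c * h * c1x f (x, t)) by ring.
by apply: le_trans (ler_normD _ _) _; rewrite (_ : e * `|h| = e / 2 * `|h| + e / 2 * `|h|); [exact: lerD|field].
Qed.

Definition slice (h : R * R -> R) (t : R) : R -> R := fun x => h (x, t).

Lemma slice_continuous (h : R * R -> R) t : continuous h -> continuous (slice h t).
Proof. exact: continuous_slice1. Qed.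

(** The integral over the section at time [t] of the light cone that shrinks from the base [l,
    r]. *)
Definition cone_mass (h : R * R -> R) (l r t : R) : R := RI (slice h t) (l + t) (r - t).

Lemma cone_mass_continuous (h : R * R -> R) l r : continuous h -> continuous (cone_mass h l r).
Proof.
move=> ch; apply: RI_slice_continuous => // t.
  by apply: cvgD; [exact: cvg_cst|exact: cvg_id].
by apply: cvgB; [exact: cvg_cst|exact: cvg_id].
Qed.

Lemma le_deriv_one_sided (f g df dg : R -> R) (a b : R) : a <= b ->
  {within `[a, b], continuous f} -> {within `[a, b], continuous g} ->
  (forall x, x \in `]a, b[ -> is_derive x (1:R) f (df x)) ->
  (forall x, x \in `]a, b[ -> is_derive x (1:R) g (dg x)) ->
  (forall x, x \in `]a, b[ -> df x <= dg x) ->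
  f b - f a <= g b - g a.
Proof.
move=> ab cf cg Hf Hg H.
have := @le_deriv R (fun=> 0) (fun x => g x - f x) (fun=> 0) (fun x => dg x - df x) a b ab.
rewrite subr0 normr0 => K.
have : 0 <= (g b - f b) - (g a - f a); last by lra.
apply: K.
- by move=> x; apply: cvg_cst.
- by move=> x; apply: cvgB; [exact: cg|exact: cf].
- by move=> x xab; apply: is_deriveB; [exact: Hg|exact: Hf].
- by move=> x xab; rewrite subr_ge0; exact: H.
Qed.

(** At the apex of the cone this functional is twice the value of [A], and its time derivative
    is the integral of the wave operator applied to [A]; together these give d'Alembert's
    formula. *)
Definition dalembert (A At : R * R -> R) (l r t : R) : R :=
  cone_mass At l r t + A (r - t, t) + A (l + t, t).

Lemma dalembert_continuous (A At : R * R -> R) l r : continuous A -> continuous At ->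
  continuous (dalembert A At l r).
Proof.
move=> cA cAt t; apply: cvgD; first apply: cvgD.
- exact: cone_mass_continuous.
- apply: (@continuous_pair _ _ A (fun t => r - t) id cA) => s; last exact: cvg_id.
  by apply: cvgB; [exact: cvg_cst|exact: cvg_id].
- apply: (@continuous_pair _ _ A (fun t => l + t) id cA) => s; last exact: cvg_id.
  by apply: cvgD; [exact: cvg_cst|exact: cvg_id].
Qed.

(** The boundary terms of Leibniz' rule cancel against the derivatives of [A] along the two
    sides of the cone and the fundamental theorem applied to the second x-derivative. *)
Lemma dalembert_derive (A At Ax : c1fun) (l r t : R) :
  (forall p, c1t A p = At p) -> (forall p, c1x A p = Ax p) -> 0 < t ->
  is_derive t (1:R) (dalembert A At l r) (cone_mass (fun p => c1t At p - c1x Ax p) l r t).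
Proof.
move=> EAt EAx t0.
have D1 := @leibniz_cone R At (c1t At) l r t (@c1_continuous At) (@c1t_continuous At)
  (fun x s s0 => @c1t_derive At (x, s) s0) t0.
have n1 : `|(-1:R)| <= 1 by rewrite normrN normr1.
have n2 : `|(1:R)| <= 1 by rewrite normr1.
have D2 := c1_line_derive A r n1 t0; have D3 := c1_line_derive A l n2 t0.
have E2 : (fun t : R => A (r + -1 * t, t)) = (fun t => A (r - t, t)).
  by apply/funext => s; rewrite mulN1r.
have E3 : (fun t : R => A (l + 1 * t, t)) = (fun t => A (l + t, t)).
  by apply/funext => s; rewrite mul1r.
rewrite E2 mulN1r in D2; rewrite E3 mul1r in D3.
have := is_deriveD (is_deriveD D1 D2) D3.
rewrite !EAt !EAx => D.
apply: is_derive_eq D _.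
have cx : continuous (fun x => c1x Ax (x, t)) by exact: slice_continuous (@c1x_continuous Ax).
have ct : continuous (fun x => c1t At (x, t)) by exact: slice_continuous (@c1t_continuous At).
rewrite /cone_mass /slice RIB//.
rewrite (@RI_eq R (fun x => c1x Ax (x, t)) (fun x => Ax (x, t)) (l + t) (r - t) cx
  (fun x => @c1x_derive Ax (x, t) t0)).
by rewrite !mulN1r mul1r; ring.
Qed.

(** A conservation law whose flux is dominated by the density: the flux through the sides of the
    shrinking cone can only lose mass. *)
Lemma cone_energy_derive (e j : c1fun) (S : R * R -> R) (l r t : R) : continuous S ->
  (forall p, 0 < p.2 -> c1t e p + c1x j p = S p) -> (forall p, `|j p| <= e p) -> 0 < t ->
  exists2 E' : R, is_derive t (1:R) (cone_mass e l r) E' & E' <= cone_mass S l r t.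
Proof.
move=> cS HS je t0.
have D1 := @leibniz_cone R e (c1t e) l r t (@c1_continuous e) (@c1t_continuous e)
  (fun x s s0 => @c1t_derive e (x, s) s0) t0.
eexists; first exact: D1.
have cx : continuous (fun x => c1x j (x, t)) by exact: slice_continuous (@c1x_continuous j).
have ct : continuous (fun x => c1t e (x, t)) by exact: slice_continuous (@c1t_continuous e).
have -> : cone_mass S l r t = RI (fun x => c1t e (x, t) + c1x j (x, t)) (l + t) (r - t).
  by apply: RI_ext => x; rewrite /slice -HS.
rewrite RID// (@RI_eq R (fun x => c1x j (x, t)) (fun x => j (x, t)) (l + t) (r - t) cx
  (fun x => @c1x_derive j (x, t) t0)).
have := je (l + t, t); have := je (r - t, t); rewrite !ler_norml; lra.
Qed.

End C1Functions.

(** * Stability in the charge norm *)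

Section Stability.
Context {R : realType}.

Definition sumsq (a b c d : @c1fun R) : c1fun := c1D (c1D (c1M a a) (c1M b b)) (c1D (c1M c c) (c1M d d)).

(** The factor two in the flux [2 Re (Psi_1 conj Psi_2)] is written as a sum, so that it is
    again built from products of functions of class C^1. *)
Definition flux (a b c d : @c1fun R) : c1fun :=
  c1D (c1D (c1M a c) (c1M b d)) (c1D (c1M a c) (c1M b d)).

Lemma flux_bound a b c d p : `|flux a b c d p| <= sumsq a b c d p.
Proof.
rewrite /= ler_norml.
have := sqr_ge0 (a p + c p); have := sqr_ge0 (b p + d p).
have := sqr_ge0 (a p - c p); have := sqr_ge0 (b p - d p); rewrite !expr2 => h1 h2 h3 h4.
by apply/andP; split; lra.
Qed.

Lemma sumsq_ge0 a b c d p : 0 <= sumsq a b c d p.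
Proof. exact: le_trans (normr_ge0 _) (flux_bound a b c d p). Qed.

Lemma sumsq_flux a b c d p :
  c1t (sumsq a b c d) p + c1x (flux a b c d) p =
  2 * (a p * (c1t a p + c1x c p) + b p * (c1t b p + c1x d p)
     + c p * (c1t c p + c1x a p) + d p * (c1t d p + c1x b p)).
Proof. by rewrite /=; ring. Qed.

(** The real components of a classical solution on [t > 0]:
   [Psi_1 = fa + i fb], [Psi_2 = fc + i fd]. *)
Record half_solution (m : R) := HalfSolution {
  fa : @c1fun R; fb : @c1fun R; fc : @c1fun R; fd : @c1fun R;
  pot : 'I_2 -> @c1fun R; pott : 'I_2 -> @c1fun R; potx : 'I_2 -> @c1fun R;
  pot_t : forall mu p, c1t (pot mu) p = pott mu p;
  pot_x : forall mu p, c1x (pot mu) p = potx mu p;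
  dirac_a : forall p : R * R, 0 < p.2 ->
    c1t fa p + c1x fc p = - m * fb p - pot 0 p * fb p - pot 1 p * fd p;
  dirac_b : forall p : R * R, 0 < p.2 ->
    c1t fb p + c1x fd p = m * fa p + pot 0 p * fa p + pot 1 p * fc p;
  dirac_c : forall p : R * R, 0 < p.2 ->
    c1t fc p + c1x fa p = m * fd p - pot 0 p * fd p - pot 1 p * fb p;
  dirac_d : forall p : R * R, 0 < p.2 ->
    c1t fd p + c1x fb p = - m * fc p + pot 0 p * fc p + pot 1 p * fa p;
  wave_0 : forall p : R * R, 0 < p.2 ->
    c1t (pott 0) p - c1x (potx 0) p = fa p ^+ 2 + fb p ^+ 2 + (fc p ^+ 2 + fd p ^+ 2);
  wave_1 : forall p : R * R, 0 < p.2 ->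
    c1t (pott 1) p - c1x (potx 1) p = - 2 * (fa p * fc p + fb p * fd p) }.

Definition density m (s : half_solution m) := sumsq (fa s) (fb s) (fc s) (fd s).

Definition diff_density m (s s' : half_solution m) :=
  sumsq (c1B (fa s) (fa s')) (c1B (fb s) (fb s')) (c1B (fc s) (fc s')) (c1B (fd s) (fd s')).

Lemma cone_mass_ge0 (h : R * R -> R) l r t : l + t <= r - t -> continuous h ->
  (forall p, 0 <= h p) -> 0 <= cone_mass h l r t.
Proof.
by move=> lr ch h0; apply: RI_ge0 => // [|x _]; [exact: slice_continuous|exact: h0].
Qed.

Lemma RI_sub_interval (g : R -> R) (l a b r : R) : l <= a -> a <= b -> b <= r ->
  continuous g -> (forall x, 0 <= g x) -> RI g a b <= RI g l r.
Proof.
move=> la ab br cg g0; rewrite (RI_split g a l r) (RI_split g b a r).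
have := @RI_ge0 _ g l a la cg (fun x _ => g0 x); have := @RI_ge0 _ g b r br cg (fun x _ => g0 x); lra.
Qed.

(** Conservation of charge: all terms of the Dirac equation are skew, so that density and flux
    satisfy a conservation law without source. *)
Lemma charge_le m (s : half_solution m) (l r t : R) : 0 <= t -> l + t <= r - t ->
  cone_mass (density s) l r t <= cone_mass (density s) l r 0.
Proof.
move=> t0 lr.
pose S : R * R -> R := fun=> 0.
have cS : continuous S by exact: plane_continuous_cst.
have HS (p : R * R) : 0 < p.2 -> c1t (density s) p + c1x (flux (fa s) (fb s) (fc s) (fd s)) p = S p.
  by move=> p0; rewrite sumsq_flux dirac_a// dirac_b// dirac_c// dirac_d// /S; ring.
(* a function that selects the derivative, which is known to exist at positive times only *)
pose E' (u : R) := if pselect (0 < u) is left u0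
  then projT1 (cid2 (@cone_energy_derive _ _ _ S l r u cS HS (flux_bound _ _ _ _) u0)) else 0.
have E'P (u : R) : 0 < u -> is_derive u (1:R) (cone_mass (density s) l r) (E' u) /\ E' u <= 0.
  move=> u0; rewrite /E'; case: pselect => // v0; case: cid2 => /= E1 d1 h1; split => //.
  by apply: le_trans h1 _; rewrite /cone_mass /S (_ : slice _ _ = (fun=> 0))// RI_cst mul0r.
rewrite -subr_le0.
have := @le_deriv_one_sided R (cone_mass (density s) l r) (fun=> 0) E' (fun=> 0) 0 t t0.
rewrite subrr; apply.
- by apply: continuous_subspaceT; exact: cone_mass_continuous (@c1_continuous _ _).
- by move=> x; apply: cvg_cst.
- by move=> x; rewrite in_itv/= => /andP[x0 _]; case: (E'P x x0).
- by move=> x; rewrite in_itv/= => /andP[x0 _]; case: (E'P x x0).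
Qed.

(** Optimisation over [k] of the bounds [k * a + b / k]; the minimum is [2 sqrt (a b)]. Keeping
    [k] free replaces the Cauchy-Schwarz inequality for integrals. *)
Lemma young_optimize (y a b : R) : 0 <= a -> 0 <= b ->
  (forall k, 0 < k -> y <= k * a + b / k) -> 0 <= y -> y ^+ 2 <= 4 * a * b.
Proof.
move=> a0 b0 H; rewrite le_eqVlt => /predU1P[<-|y0].
  by rewrite expr0n/= !mulr_ge0.
have [a00|a1] := eqVneq a 0.
  have k0 : 0 < (2 * b + 1) / y by rewrite divr_gt0//; lra.
  have := H _ k0; rewrite a00 mulr0 add0r invf_div mulrA ler_pdivlMr; last by lra.
  have := mulr_ge0 b0 (ltW y0); nra.
have ap : 0 < a by rewrite lt_def a1.
have k0 : 0 < y / (2 * a) by rewrite divr_gt0//; lra.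
have := H _ k0.
have -> : y / (2 * a) * a = y / 2 by field.
rewrite invf_div mulrA => K.
have : y / 2 <= b * (2 * a) / y by lra.
by rewrite ler_pdivlMr// => K'; nra.
Qed.

Section TwoSolutions.
Context (m T M : R) (s s' : half_solution m) (l r eta E0 : R).
Context (T0 : 0 <= T) (M0 : 0 <= M) (lrT : l + T <= r - T) (eta0 : 0 <= eta).
Context (massM : cone_mass (density s) l r 0 <= M) (massM' : cone_mass (density s') l r 0 <= M).
Context (H0 : forall mu y, l <= y <= r ->
  `|pot s mu (y, 0) - pot s' mu (y, 0)| <= eta /\ `|pott s mu (y, 0) - pott s' mu (y, 0)| <= eta).
Context (HE0 : cone_mass (diff_density s s') l r 0 <= E0).

Let e := diff_density s s'.
Let E t := cone_mass e l r t.
(* [Q] bounds the sum of the two charges and [B0] the contribution of the data to d'Alembert's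
   formula; [lam] satisfies [3 / lam <= 1 / 2] and [4 * T * Q * M / lam <= 1]. *)
Let Q := 2 * M.
Let lam := 8 + 4 * T * Q * M.
Let B0 := 2 * eta + 2 * T * eta.
Let dA mu p := pot s mu p - pot s' mu p.

Lemma lam_ge8 : 8 <= lam.
Proof. by rewrite /lam lerDl /Q !mulr_ge0. Qed.

Lemma B0_ge0 : 0 <= B0.
Proof. by rewrite /B0 addr_ge0// !mulr_ge0. Qed.

(** The difference of the two quadratic sources of the wave equation, bounded by Young's
    inequality with weight [k]: the difference of the spinors is paired with the spinors
    themselves. *)
Lemma wave_diff mu k p : 0 < p.2 -> 0 < k ->
  `|(c1t (pott s mu) p - c1x (potx s mu) p) - (c1t (pott s' mu) p - c1x (potx s' mu) p)| <=
  k * e p + (density s p + density s' p) / k.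
Proof.
move=> p0 k0.
have yg (x y : R) : 2 * `|x * y| <= k * x ^+ 2 + y ^+ 2 / k.
  have : 0 <= (k * `|x| - `|y|) ^+ 2 / k by rewrite divr_ge0 ?sqr_ge0// ltW.
  rewrite (_ : _ / k = k * `|x| ^+ 2 + `|y| ^+ 2 / k - 2 * (`|x| * `|y|)).
    by rewrite !real_normK ?num_real// normrM; lra.
  by field; exact: lt0r_neq0.
set xa := c1B (fa s) (fa s') p; set xb := c1B (fb s) (fb s') p.
set xc := c1B (fc s) (fc s') p; set xd := c1B (fd s) (fd s') p.
have eE : e p = xa ^+ 2 + xb ^+ 2 + (xc ^+ 2 + xd ^+ 2) by rewrite /e /= !expr2.
have dE : density s p = fa s p ^+ 2 + fb s p ^+ 2 + (fc s p ^+ 2 + fd s p ^+ 2) by rewrite /= !expr2.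
have dE' : density s' p = fa s' p ^+ 2 + fb s' p ^+ 2 + (fc s' p ^+ 2 + fd s' p ^+ 2) by rewrite /= !expr2.
have -> : k * e p + (density s p + density s' p) / k =
  k * xa ^+ 2 + k * xb ^+ 2 + (k * xc ^+ 2 + k * xd ^+ 2) +
  (fa s p ^+ 2 / k + fb s p ^+ 2 / k + (fc s p ^+ 2 / k + fd s p ^+ 2 / k)
  + (fa s' p ^+ 2 / k + fb s' p ^+ 2 / k + (fc s' p ^+ 2 / k + fd s' p ^+ 2 / k))).
  by rewrite eE dE dE'; field; exact: lt0r_neq0.
have ki : 0 <= k^-1 by rewrite invr_ge0 ltW.
have sq (x : R) : 0 <= x ^+ 2 / k by rewrite mulr_ge0// sqr_ge0.
have ksq (x : R) : 0 <= k * x ^+ 2 by rewrite mulr_ge0 ?sqr_ge0// ltW.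
have [->|mu1] := eqVneq mu 0.
  rewrite !wave_0// (_ : _ - _ = xa * fa s p + xa * fa s' p + (xb * fb s p + xb * fb s' p) +
     (xc * fc s p + xc * fc s' p + (xd * fd s p + xd * fd s' p))); last first.
    by rewrite /xa /xb /xc /xd /=; ring.
  have := yg xa (fa s p); have := yg xa (fa s' p); have := yg xb (fb s p); have := yg xb (fb s' p).
  have := yg xc (fc s p); have := yg xc (fc s' p); have := yg xd (fd s p); have := yg xd (fd s' p).
  have tri (x1 x2 : R) : `|x1 + x2| <= `|x1| + `|x2| := ler_normD x1 x2.
  move=> y1 y2 y3 y4 y5 y6 y7 y8.
  apply: le_trans (tri _ _) _; apply: le_trans (lerD (tri _ _) (tri _ _)) _.
  apply: le_trans (lerD (lerD (tri _ _) (tri _ _)) (lerD (tri _ _) (tri _ _))) _.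
  have := sq (fa s p); have := sq (fa s' p); have := sq (fb s p); have := sq (fb s' p).
  have := sq (fc s p); have := sq (fc s' p); have := sq (fd s p); have := sq (fd s' p).
  by lra.
have -> : mu = 1 by apply/val_inj; case: mu mu1 => [[|[|]]].
rewrite !wave_1// (_ : _ - _ = - (2 * (xa * fc s p) + 2 * (xc * fa s' p) + (2 * (xb * fd s p) + 2 * (xd * fb s' p)))); last first.
  by rewrite /xa /xb /xc /xd /=; ring.
rewrite normrN.
have := yg xa (fc s p); have := yg xc (fa s' p); have := yg xb (fd s p); have := yg xd (fb s' p).
have tri (x1 x2 : R) : `|2 * x1 + 2 * x2| <= 2 * `|x1| + 2 * `|x2|.
  by apply: le_trans (ler_normD _ _) _; rewrite !normrM ger0_norm.
move=> y1 y2 y3 y4.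
apply: le_trans (ler_normD _ _) _; apply: le_trans (lerD (tri _ _) (tri _ _)) _.
have := sq (fa s p); have := sq (fa s' p); have := sq (fb s p); have := sq (fb s' p).
have := sq (fc s p); have := sq (fc s' p); have := sq (fd s p); have := sq (fd s' p).
by lra.
Qed.

(** d'Alembert's formula bounds the difference of the potentials at a point by the data and by
    the integral of [wave_diff] over the backward cone. The charges are bounded by [M], and the
    energy [E] of the difference of the spinors is assumed to grow at most like [S * expR (lam *
    t)]. *)
Lemma potential_bound S : 0 <= S ->
  (forall t, 0 <= t <= T -> E t <= S * expR (lam * t)) ->
  forall mu x t, 0 <= t <= T -> l + t <= x <= r - t ->
  dA mu (x, t) ^+ 2 <= B0 ^+ 2 / 2 + 2 * T * Q * (S * expR (lam * t) / lam).
Proof.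
move=> S0 HS mu x t /andP[t0 tT] /andP[xl xr].
have lam0 : 0 < lam by have := lam_ge8; lra.
have Q0 : 0 <= Q by rewrite /Q mulr_ge0.
pose A := c1B (pot s mu) (pot s' mu).
pose At := c1B (pott s mu) (pott s' mu).
pose Ax := c1B (potx s mu) (potx s' mu).
have EAt p : c1t A p = At p by rewrite /= !pot_t.
have EAx p : c1x A p = Ax p by rewrite /= !pot_x.
pose G := dalembert A At (x - t) (x + t).
have Gt : G t = 2 * dA mu (x, t).
  rewrite /G /dalembert /cone_mass addrK subrK RIxx /A /dA/=; ring.
have G0 : `|G 0| <= B0.
  rewrite /G /dalembert /cone_mass addr0 subr0.
  have h1 : `|A (x + t, 0)| <= eta by apply: (H0 mu _).1; lra.
  have h2 : `|A (x - t, 0)| <= eta by apply: (H0 mu _).1; lra.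
  have h3 : `|RI (slice At 0) (x - t) (x + t)| <= eta * `|x + t - (x - t)|.
    apply: RI_bound; first exact: slice_continuous (@c1_continuous _ At).
    move=> y; rewrite min_l; last by lra.
    rewrite max_r; last by lra.
    by move=> /andP[y1 y2]; apply: (H0 mu _).2; lra.
  have h4 : eta * `|x + t - (x - t)| <= 2 * T * eta.
    have -> : x + t - (x - t) = 2 * t by ring.
    rewrite ger0_norm ?mulr_ge0// (_ : 2 * T * eta = eta * (2 * T)); last by ring.
    by rewrite ler_wpM2l//; lra.
  have := ler_normD (RI (slice At 0) (x - t) (x + t) + A (x + t, 0)) (A (x - t, 0)).
  have := ler_normD (RI (slice At 0) (x - t) (x + t)) (A (x + t, 0)).
  rewrite /B0; lra.
have key k : 0 < k -> 2 * `|dA mu (x, t)| - B0 <= k * (S * expR (lam * t) / lam) + T * Q / k.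
  move=> k0.
  pose phi (u : R) := k * S / lam * expR (lam * u) + Q / k * u.
  have dphi (u : R) : is_derive u (1:R) phi (k * S * expR (lam * u) + Q / k).
    apply: is_deriveD; last exact: deriveZid.
    have -> : k * S * expR (lam * u) = k * S / lam * (expR (lam * u) * lam) by field; exact: lt0r_neq0.
    apply: (@is_deriveZ _ _ _ (fun u : R => expR (lam * u))).
    apply: (@is_derive1_comp _ expR (fun u : R => lam * u)); exact: deriveZid.
  have := @le_deriv R G phi (fun u => cone_mass (fun p => c1t At p - c1x Ax p) (x - t) (x + t) u)
     (fun u => k * S * expR (lam * u) + Q / k) 0 t t0.
  move=> D; have {}D : `|G t - G 0| <= phi t - phi 0.
    apply: D.
    - by apply: continuous_subspaceT; apply: dalembert_continuous; exact: c1_continuous.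
    - exact/continuous_subspaceT/derive_continuous.
    - by move=> u; rewrite in_itv/= => /andP[u0 _]; exact: (dalembert_derive (x - t) (x + t) EAt EAx u0).
    - move=> u; rewrite in_itv/= => /andP[u0 ut].
      have ce := @c1_continuous _ e; have cd := @c1_continuous _ (density s); have cd' := @c1_continuous _ (density s').
      pose g p := k * e p + k^-1 * (density s p + density s' p).
      have cg : continuous g.
        apply: plane_continuousD; apply: plane_continuousM; try exact: plane_continuous_cst; first exact: ce.
        exact: plane_continuousD.
      have g0 p : 0 <= g p.
        have e0 : 0 <= e p by exact: sumsq_ge0.
        have d0 : 0 <= density s p by exact: sumsq_ge0.
        have d0' : 0 <= density s' p by exact: sumsq_ge0.
        have k00 := ltW k0; have k0i : 0 <= k^-1 by rewrite invr_ge0.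
        by apply: addr_ge0; apply: mulr_ge0 => //; exact: addr_ge0.
      have B1 : `|cone_mass (fun p => c1t At p - c1x Ax p) (x - t) (x + t) u| <= cone_mass g (x - t) (x + t) u.
        apply: RI_le; first by lra.
        - apply: slice_continuous; apply: plane_continuousB; [exact: c1t_continuous|exact: c1x_continuous].
        - exact: slice_continuous.
        move=> y _; rewrite /slice /g mulrC.
        have := @wave_diff mu k (y, u) u0 k0; rewrite /= => B; apply: le_trans _ (le_trans B _).
          by rewrite le_eqVlt; apply/orP; left; apply/eqP; congr `| _ |; ring.
        by rewrite le_eqVlt; apply/orP; left; apply/eqP; ring.
      have B2 : cone_mass g (x - t) (x + t) u <= cone_mass g l r u.
        by apply: RI_sub_interval; [lra|lra|lra|exact: slice_continuous|by move=> y; exact: g0].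
      have B3 : cone_mass g l r u = k * E u + k^-1 * (cone_mass (density s) l r u + cone_mass (density s') l r u).
        rewrite /cone_mass /E /cone_mass -RID; [|exact: slice_continuous..].
        rewrite -RI_lin//; first exact: slice_continuous.
        by move=> y; apply: cvgD; apply: slice_continuous.
      have lru : l + u <= r - u by lra.
      have c1 := le_trans (charge_le s (ltW u0) lru) massM.
      have c2 := le_trans (charge_le s' (ltW u0) lru) massM'.
      have c3 : k * E u <= k * S * expR (lam * u).
        by rewrite -mulrA ler_wpM2l ?(ltW k0)//; apply: HS; apply/andP; split; lra.
      have c4 : k^-1 * (cone_mass (density s) l r u + cone_mass (density s') l r u) <= Q / k.
        by rewrite [leRHS]mulrC ler_wpM2l ?invr_ge0 ?(ltW k0)// /Q; lra.
      lra.
  have p0 : phi 0 = k * S / lam by rewrite /phi !mulr0 expR0; ring.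
  have pt : phi t = k * (S * expR (lam * t) / lam) + Q / k * t by rewrite /phi; ring.
  have p00 : 0 <= k * S / lam by rewrite divr_ge0 ?mulr_ge0// ltW.
  have tq : Q / k * t <= T * Q / k.
    by rewrite (_ : T * Q / k = Q / k * T); [rewrite ler_wpM2l// divr_ge0// ltW|ring].
  have TR := ler_normD (G t - G 0) (G 0).
  rewrite subrK Gt normrM (ger0_norm (x := 2))// in TR.
  rewrite Gt p0 pt in D; lra.
set y := 2 * `|dA mu (x, t)| - B0 in key.
set I := S * expR (lam * t) / lam.
have I0 : 0 <= I by rewrite divr_ge0 ?mulr_ge0 ?expR_ge0// ltW.
have sqA : dA mu (x, t) ^+ 2 = `|dA mu (x, t)| ^+ 2 by rewrite real_normK// num_real.
have b0 := B0_ge0; have nA := normr_ge0 (dA mu (x, t)).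
have TQ : 0 <= T * Q by rewrite mulr_ge0.
rewrite sqA (_ : 2 * T * Q * I = 2 * (T * Q) * I); last by ring.
have TQI : 0 <= T * Q * I by rewrite mulr_ge0.
case: (leP 0 y) => y0.
  have := young_optimize I0 TQ key y0.
  move: y0; rewrite /y; set n := `|_| in nA * => y0 Hy.
  have := sqr_ge0 (2 * n - B0 - B0).
  rewrite !expr2 in Hy *; nra.
move: y0; rewrite /y; set n := `|_| in nA * => y0.
rewrite !expr2; nra.
Qed.

(** In the energy identity for the difference of the spinors the potentials act skewly and drop
    out; what remains is the difference of the potentials acting on [s'], which
    [potential_bound] controls. The constant [lam] is so large that [S] is halved. *)
Lemma energy_step S : 0 <= S ->
  (forall t, 0 <= t <= T -> E t <= S * expR (lam * t)) ->
  forall t, 0 <= t <= T -> E t <= E0 + T * M * B0 ^+ 2 + S / 2 * expR (lam * t).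
Proof.
move=> S0 HS t /andP[t0 tT].
have lam8 := lam_ge8; have lam0 : 0 < lam by lra.
have Q0 : 0 <= Q by rewrite /Q mulr_ge0.
have PB := potential_bound S0 HS.
pose xa := c1B (fa s) (fa s'); pose xb := c1B (fb s) (fb s').
pose xc := c1B (fc s) (fc s'); pose xd := c1B (fd s) (fd s').
pose D0 := c1B (pot s 0) (pot s' 0); pose D1 := c1B (pot s 1) (pot s' 1).
pose S1 := c1B (c1B (c1M xb (c1D (c1M D0 (fa s')) (c1M D1 (fc s'))))
                    (c1M xa (c1D (c1M D0 (fb s')) (c1M D1 (fd s')))))
               (c1B (c1M xc (c1D (c1M D0 (fd s')) (c1M D1 (fb s'))))
                    (c1M xd (c1D (c1M D0 (fc s')) (c1M D1 (fa s'))))).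
pose Sf := c1D S1 S1.
have HSf (p : R * R) : 0 < p.2 -> c1t e p + c1x (flux xa xb xc xd) p = Sf p.
  move=> p0; rewrite sumsq_flux.
  have -> : c1t xa p + c1x xc p = (c1t (fa s) p + c1x (fc s) p) - (c1t (fa s') p + c1x (fc s') p) by rewrite /=; ring.
  have -> : c1t xb p + c1x xd p = (c1t (fb s) p + c1x (fd s) p) - (c1t (fb s') p + c1x (fd s') p) by rewrite /=; ring.
  have -> : c1t xc p + c1x xa p = (c1t (fc s) p + c1x (fa s) p) - (c1t (fc s') p + c1x (fa s') p) by rewrite /=; ring.
  have -> : c1t xd p + c1x xb p = (c1t (fd s) p + c1x (fb s) p) - (c1t (fd s') p + c1x (fb s') p) by rewrite /=; ring.
  rewrite !dirac_a// !dirac_b// !dirac_c// !dirac_d// /=; ring.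
have cSf := @c1_continuous _ Sf.
pose E' (u : R) := if pselect (0 < u) is left u0
  then projT1 (cid2 (@cone_energy_derive _ _ _ Sf l r u cSf HSf (flux_bound _ _ _ _) u0)) else 0.
have E'P (u : R) : 0 < u -> is_derive u (1:R) E (E' u) /\ E' u <= cone_mass Sf l r u.
  by move=> u0; rewrite /E'; case: pselect => // v0; case: cid2.
have Sf_le p : Sf p <= 2 * e p + (dA 0 p ^+ 2 + dA 1 p ^+ 2) * density s' p.
  have yg (x y : R) : 2 * (x * y) <= x ^+ 2 + y ^+ 2.
    by have := sqr_ge0 (x - y); rewrite sqrrB; lra.
  have yn (x y : R) : - (2 * (x * y)) <= x ^+ 2 + y ^+ 2.
    by have := sqr_ge0 (x + y); rewrite sqrrD; lra.
  have := yg (xb p) (D0 p * fa s' p); have := yg (xb p) (D1 p * fc s' p).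
  have := yn (xa p) (D0 p * fb s' p); have := yn (xa p) (D1 p * fd s' p).
  have := yn (xc p) (D0 p * fd s' p); have := yn (xc p) (D1 p * fb s' p).
  have := yg (xd p) (D0 p * fc s' p); have := yg (xd p) (D1 p * fa s' p).
  have -> : dA 0 p = D0 p by [].
  have -> : dA 1 p = D1 p by [].
  have -> : e p = xa p ^+ 2 + xb p ^+ 2 + (xc p ^+ 2 + xd p ^+ 2) by rewrite /e /= !expr2.
  have -> : density s' p = fa s' p ^+ 2 + fb s' p ^+ 2 + (fc s' p ^+ 2 + fd s' p ^+ 2) by rewrite /= !expr2.
  have -> : Sf p = 2 * (xb p * (D0 p * fa s' p)) + 2 * (xb p * (D1 p * fc s' p))
     - 2 * (xa p * (D0 p * fb s' p)) - 2 * (xa p * (D1 p * fd s' p))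
     - 2 * (xc p * (D0 p * fd s' p)) - 2 * (xc p * (D1 p * fb s' p))
     + 2 * (xd p * (D0 p * fc s' p)) + 2 * (xd p * (D1 p * fa s' p)) by rewrite /=; ring.
  rewrite !exprMn; set A := D0 p ^+ 2; set B := D1 p ^+ 2; lra.
have dE u : 0 < u -> u <= T -> E' u <= 3 * S * expR (lam * u) + M * B0 ^+ 2.
  move=> u0 uT; have [_ h] := E'P u u0; apply: le_trans h _.
  have u01 : 0 <= u <= T by rewrite (ltW u0).
  set X := expR (lam * u); have X0 : 0 <= X by exact: expR_ge0.
  pose D2 := B0 ^+ 2 + 4 * T * Q * (S * X / lam).
  have D20 : 0 <= D2.
    by rewrite addr_ge0 ?sqr_ge0// mulr_ge0 ?divr_ge0 ?mulr_ge0// ltW.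
  have h1 : cone_mass Sf l r u <= RI (fun x => 2 * slice e u x + D2 * slice (density s') u x) (l + u) (r - u).
    apply: RI_mono; first by move: lrT; lra.
    - exact: slice_continuous.
    - by move=> x; apply: cvgD; apply: cvgM; try exact: cvg_cst; exact: slice_continuous (@c1_continuous _ _) x.
    - move=> x xlr; apply: le_trans (Sf_le (x, u)) _; rewrite lerD2l ler_wpM2r ?sumsq_ge0//.
      have p0 := PB 0 x u u01 xlr; have p1 := PB 1 x u u01 xlr; rewrite /D2.
      set Y := S * X / lam in p0 p1 *; lra.
  rewrite RI_lin in h1; last 2 first.
  - exact: slice_continuous (@c1_continuous _ _).
  - exact: slice_continuous (@c1_continuous _ _).
  have lru : l + u <= r - u by move: lrT; lra.
  have h2 := le_trans (charge_le s' (ltW u0) lru) massM'.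
  have h3 := HS u u01.
  have h4 : D2 * cone_mass (density s') l r u <= D2 * M by rewrite ler_wpM2l.
  have h5 : D2 * M <= M * B0 ^+ 2 + S * X.
    rewrite /D2 mulrDl mulrC lerD2l.
    rewrite (_ : 4 * T * Q * (S * X / lam) * M = S * X * ((4 * T * Q * M) / lam)); last by ring.
    rewrite -[leRHS]mulr1 ler_wpM2l ?mulr_ge0//.
    by rewrite ler_pdivrMr// mul1r /lam; lra.
  rewrite /cone_mass in h4; rewrite /E /cone_mass in h3; rewrite -/X in h3; lra.
pose phi (u : R) := 3 * S / lam * expR (lam * u) + M * B0 ^+ 2 * u.
have dphi (u : R) : is_derive u (1:R) phi (3 * S * expR (lam * u) + M * B0 ^+ 2).
  apply: is_deriveD; last exact: deriveZid.
  have -> : 3 * S * expR (lam * u) = 3 * S / lam * (expR (lam * u) * lam) by field; exact: lt0r_neq0.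
  apply: (@is_deriveZ _ _ _ (fun u : R => expR (lam * u))).
  apply: (@is_derive1_comp _ expR (fun u : R => lam * u)); exact: deriveZid.
have := @le_deriv_one_sided R E phi E' (fun u => 3 * S * expR (lam * u) + M * B0 ^+ 2) 0 t t0.
move=> K; have {}K : E t - E 0 <= phi t - phi 0.
  apply: K.
  - by apply: continuous_subspaceT; exact: cone_mass_continuous (@c1_continuous _ _).
  - exact/continuous_subspaceT/derive_continuous.
  - by move=> u; rewrite in_itv/= => /andP[u0 _]; case: (E'P u u0).
  - by move=> u; rewrite in_itv/= => /andP[u0 ut]; apply: dE => //; lra.
have p0 : phi 0 = 3 * S / lam by rewrite /phi !mulr0 expR0; ring.
have p00 : 0 <= 3 * S / lam by rewrite divr_ge0 ?mulr_ge0// ltW.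
have q1 : 3 * S / lam * expR (lam * t) <= S / 2 * expR (lam * t).
  rewrite ler_wpM2r ?expR_ge0// ler_pdivrMr//; nra.
have q2 : M * B0 ^+ 2 * t <= T * M * B0 ^+ 2.
  rewrite (_ : T * M * B0 ^+ 2 = M * B0 ^+ 2 * T); last by ring.
  by rewrite ler_wpM2l// mulr_ge0 ?sqr_ge0.
have E00 : E 0 <= E0 by [].
have pt : phi t = 3 * S / lam * expR (lam * t) + M * B0 ^+ 2 * t by [].
lra.
Qed.

(** Iteration of [energy_step] from the bound that compactness provides. *)
Lemma energy_bound t : 0 <= t <= T ->
  E t <= 2 * (E0 + T * M * B0 ^+ 2) * expR (lam * t).
Proof.
have lam8 := lam_ge8; have lam0 : 0 < lam by lra.
have cE : continuous E by exact: cone_mass_continuous (@c1_continuous _ _).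
pose A := 2 * (E0 + T * M * B0 ^+ 2).
have E00 : 0 <= E0.
  apply: (le_trans _ HE0); apply: cone_mass_ge0 => [||p].
  - by rewrite addr0 subr0; move: lrT T0; lra.
  - exact: c1_continuous.
  - exact: sumsq_ge0.
have A0 : 0 <= A by rewrite mulr_ge0// addr_ge0// mulr_ge0 ?sqr_ge0 ?mulr_ge0.
have [K K0 HK] := @compact_bound R (fun p => E p.2) _
  (fun p => continuous_comp (cvg_snd) (cE p.2)) (box_compact 0 0 0 T).
have ex u : 0 <= u -> 1 <= expR (lam * u) by move=> u0; rewrite -expR0 ler_expR mulr_ge0// ltW.
have main n : forall u, 0 <= u <= T -> E u <= (A + K * (2^-1) ^+ n) * expR (lam * u).
  elim: n => [|n IH] u uT.
    have u0 : 0 <= u by case/andP: uT.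
    rewrite expr0 mulr1; have := HK (0, u); rewrite /= => /(_ _)/le_trans => h.
    apply: le_trans (ler_norm _) _; apply: h; first by apply/box_setP; rewrite /= lexx.
    have := ex u u0; set X := expR _ => X1; nra.
  have S0 : 0 <= A + K * (2^-1) ^+ n by rewrite addr_ge0// mulr_ge0// half_pow_ge0.
  apply: le_trans (energy_step S0 IH uT) _.
  have u0 : 0 <= u by case/andP: uT.
  have X1 := ex u u0; set X := expR _ in X1 *.
  have a2 : A / 2 <= A / 2 * X by rewrite ler_peMr//; lra.
  rewrite (_ : (A + K * 2^-1 ^+ n.+1) * X = A / 2 * X + A / 2 * X + (K * 2^-1 ^+ n) / 2 * X); last by rewrite exprS; field.
  rewrite (_ : E0 + T * M * B0 ^+ 2 = A / 2); last by rewrite /A; field.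
  rewrite (_ : (A + K * 2^-1 ^+ n) / 2 * X = A / 2 * X + (K * 2^-1 ^+ n) / 2 * X); last by field.
  lra.
move=> tT; set X := expR _; apply: (@le_half_pow _ _ _ (K * X)) => n.
by apply: le_trans (main n t tT) _; rewrite -/X -/A; lra.
Qed.

End TwoSolutions.

(** The data control the solution on a light cone, in L^2 for the spinor and uniformly for the
    potential. The constant depends only on the height of the cone and on the charge, and not on
    the smoothness of the solutions: this is what makes the theory work for data in L^2. *)
Theorem stability (m T M : R) : 0 <= T -> 0 <= M -> exists2 C : R, 0 <= C &
  forall (s s' : half_solution m) (l r eta E0 : R), l + T <= r - T -> 0 <= eta ->
  cone_mass (density s) l r 0 <= M -> cone_mass (density s') l r 0 <= M ->
  (forall mu y, l <= y <= r -> `|pot s mu (y, 0) - pot s' mu (y, 0)| <= eta /\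
     `|pott s mu (y, 0) - pott s' mu (y, 0)| <= eta) ->
  cone_mass (diff_density s s') l r 0 <= E0 ->
  (forall t : R, 0 <= t <= T -> cone_mass (diff_density s s') l r t <= C * (E0 + eta ^+ 2)) /\
  (forall mu (x t : R), 0 <= t <= T -> l + t <= x <= r - t ->
     (pot s mu (x, t) - pot s' mu (x, t)) ^+ 2 <= C * (E0 + eta ^+ 2)).
Proof.
move=> T0 M0.
pose lam := 8 + 4 * T * (2 * M) * M.
have lam8 : 8 <= lam by rewrite /lam lerDl !mulr_ge0.
pose X := expR (lam * T).
have X0 : 0 <= X by exact: expR_ge0.
pose C1 := 2 + 8 * T * M * (1 + T) ^+ 2.
have C10 : 0 <= C1 by rewrite /C1 addr_ge0// mulr_ge0 ?sqr_ge0// !mulr_ge0.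
pose C := X * C1 * (1 + 4 * T * M) + 2 * (1 + T) ^+ 2.
have TM0 : 0 <= T * M by rewrite mulr_ge0.
exists C.
  by rewrite /C addr_ge0 ?mulr_ge0 ?sqr_ge0// addr_ge0// -mulrA mulr_ge0.
move=> s s' l r eta E0 lrT eta0 hM hM' h0 hE0.
have E00 : 0 <= E0.
  apply: (le_trans _ hE0); apply: cone_mass_ge0 => [||p].
  - by rewrite addr0 subr0; lra.
  - exact: c1_continuous.
  - exact: sumsq_ge0.
pose B0 := 2 * eta + 2 * T * eta.
have B0E : B0 ^+ 2 = 4 * (1 + T) ^+ 2 * eta ^+ 2 by rewrite /B0; ring.
set N := E0 + eta ^+ 2.
have eta20 : 0 <= eta ^+ 2 by exact: sqr_ge0.
have N0 : 0 <= N by rewrite addr_ge0.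
have A_le : 2 * (E0 + T * M * B0 ^+ 2) <= C1 * N.
  rewrite B0E /C1 /N.
  have : 0 <= T * M * (1 + T) ^+ 2 * E0 by rewrite mulr_ge0// mulr_ge0 ?sqr_ge0.
  set z := (1 + T) ^+ 2; lra.
have A0 : 0 <= 2 * (E0 + T * M * B0 ^+ 2).
  by rewrite mulr_ge0// addr_ge0// mulr_ge0 ?sqr_ge0.
have EB := energy_bound T0 M0 lrT eta0 hM hM' h0 hE0.
have XX t : 0 <= t <= T -> expR (lam * t) <= X.
  by move=> /andP[_ tT]; rewrite ler_expR ler_wpM2l//; lra.
have big : X * C1 * N <= C * N.
  rewrite ler_wpM2r//.
  have -> : C = X * C1 + (X * C1 * (4 * (T * M)) + 2 * (1 + T) ^+ 2) by rewrite /C; ring.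
  by rewrite lerDl addr_ge0// mulr_ge0 ?sqr_ge0// mulr_ge0.
split=> [t tT|mu x t tT xlr].
  apply: le_trans (EB t tT) _; apply: le_trans big.
  rewrite (_ : X * C1 * N = C1 * N * X); last by ring.
  by apply: ler_pM => //; exact: XX.
have PB := potential_bound T0 M0 eta0 hM hM' h0 A0 EB mu tT xlr.
apply: le_trans PB _.
set Y := expR _ in EB *.
have Y0 : 0 <= Y by exact: expR_ge0.
have YX : Y <= X by exact: XX.
have h1 : B0 ^+ 2 / 2 <= 2 * (1 + T) ^+ 2 * N.
  rewrite B0E /N (_ : _ / 2 = 2 * (1 + T) ^+ 2 * eta ^+ 2); last by field.
  by apply: ler_wpM2l; [rewrite mulr_ge0// sqr_ge0|rewrite lerDr].
have h2 : 2 * (E0 + T * M * B0 ^+ 2) * Y / lam <= X * C1 * N.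
  rewrite ler_pdivrMr; last by lra.
  apply: (@le_trans _ _ (X * C1 * N)).
    rewrite (_ : X * C1 * N = C1 * N * X); last by ring.
    exact: ler_pM.
  by rewrite ler_peMr ?mulr_ge0//; lra.
have h3 : 2 * T * (2 * M) * (2 * (E0 + T * M * B0 ^+ 2) * Y / lam) <= 4 * T * M * (X * C1 * N).
  rewrite (_ : 2 * T * (2 * M) = 4 * T * M); last by ring.
  by rewrite ler_wpM2l// -mulrA mulr_ge0.
apply: (@le_trans _ _ (2 * (1 + T) ^+ 2 * N + 4 * T * M * (X * C1 * N))); first exact: lerD.
have -> : C * N = 2 * (1 + T) ^+ 2 * N + 4 * T * M * (X * C1 * N) + X * C1 * N by rewrite /C; ring.
by rewrite lerDl mulr_ge0// mulr_ge0.
Qed.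

End Stability.

(** * Even reflection of smooth solutions *)

Section HalfOfSmooth.
Context {R : realType}.
Implicit Types (f : R * R -> R) (p : R * R).

(** Even reflection in time turns continuity on the closed half plane into continuity on the plane. *)
Definition reflect_t f p : R := f (p.1, `|p.2|).

Lemma reflect_tE f p : 0 <= p.2 -> reflect_t f p = f p.
Proof. by move=> p0; rewrite /reflect_t ger0_norm// -surjective_pairing. Qed.

Lemma reflect_t_continuous f : {within halfplane R, continuous f} -> continuous (reflect_t f).
Proof.
move=> /subspace_continuousP cf p.
have h0 : halfplane R (p.1, `|p.2|) by rewrite /halfplane/=.
apply: (@cvg_comp _ _ _ (fun q : R * R => (q.1, `|q.2|)) f _ _ _ _ (cf _ h0)) => A /= HA.
have cg : (fun q : R * R => (q.1, `|q.2|)) @ p --> (p.1, `|p.2|).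
  apply: (@cvg_pair _ _ _ _ (nbhs p.1) (nbhs `|p.2|)); first exact: cvg_fst.
  by apply: cvg_norm; exact: cvg_snd.
have H2 : nbhs p (fun q : R * R => halfplane R (q.1, `|q.2|) -> A (q.1, `|q.2|)) := cg _ HA.
apply: (@filterS _ (nbhs p) _ _ _ _ H2) => q; apply.
by rewrite /halfplane/=.
Qed.

Lemma reflect_t_derive_t f p : derivable_t f p -> 0 < p.2 ->
  is_derive p.2 (1:R) (fun t => reflect_t f (p.1, t)) (dt f p).
Proof.
move=> df p0; apply/is_derive_epsP => e e0.
have /cvgrPdist_le/(_ _ e0) : t_quotients f p --> dt f p by exact: df.
rewrite /within/= => /nbhs_ballP[d /= d0 Hd].
exists (Num.min d p.2); first by rewrite lt_min d0.
move=> h; rewrite lt_min => /andP[hd hp].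
have h0 : 0 <= p.2 + h by move: hp; rewrite ltr_norml; lra.
rewrite /reflect_t /= (ger0_norm h0) (gtr0_norm p0) -surjective_pairing.
have [->|hn] := eqVneq h 0; first by rewrite addr0 -surjective_pairing subrr mul0r subrr normr0 mulr0.
have := Hd h; rewrite /ball/= sub0r normrN => /(_ hd hn h0) H.
have hh : 0 < `|h| by rewrite normr_gt0.
rewrite -ler_pdivrMr// -normfV -normrM distrC in H *.
apply: le_trans H; rewrite le_eqVlt; apply/orP; left; apply/eqP; congr `| _ |.
by field.
Qed.

Lemma reflect_t_derive_x f p : derivable_x f p -> 0 < p.2 ->
  is_derive p.1 (1:R) (fun x => reflect_t f (x, p.2)) (dx f p).
Proof.
move=> df p0; rewrite (_ : (fun x => _) = (fun x => f (x, p.2))).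
  by split; [exact: df|rewrite /dx derive1E].
by apply/funext => x; rewrite reflect_tE//= ltW.
Qed.

Lemma smooth_dx f : smooth f -> smooth (dx f).
Proof. by move=> H k; have [] := H k.+1. Qed.

Lemma smooth_dt f : smooth f -> smooth (dt f).
Proof. by move=> H k; have [] := H k.+1. Qed.

(** The function and its partial derivatives are reflected separately, which keeps all three of
    them continuous across [t = 0]. *)
Definition c1_of_smooth f (H : smooth f) : @c1fun R.
Proof.
refine (@C1Fun R (reflect_t f) (reflect_t (dx f)) (reflect_t (dt f)) _ _ _ _ _).
- exact: reflect_t_continuous (H 0%N).
- exact: reflect_t_continuous (smooth_dx H 0%N).
- exact: reflect_t_continuous (smooth_dt H 0%N).
- move=> p p0; rewrite reflect_tE ?ltW//.
  have [/(_ p (ltW p0))[dfx _] _ _] := H 1%N; exact: reflect_t_derive_x.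
- move=> p p0; rewrite reflect_tE ?ltW//.
  have [/(_ p (ltW p0))[_ dft] _ _] := H 1%N; exact: reflect_t_derive_t.
Defined.

Lemma c1_valE f (H : smooth f) p : 0 < p.2 -> c1_of_smooth H p = f p.
Proof. by move=> p0; rewrite [LHS]reflect_tE// ltW. Qed.

Lemma c1_xE f (H : smooth f) p : 0 < p.2 -> c1x (c1_of_smooth H) p = dx f p.
Proof. by move=> p0; rewrite [LHS]reflect_tE// ltW. Qed.

Lemma c1_tE f (H : smooth f) p : 0 < p.2 -> c1t (c1_of_smooth H) p = dt f p.
Proof. by move=> p0; rewrite [LHS]reflect_tE// ltW. Qed.

Lemma dirac_real (ta tb xc xd m A0 A1 : R) (z w : R[i]) :
  (ta +i* tb) + (xc +i* xd) = 'i%C * m%:C * z + 'i%C * A0%:C * z + 'i%C * A1%:C * w ->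
  ta + xc = - m * complex.Im z - A0 * complex.Im z - A1 * complex.Im w /\
  tb + xd = m * complex.Re z + A0 * complex.Re z + A1 * complex.Re w.
Proof.
case: z => a b; case: w => c d /= /eqP; rewrite eq_complex /= => /andP[/eqP -> /eqP ->].
by split; ring.
Qed.

Lemma dirac_real' (ta tb xc xd m A0 A1 : R) (z w : R[i]) :
  (ta +i* tb) + (xc +i* xd) = - 'i%C * m%:C * z + 'i%C * A0%:C * z + 'i%C * A1%:C * w ->
  ta + xc = m * complex.Im z - A0 * complex.Im z - A1 * complex.Im w /\
  tb + xd = - m * complex.Re z + A0 * complex.Re z + A1 * complex.Re w.
Proof.
case: z => a b; case: w => c d /= /eqP; rewrite eq_complex /= => /andP[/eqP -> /eqP ->].
by split; ring.
Qed.

Lemma wave_real0 (b : R) (z w : R[i]) : b%:C = `|z| ^+ 2 + `|w| ^+ 2 ->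
  b = complex.Re z ^+ 2 + complex.Im z ^+ 2 + (complex.Re w ^+ 2 + complex.Im w ^+ 2).
Proof.
rewrite !normCK; case: z => a1 b1; case: w => c d /= /eqP; rewrite eq_complex /= => /andP[/eqP -> _].
by ring.
Qed.

Lemma wave_real1 (b : R) (z w : R[i]) : b%:C = - (w^*%C * z + z^*%C * w) ->
  b = - 2 * (complex.Re z * complex.Re w + complex.Im z * complex.Im w).
Proof.
case: z => a1 b1; case: w => c d /= /eqP; rewrite eq_complex /= => /andP[/eqP -> _].
by ring.
Qed.

(** The complex equations split into real and imaginary parts. *)
Lemma half_of_smooth (m : R) (Psi : R * R -> spinor R) (A : 'I_2 -> R * R -> R) :
  smooth_solution m Psi A -> exists s : half_solution m,
  [/\ forall p, fa s p = reflect_t (fun q => complex.Re (Psi q).1) p /\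
                fb s p = reflect_t (fun q => complex.Im (Psi q).1) p,
      forall p, fc s p = reflect_t (fun q => complex.Re (Psi q).2) p /\
                fd s p = reflect_t (fun q => complex.Im (Psi q).2) p,
      forall mu p, pot s mu p = reflect_t (A mu) p &
      forall mu p, pott s mu p = reflect_t (dt (A mu)) p].
Proof.
move=> [[[sa sb] [sc sd]] sA eqs].
unshelve eexists.
  refine (@HalfSolution R m (c1_of_smooth sa) (c1_of_smooth sb) (c1_of_smooth sc) (c1_of_smooth sd)
    (fun mu => c1_of_smooth (sA mu)) (fun mu => c1_of_smooth (smooth_dt (sA mu)))
    (fun mu => c1_of_smooth (smooth_dx (sA mu))) (fun _ _ => erefl) (fun _ _ => erefl) _ _ _ _ _ _).
  - move=> p p0; have [e1 _ _ _] := eqs p (ltW p0); have [e _] := dirac_real e1.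
    by rewrite !(c1_valE, c1_xE, c1_tE).
  - move=> p p0; have [e1 _ _ _] := eqs p (ltW p0); have [_ e] := dirac_real e1.
    by rewrite !(c1_valE, c1_xE, c1_tE).
  - move=> p p0; have [_ e1 _ _] := eqs p (ltW p0); have [e _] := dirac_real' e1.
    by rewrite !(c1_valE, c1_xE, c1_tE).
  - move=> p p0; have [_ e1 _ _] := eqs p (ltW p0); have [_ e] := dirac_real' e1.
    by rewrite !(c1_valE, c1_xE, c1_tE).
  - move=> p p0; have [_ _ e1 _] := eqs p (ltW p0); have e := wave_real0 e1.
    by rewrite !(c1_valE, c1_xE, c1_tE).
  - move=> p p0; have [_ _ _ e1] := eqs p (ltW p0); have e := wave_real1 e1.
    by rewrite !(c1_valE, c1_xE, c1_tE).
by [].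
Qed.

End HalfOfSmooth.

(** * Polynomial approximation *)

Section Weierstrass.
Context {R : realType}.

(** The Bernstein polynomial with node values [phi 0, ..., phi n], generated by Pascal's
    recursion: positivity and the two moments below then follow by induction, without binomial
    sums. *)
Fixpoint bernstein (n : nat) (phi : nat -> R) : {poly R} :=
  if n is n'.+1 then 'X * bernstein n' (fun k => phi k.+1) + (1 - 'X) * bernstein n' phi
  else (phi 0%N)%:P.

Lemma bernsteinS n phi (x : R) : (bernstein n.+1 phi).[x] =
  x * (bernstein n (fun k => phi k.+1)).[x] + (1 - x) * (bernstein n phi).[x].
Proof. by rewrite /= !hornerE. Qed.

Lemma bernstein_lin n (f g : nat -> R) (a b x : R) :
  (bernstein n (fun k => a * f k + b * g k)).[x] = a * (bernstein n f).[x] + b * (bernstein n g).[x].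
Proof.
elim: n f g => [|n IH] f g; first by rewrite /= !hornerC.
have IH' := IH (fun k => f k.+1) (fun k => g k.+1); rewrite /= in IH'.
by rewrite !bernsteinS IH' IH; ring.
Qed.

Lemma bernstein_cst n (a x : R) : (bernstein n (fun=> a)).[x] = a.
Proof.
elim: n => [|n IH]; first by rewrite /= hornerC.
by rewrite bernsteinS !IH; ring.
Qed.

Lemma bernstein_mono n (f g : nat -> R) (x : R) : 0 <= x <= 1 ->
  (forall k, (k <= n)%N -> f k <= g k) -> (bernstein n f).[x] <= (bernstein n g).[x].
Proof.
move=> /andP[x0 x1]; elim: n f g => [|n IH] f g H; first by rewrite /= !hornerC H.
rewrite !bernsteinS; apply: lerD; apply: ler_wpM2l => //.
- by apply: IH => k kn; exact: H.
- by rewrite subr_ge0.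
- by apply: IH => k kn; apply: H; exact: leqW.
Qed.

Lemma bernstein_variance n (a x : R) :
  (bernstein n (fun k => (k%:R - a) ^+ 2)).[x] = n%:R * x * (1 - x) + (n%:R * x - a) ^+ 2.
Proof.
elim: n a => [|n IH] a; first by rewrite /= hornerC; ring.
rewrite bernsteinS IH (_ : (fun k : nat => (k.+1%:R - a) ^+ 2) = (fun k : nat => (k%:R - (a - 1)) ^+ 2)).
  by rewrite IH -(natr1 n); ring.
by apply/funext => k; rewrite -(natr1 k); ring.
Qed.

(** Chebyshev's argument: away from [x] the oscillation of [f] is dominated by a multiple of the
    squared distance, whose Bernstein mean is of order [1 / n]. *)
Lemma weierstrass01 (f : R -> R) (e : R) : continuous f -> 0 < e ->
  exists p : {poly R}, forall x, 0 <= x <= 1 -> `|f x - p.[x]| <= e.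
Proof.
move=> cf e0.
pose F (p : R * R) := f p.1.
have cF : continuous F by move=> p; apply: (continuous_comp cvg_fst (cf p.1)).
have cb := box_compact (0 : R) 1 0 0.
have [M M0 HM] := compact_bound cF cb.
have e20 : 0 < e / 2 by lra.
have [d d0 Hd] := heine cF cb e20.
pose K := 2 * M / d ^+ 2.
have d20 : 0 < d ^+ 2 by rewrite exprn_gt0.
have K0 : 0 <= K by rewrite divr_ge0 ?mulr_ge0// ltW.
pose n := (Num.truncn (K / (e / 2))).+1.
have n0 : 0 < n%:R :> R by rewrite ltr0n.
have nK : K / n%:R <= e / 2.
  by rewrite ler_pdivrMr// mulrC -ler_pdivrMr// ltW// /n truncnS_gt.
exists (bernstein n (fun k => f (k%:R / n%:R))) => x x01; have /andP[x0 x1] := x01.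
have bd : forall k, (k <= n)%N ->
    `|f (k%:R / n%:R) - f x| <= e / 2 + K / n%:R ^+ 2 * (k%:R - n%:R * x) ^+ 2.
  move=> k kn.
  have kn1 : (k%:R / n%:R : R) <= 1 by rewrite ler_pdivrMr// mul1r ler_nat.
  have kn0 : 0 <= (k%:R / n%:R : R) by rewrite divr_ge0.
  have -> : K / n%:R ^+ 2 * (k%:R - n%:R * x) ^+ 2 = K * (k%:R / n%:R - x) ^+ 2.
    by field; exact: lt0r_neq0.
  case: (ltP `|k%:R / n%:R - x| d) => kd.
    have := Hd (x, 0) (k%:R / n%:R, 0); rewrite /F/= subrr normr0 => /(_ _ kd d0) H.
    apply: le_trans (H _) _; first by apply/box_setP; rewrite /= x0 x1 lexx.
    by rewrite lerDl mulr_ge0// sqr_ge0.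
  have h1 : `|f (k%:R / n%:R)| <= M.
    by apply: (HM (k%:R / n%:R, 0)); apply/box_setP; rewrite /= kn0 kn1 lexx.
  have h2 : `|f x| <= M by apply: (HM (x, 0)); apply/box_setP; rewrite /= x0 x1 lexx.
  have h3 : 2 * M <= K * (k%:R / n%:R - x) ^+ 2.
    rewrite /K mulrAC ler_pdivlMr// ler_wpM2l ?mulr_ge0//.
    by rewrite -[leRHS](real_normK (num_real _)) lerXn2r ?nnegrE// ltW.
  have := ler_normB (f (k%:R / n%:R)) (f x); lra.
have -> : f x - (bernstein n (fun k => f (k%:R / n%:R))).[x] =
    - (bernstein n (fun k => 1 * f (k%:R / n%:R) + (-1) * f x)).[x].
  by rewrite bernstein_lin bernstein_cst; ring.
rewrite normrN.
have V : (bernstein n (fun k => (e / 2) * 1 + K / n%:R ^+ 2 * (k%:R - n%:R * x) ^+ 2)).[x] <= e.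
  rewrite (bernstein_lin n (fun=> 1) (fun k => (k%:R - n%:R * x) ^+ 2)) bernstein_cst bernstein_variance subrr.
  rewrite expr0n/= addr0 mulr1.
  have -> : K / n%:R ^+ 2 * (n%:R * x * (1 - x)) = K / n%:R * (x * (1 - x)) by field; exact: lt0r_neq0.
  have : K / n%:R * (x * (1 - x)) <= K / n%:R * 1.
    by rewrite ler_wpM2l ?divr_ge0//; nra.
  lra.
have A : (bernstein n (fun k => 1 * f (k%:R / n%:R) + (-1) * f x)).[x] <= e.
  apply: le_trans V; apply: bernstein_mono => // k kn.
  by have := le_trans (ler_norm _) (bd k kn); lra.
have B : - e <= (bernstein n (fun k => 1 * f (k%:R / n%:R) + (-1) * f x)).[x].
  have E := bernstein_lin n (fun k => (e / 2) * 1 + K / n%:R ^+ 2 * (k%:R - n%:R * x) ^+ 2) (fun=> 0) (-1) 0 x.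
  have : - e <= (bernstein n (fun k => (-1) * ((e / 2) * 1 + K / n%:R ^+ 2 * (k%:R - n%:R * x) ^+ 2) + 0 * 0)).[x].
    by rewrite E mul0r; lra.
  move=> h; apply: le_trans h _; apply: bernstein_mono => // k kn.
  by have := bd k kn; rewrite ler_norml => /andP[h _]; lra.
by rewrite ler_norml B A.
Qed.

Theorem weierstrass (f : R -> R) (L e : R) : continuous f -> 0 < L -> 0 < e ->
  exists p : {poly R}, forall x, `|x| <= L -> `|f x - p.[x]| <= e.
Proof.
move=> cf L0 e0.
pose g y := f (L * (2 * y - 1)).
have cg : continuous g.
  move=> y; apply: (@continuous_comp R R R (fun y : R => L * (2 * y - 1)) f); last exact: cf.
  apply: cvgM; first exact: cvg_cst.
  by apply: cvgB; [apply: cvgM; [exact: cvg_cst|exact: cvg_id]|exact: cvg_cst].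
have [p Hp] := weierstrass01 cg e0.
exists (p \Po ((2 * L)^-1 *: 'X + 2^-1%:P)) => x xL.
have Ln : L != 0 by exact: lt0r_neq0.
rewrite horner_comp !hornerE.
have -> : f x = g ((2 * L)^-1 * x + 2^-1) by rewrite /g; congr f; field.
apply: Hp; move: xL; rewrite ler_norml => /andP[x1 x2].
have -> : (2 * L)^-1 * x + 2^-1 = (x + L) / (2 * L) by field.
by rewrite divr_ge0 ?ler_pdivrMr ?mulr_gt0//=; [rewrite mul1r; lra|lra|lra].
Qed.

End Weierstrass.

Section L2Density.
Context {R : realType}.
Let mu := @lebesgue_measure R.

Lemma ecvg0P (T : Type) (F : set_system T) {FF : Filter F} (u : T -> \bar R) :
  (forall x, (0 <= u x)%E) ->
  (u @ F --> 0%E) <-> (forall e : R, 0 < e -> \forall x \near F, (u x <= e%:E)%E).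
Proof.
move=> u0; split=> [/fine_cvgP[fu /cvgrPdist_le cu] e e0|H].
  have := cu e e0; apply: filterS2 fu => x fx /=.
  by rewrite sub0r normrN ger0_norm ?fine_ge0// -lee_fin fineK.
apply/fine_cvgP; split.
  have := H 1 ltr01; apply: filterS => x ux.
  by rewrite ge0_fin_numE//; apply: le_lt_trans ux _; rewrite ltry.
apply/cvgrPdist_le => e e0; have := H e e0; apply: filterS => x ux /=.
rewrite sub0r normrN ger0_norm ?fine_ge0// -lee_fin fineK//.
by rewrite ge0_fin_numE//; apply: le_lt_trans ux _; rewrite ltry.
Qed.

Lemma sq_sum3 (a b c : R) : (a + b + c) ^+ 2 <= 3 * (a ^+ 2 + b ^+ 2 + c ^+ 2).
Proof.
have := sqr_ge0 (a - b); have := sqr_ge0 (a - c); have := sqr_ge0 (b - c).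
rewrite !expr2; lra.
Qed.

(** The function is truncated (dominated convergence), the truncation is approximated in L^1 by
    a continuous function that can be truncated as well, so that L^1 and L^2 distance are
    comparable, and a polynomial approximates the latter uniformly. *)
Lemma L2_poly_dense (f : measurableTypeR R -> R) (L e : R) : 0 < L -> 0 < e ->
  measurable_fun setT f -> (\int[mu]_(x in `[(- L)%R, L]) (f x ^+ 2)%:E < +oo)%E ->
  exists p : {poly R}, (\int[mu]_(x in `[(- L)%R, L]) ((f x - p.[x]) ^+ 2)%:E <= e%:E)%E.
Proof.
move=> L0 e0 mf' f2.
set D := `[(- L)%R, L]%classic.
have mD : measurable D by exact: measurable_itv.
have muD : mu D = (2 * L)%:E.
  by rewrite /mu lebesgue_measure_itv/= lte_fin ifT; [rewrite -EFinB; congr EFin; ring|lra].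
have muDoo : (mu D < +oo)%E by rewrite muD ltry.
have mf : measurable_fun D f by exact: measurable_funTS.
have mclip (n : R) (g : measurableTypeR R -> R) : measurable_fun D g -> measurable_fun D (fun x => clip n (g x)).
  move=> mg; apply: measurable_maxr; first exact: measurable_cst.
  by apply: measurable_minr => //; exact: measurable_cst.
have e12 : 0 < e / 12 by lra.
have [N N0 HN] : exists2 N : R, 0 < N & (\int[mu]_(x in D) ((f x - clip N (f x)) ^+ 2)%:E <= (e / 12)%:E)%E.
  have := @dominated_convergence _ _ _ mu D mD (fun n x => ((f x - clip n%:R (f x)) ^+ 2)%:E) (cst 0%E)
    (fun x => (f x ^+ 2)%:E).
  case.
  - move=> n; apply/measurable_EFinP; apply: measurable_funX; apply: measurable_funB => //; exact: mclip.
  - exact: measurable_cst.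
  - apply: aeW => x Dx.
    apply: cvg_near_cst; exists (Num.truncn `|f x|).+1 => // n /= Hn.
    rewrite clip_id ?subrr ?expr0n//.
    by apply: (le_trans (ltW (truncnS_gt `|f x|))); rewrite ler_nat.
  - apply/integrableP; split; first by apply/measurable_EFinP; exact: measurable_funX.
    rewrite (eq_integral (fun x => (f x ^+ 2)%:E))// => x _.
    by rewrite gee0_abs// lee_fin sqr_ge0.
  - apply: aeW => x n _; rewrite lee_fin ger0_norm ?sqr_ge0//.
    rewrite -(real_normK (num_real (f x - _))) -(real_normK (num_real (f x))).
    rewrite lerXn2r ?nnegrE// /clip.
    case: (leP n%:R (f x)) => h1; case: (leP (- n%:R : R) _) => h2 //.
    + by have n0 : 0 <= n%:R :> R by []; rewrite ger0_norm ?ger0_norm; lra.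
    + by have n0 : 0 <= n%:R :> R by []; rewrite ger0_norm ?ger0_norm; lra.
    + by rewrite subrr normr0.
    + by have n0 : 0 <= n%:R :> R by []; rewrite ler0_norm ?ler0_norm; lra.
  - move=> _ _ ; rewrite integral0 => /ecvg0P H.
    have [n|n _ Hn] := H _ (e / 12) e12.
      by apply: integral_ge0 => x _; rewrite lee_fin sqr_ge0.
    exists n.+1%:R; first by rewrite ltr0n.
    exact: (Hn n.+1 (leqnSn n)).
(* approximation in L^1 is enough: once both functions are clipped, the square of their
   difference is at most [2 * N] times its absolute value *)
have bclip x : `|clip N (f x)| <= N by apply: clip_bound; exact: ltW.
have iclip : mu.-integrable D (EFin \o (fun x => clip N (f x))).
  apply: measurable_bounded_integrable => //; first exact: mclip.
  exists N; split => [|y Ny x Dx]; first exact: num_real.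
  by apply: le_trans (bclip x) (ltW Ny).
have [g_ [cg _ Hg]] := approximation_continuous_integrable mD muDoo iclip.
have eN : 0 < e / 12 / (2 * N) by rewrite divr_gt0//; lra.
have [g cg' Hg'] : exists2 g : R -> R, continuous g &
    (\int[mu]_(x in D) `|(clip N (f x) - g x)%:E| <= (e / 12 / (2 * N))%:E)%E.
  have /ecvg0P H := Hg.
  have [n|n _ Hn] := H _ _ eN; first by apply: integral_ge0 => x _; exact: abse_ge0.
  by exists (g_ n) => //; exact: (Hn n (leqnn n)).
have ch : continuous (fun x => clip N (g x)).
  by apply: clip_continuous => // x; exact: cvg_cst.
have L20 : 0 < 2 * L by lra.
have d0 : 0 < Num.min 1 (e / 12 / (2 * L)) by rewrite lt_min ltr01/= divr_gt0.
have [p Hp] := weierstrass ch L0 d0.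
exists p.
have mg : measurable_fun D g by apply: measurable_funTS; exact: continuous_measurable_fun.
have mp : measurable_fun D (fun x => p.[x]).
  by apply: measurable_funTS; apply: continuous_measurable_fun; exact: continuous_horner.
have m1 : measurable_fun D (fun x => ((f x - clip N (f x)) ^+ 2)%:E).
  by apply/measurable_EFinP; apply: measurable_funX; apply: measurable_funB => //; exact: mclip.
have m2 : measurable_fun D (fun x => ((clip N (f x) - clip N (g x)) ^+ 2)%:E).
  by apply/measurable_EFinP; apply: measurable_funX; apply: measurable_funB => //; exact: mclip.
have m3 : measurable_fun D (fun x => ((clip N (g x) - p.[x]) ^+ 2)%:E).
  by apply/measurable_EFinP; apply: measurable_funX; apply: measurable_funB => //; exact: mclip.
have I2 : (\int[mu]_(x in D) ((clip N (f x) - clip N (g x)) ^+ 2)%:E <= (e / 12)%:E)%E.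
  apply: (@le_trans _ _ (\int[mu]_(x in D) ((2 * N)%:E * `|(clip N (f x) - g x)%:E|)%E)%E).
    apply: ge0_le_integral => //.
    - by move=> x _; rewrite lee_fin sqr_ge0.
    - apply: emeasurable_funM; first exact: measurable_cst.
      apply: measurableT_comp => //; apply/measurable_EFinP; apply: measurable_funB => //; exact: mclip.
    - move=> x _; rewrite -EFinM lee_fin -(real_normK (num_real (_ - _))) expr2.
      apply: ler_pM => //.
        apply: le_trans (ler_normB _ _) _; have := bclip x; have := clip_bound (g x) (ltW N0); lra.
      by have := clip_lip N (clip N (f x)) (g x); rewrite (clip_id (bclip x)).
  rewrite ge0_integralZl_EFin//; first last.
  - by rewrite mulr_ge0// ltW.
  - apply: measurableT_comp => //; apply/measurable_EFinP; apply: measurable_funB => //; exact: mclip.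
  apply: (@le_trans _ _ ((2 * N)%:E * (e / 12 / (2 * N))%:E)%E).
    by rewrite lee_pmul2l// lte_fin; lra.
  by rewrite -EFinM lee_fin mulrC divfK//; apply: lt0r_neq0; lra.
have I3 : (\int[mu]_(x in D) ((clip N (g x) - p.[x]) ^+ 2)%:E <= (e / 12)%:E)%E.
  apply: (@le_trans _ _ (\int[mu]_(x in D) (e / 12 / (2 * L))%:E)%E).
    apply: ge0_le_integral => //.
    - by move=> x _; rewrite lee_fin sqr_ge0.
    - move=> x; rewrite /D/= in_itv/= -ler_norml => xL; rewrite lee_fin.
      have := Hp x xL; rewrite le_min => /andP[h1 h2].
      rewrite -(real_normK (num_real (_ - _))) expr2 -[leRHS]mul1r; exact: ler_pM.
  rewrite integral_cst// [X in (_ * X)%E]muD -EFinM lee_fin divfK//; exact: lt0r_neq0.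
apply: (@le_trans _ _ (\int[mu]_(x in D) (3%:E * (((f x - clip N (f x)) ^+ 2)%:E + ((clip N (f x) - clip N (g x)) ^+ 2)%:E
   + ((clip N (g x) - p.[x]) ^+ 2)%:E))%E)%E).
  apply: ge0_le_integral => //.
  - by move=> x _; rewrite lee_fin sqr_ge0.
  - by apply/measurable_EFinP; apply: measurable_funX; exact: measurable_funB.
  - apply: emeasurable_funM; first exact: measurable_cst.
    by apply: emeasurable_funD => //; exact: emeasurable_funD.
  - move=> x _; rewrite -!EFinD -EFinM lee_fin.
    by apply: le_trans (sq_sum3 _ _ _); rewrite le_eqVlt; apply/orP; left; apply/eqP; congr (_ ^+ 2); ring.
have p0 (a b : R) : (0 <= ((a - b) ^+ 2)%:E)%E by rewrite lee_fin sqr_ge0.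
rewrite ge0_integralZl_EFin//; first last.
- by apply: emeasurable_funD => //; exact: emeasurable_funD.
- by move=> x _; rewrite !adde_ge0.
rewrite ge0_integralD//; first last.
- exact: emeasurable_funD.
- by move=> x _; rewrite adde_ge0.
rewrite ge0_integralD//.
apply: (@le_trans _ _ (3%:E * ((e / 12)%:E + (e / 12)%:E + (e / 12)%:E))%E).
  by rewrite lee_pmul2l ?lte_fin// !leeD.
by rewrite -!EFinD -EFinM lee_fin; lra.
Qed.

End L2Density.

(** * Measurability in the plane and spinor masses *)

Section PlaneMeasure.
Context {R : realType}.
Local Notation plane := (measurableTypeR R * measurableTypeR R)%type.

(** An open set is a countable union of rectangles with rational vertices. *)
Lemma open_measurable2 (U : set (R * R)) : open U -> measurable (U : set plane).
Proof.
move=> oU.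
pose box a b c d : set plane := (`]ratr a, ratr b[%classic : set R) `*` (`]ratr c, ratr d[%classic : set R).
have -> : (U : set plane) = \bigcup_(a in [set: rat]) \bigcup_(b in [set: rat]) \bigcup_(c in [set: rat])
    \bigcup_(d in [set: rat]) (if `[< box a b c d `<=` U >] then box a b c d else set0).
  apply/seteqP; split => [[x t] Uxt|p [a _ [b _ [c _ [d _]]]]]; last by case: asboolP => // H /H.
  have [e /= e0 He] : nbhs_ball (x, t) U by apply/nbhs_ballP; exact: open_nbhs_nbhs.
  have E1 (y : R) : y - e < y by lra.
  have E2 (y : R) : y < y + e by lra.
  have [a] := rat_in_itvoo (E1 x); rewrite in_itv /= => /andP[a1 a2].
  have [b] := rat_in_itvoo (E2 x); rewrite in_itv /= => /andP[b1 b2].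
  have [c] := rat_in_itvoo (E1 t); rewrite in_itv /= => /andP[c1 c2].
  have [d] := rat_in_itvoo (E2 t); rewrite in_itv /= => /andP[d1 d2].
  exists a => //; exists b => //; exists c => //; exists d => //.
  case: asboolP => [_|[]]; first by split; rewrite /= in_itv /= ?a2 ?b1 ?c2 ?d1.
  move=> [y s] [] /=; rewrite !in_itv /= => /andP[y1 y2] /andP[s1 s2].
  by apply: He; split; rewrite /= /ball /= ltr_norml; apply/andP; split; lra.
apply: bigcupT_measurable_rat => a; apply: bigcupT_measurable_rat => b.
apply: bigcupT_measurable_rat => c; apply: bigcupT_measurable_rat => d.
by case: asboolP => // _; apply: measurableX; exact: measurable_itv.
Qed.

Lemma closed_measurable2 (K : set (R * R)) : closed K -> measurable (K : set plane).
Proof. by move=> cK; rewrite -(setCK K); apply: measurableC; apply: open_measurable2; exact: closed_openC. Qed.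

Lemma compact_measurable2 (K : set (R * R)) : compact K -> measurable (K : set plane).
Proof. by move=> cK; apply: closed_measurable2; apply: compact_closed => //; exact: norm_hausdorff. Qed.

Lemma continuous_measurable2 (f : R * R -> R) : continuous f -> measurable_fun setT (f : plane -> R).
Proof.
move=> /continuousP cf; apply: (measurability _ (RGenOpens.measurableE R)).
move=> _ [_ [a [b ->] <-]]; rewrite setTI; apply: open_measurable2.
by apply: cf; exact: interval_open.
Qed.

Lemma measurable_box (a b c d : R) : measurable ((`[a, b]%classic `*` `[c, d]%classic) : set plane).
Proof. by apply: measurableX; exact: measurable_itv. Qed.

(** Cavalieri's principle on a rectangle. *)
Lemma box_integral_le (F : plane -> R) (a b c d e : R) :
  c <= d -> 0 <= e -> measurable_fun setT F -> (forall p, 0 <= F p) ->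
  (forall t, c <= t <= d -> (\int[leb1 R]_(x in `[a, b]) (F (x, t))%:E <= e%:E)%E) ->
  (\int[leb2 R]_(p in `[a, b] `*` `[c, d]) (F p)%:E <= (e * (d - c))%:E)%E.
Proof.
move=> cd e0 mF F0 H.
have mE : measurable_fun setT (fun p : plane => (F p)%:E) by exact/measurable_EFinP.
rewrite integral_mkcond.
have mB := measurable_box a b c d.
rewrite /leb2 fubini_tonelli2; last first.
- by move=> p; rewrite patchE; case: ifP => // _; rewrite lee_fin.
- by apply/(measurable_restrictT _ mB); apply: measurable_funTS.
rewrite /fubini_G.
apply: (@le_trans _ _ (\int[leb1 R]_(t in `[c, d]) e%:E)%E); last first.
  by rewrite integral_cst //= lebesgue_measure_itv /= lte_fin; case: ltP => [_|dc]; rewrite ?mule0 ?lee_fin ?mulr_ge0 ?subr_ge0 // -EFinD.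
rewrite [leRHS]integral_mkcond.
apply: ge0_le_integral => //.
- move=> t _; apply: integral_ge0 => x _; rewrite patchE; case: ifP => // _; by rewrite lee_fin.
- apply: measurable_fun_fubini_tonelli_G.
  + by apply/(measurable_restrictT _ mB); apply: measurable_funTS.
  + by move=> p; rewrite patchE; case: ifP => // _; rewrite lee_fin.
- have mI : measurable (`[c, d]%classic : set (measurableTypeR R)) by exact: measurable_itv.
  by apply/(measurable_restrictT _ mI); exact: measurable_cst.
- move=> t _; rewrite patchE; case: ifPn => [|/negP nt].
    rewrite inE /= in_itv /= => tt.
    apply: le_trans (H t tt); rewrite [leRHS]integral_mkcond.
    rewrite (_ : (fun x => _) = ((fun x => (F (x, t))%:E) \_ `[a, b])) //.
    apply/funext => x; rewrite !patchE; congr (if _ then _ else _).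
    by apply/idP/idP; rewrite !inE /=; [case|move=> h; split].
  rewrite (_ : (fun x => _) = cst 0%E) ?integral0 //.
  apply/funext => x; rewrite patchE; case: ifP => //; rewrite inE /= => -[/= _ h].
  by case: nt; rewrite inE.
Qed.
End PlaneMeasure.

Section SpinorIntegrals.
Context {R : realType}.

(** The square of [spinor_norm], which keeps square roots out of the integrals. *)
Definition spinor_sq (z : spinor R) : R :=
  complex.Re z.1 ^+ 2 + complex.Im z.1 ^+ 2 + (complex.Re z.2 ^+ 2 + complex.Im z.2 ^+ 2).

Lemma spinor_sq_ge0 z : 0 <= spinor_sq z.
Proof. by rewrite /spinor_sq !addr_ge0 // sqr_ge0. Qed.

Lemma spinor_sqD z w : spinor_sq (z + w) <= 2 * spinor_sq z + 2 * spinor_sq w.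
Proof.
case: z w => [[a b] [c d]] [[a' b'] [c' d']]; rewrite /spinor_sq /=.
have := sqr_ge0 (a - a'); have := sqr_ge0 (b - b'); have := sqr_ge0 (c - c'); have := sqr_ge0 (d - d').
lra.
Qed.

Lemma spinor_sqN z : spinor_sq (- z) = spinor_sq z.
Proof. by case: z => [[a b] [c d]]; rewrite /spinor_sq /= !sqrrN. Qed.

Lemma spinor_sq_eq0 z : spinor_sq z = 0 -> z = 0.
Proof.
case: z => [[a b] [c d]]; rewrite /spinor_sq /= => /eqP.
rewrite !paddr_eq0 ?addr_ge0 ?sqr_ge0 // !sqrf_eq0.
by move=> /andP[/andP[/eqP-> /eqP->] /andP[/eqP-> /eqP->]].
Qed.

Lemma spinor_sq_components z :
  [/\ complex.Re z.1 ^+ 2 <= spinor_sq z, complex.Im z.1 ^+ 2 <= spinor_sq z,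
      complex.Re z.2 ^+ 2 <= spinor_sq z & complex.Im z.2 ^+ 2 <= spinor_sq z].
Proof.
rewrite /spinor_sq; have := sqr_ge0 (complex.Re z.1); have := sqr_ge0 (complex.Im z.1).
have := sqr_ge0 (complex.Re z.2); have := sqr_ge0 (complex.Im z.2).
by split; lra.
Qed.

Context {d : measure_display} {T : measurableType d}.
Implicit Types (D : set T) (u v w : T -> spinor R).

Lemma spinor_measurable_sq D u : spinor_measurable D u -> measurable_fun D (fun x => spinor_sq (u x)).
Proof.
by move=> [m1 m2 m3 m4]; apply: measurable_funD; apply: measurable_funD; apply: measurable_funX.
Qed.

Lemma spinor_measurableB D u v : spinor_measurable D u -> spinor_measurable D v ->
  spinor_measurable D (fun x => u x - v x).
Proof.
move=> [m1 m2 m3 m4] [n1 n2 n3 n4].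
split.
- rewrite (_ : (fun _ => _) = (fun x => complex.Re (u x).1 - complex.Re (v x).1)); first exact: measurable_funB.
  by apply/funext => x /=; case: (u x) (v x) => [[? ?] [? ?]] [[? ?] [? ?]].
- rewrite (_ : (fun _ => _) = (fun x => complex.Im (u x).1 - complex.Im (v x).1)); first exact: measurable_funB.
  by apply/funext => x /=; case: (u x) (v x) => [[? ?] [? ?]] [[? ?] [? ?]].
- rewrite (_ : (fun _ => _) = (fun x => complex.Re (u x).2 - complex.Re (v x).2)); first exact: measurable_funB.
  by apply/funext => x /=; case: (u x) (v x) => [[? ?] [? ?]] [[? ?] [? ?]].
- rewrite (_ : (fun _ => _) = (fun x => complex.Im (u x).2 - complex.Im (v x).2)); first exact: measurable_funB.
  by apply/funext => x /=; case: (u x) (v x) => [[? ?] [? ?]] [[? ?] [? ?]].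
Qed.

Lemma spinor_measurableW D D' u : measurable D' -> D `<=` D' ->
  spinor_measurable D' u -> spinor_measurable D u.
Proof. by move=> mD' DD' [m1 m2 m3 m4]; split; exact: (measurable_funS mD'). Qed.

(** The square of the L^2 norm over [D]. *)
Definition mass (mu : {measure set T -> \bar R}) D u : \bar R :=
  (\int[mu]_(x in D) (spinor_sq (u x))%:E)%E.

Context (mu : {measure set T -> \bar R}).

Lemma mass_ge0 D u : (0 <= mass mu D u)%E.
Proof. by apply: integral_ge0 => x _; rewrite lee_fin spinor_sq_ge0. Qed.

Lemma mass_le_components D u (c : R) : measurable D -> spinor_measurable D u ->
  (\int[mu]_(x in D) (complex.Re (u x).1 ^+ 2)%:E <= c%:E)%E ->
  (\int[mu]_(x in D) (complex.Im (u x).1 ^+ 2)%:E <= c%:E)%E ->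
  (\int[mu]_(x in D) (complex.Re (u x).2 ^+ 2)%:E <= c%:E)%E ->
  (\int[mu]_(x in D) (complex.Im (u x).2 ^+ 2)%:E <= c%:E)%E ->
  (mass mu D u <= (4 * c)%:E)%E.
Proof.
move=> mD [m1 m2 m3 m4] h1 h2 h3 h4.
have sq0 (f : T -> R) x : D x -> (0 <= (f x ^+ 2)%:E)%E by rewrite lee_fin sqr_ge0.
have msq (f : T -> R) : measurable_fun D f -> measurable_fun D (fun x => (f x ^+ 2)%:E).
  by move=> mf; apply/measurable_EFinP; exact: measurable_funX.
rewrite /mass (_ : (fun x => _) = (fun x =>
  ((complex.Re (u x).1 ^+ 2)%:E + (complex.Im (u x).1 ^+ 2)%:E) +
  ((complex.Re (u x).2 ^+ 2)%:E + (complex.Im (u x).2 ^+ 2)%:E))%E) //.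
have n1 := msq _ m1; have n2 := msq _ m2; have n3 := msq _ m3; have n4 := msq _ m4.
rewrite ge0_integralD //; last first.
- exact: emeasurable_funD.
- by move=> x _; rewrite -EFinD lee_fin addr_ge0 // sqr_ge0.
- exact: emeasurable_funD.
- by move=> x _; rewrite -EFinD lee_fin addr_ge0 // sqr_ge0.
rewrite !ge0_integralD //; try exact: sq0.
apply: le_trans (leeD (leeD h1 h2) (leeD h3 h4)) _.
by rewrite -!EFinD lee_fin; lra.
Qed.

Lemma L2norm_mass D u : L2norm mu D u = (mass mu D u `^ 2^-1)%E.
Proof.
rewrite /L2norm unlock /mass [in RHS]integral_mkcond; congr (_ `^ _)%E.
apply: eq_integral => x _; rewrite !patchE; case: ifP => _.
  rewrite gee0_abs ?lee_fin ?sqrtr_ge0 // poweR_EFin powR_mulrn ?sqrtr_ge0 //.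
  by rewrite /spinor_norm sqr_sqrtr // spinor_sq_ge0.
by rewrite abse0 poweR0r.
Qed.

Lemma L2norm_ge0 D u : (0 <= L2norm mu D u)%E.
Proof. by rewrite L2norm_mass poweR_ge0. Qed.

Lemma L2norm_lty D u : (L2norm mu D u < +oo)%E = (mass mu D u < +oo)%E.
Proof.
rewrite L2norm_mass; apply/idP/idP => [|h]; last exact: poweR_lty.
by apply: lty_poweRy; rewrite invr_eq0.
Qed.

Lemma L2norm_le D u (e : R) : 0 <= e ->
  (L2norm mu D u <= e%:E)%E = (mass mu D u <= (e ^+ 2)%:E)%E.
Proof.
move=> e0; rewrite L2norm_mass poweR12_sqrt ?mass_ge0 //.
have := mass_ge0 D u; case: (mass mu D u) => [r| |] //=; rewrite ?leye_eq // !lee_fin => r0.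
by rewrite -[X in _ <= X](ger0_norm e0) -sqrtr_sqr ler_sqrt ?sqr_ge0 // -{2}(ger0_norm e0) real_normK ?num_real.
Qed.

Lemma L2norm_cvg0 (I : Type) (F : set_system I) {FF : Filter F} (D : I -> set T) (u : I -> T -> spinor R) :
  L2norm mu (D i) (u i) @[i --> F] --> 0%E <->
  (forall e : R, 0 < e -> \forall i \near F, (mass mu (D i) (u i) <= e%:E)%E).
Proof.
rewrite ecvg0P; last by move=> i; exact: L2norm_ge0.
split => H e e0.
  have := H (Num.sqrt e); rewrite sqrtr_gt0 => /(_ e0).
  by apply: filterS => i; rewrite L2norm_le ?sqrtr_ge0 // sqr_sqrtr // ltW.
have := H (e ^+ 2); rewrite exprn_gt0 // => /(_ isT).
by apply: filterS => i; rewrite -L2norm_le // ltW.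
Qed.

Lemma mass_triangle D u v w : measurable D ->
  spinor_measurable D u -> spinor_measurable D v -> spinor_measurable D w ->
  (mass mu D (fun x => u x - w x)%R <=
   2%:E * mass mu D (fun x => u x - v x)%R + 2%:E * mass mu D (fun x => v x - w x)%R)%E.
Proof.
move=> mD mu_ mv mw; rewrite /mass.
have m1 := spinor_measurable_sq (spinor_measurableB mu_ mv).
have m2 := spinor_measurable_sq (spinor_measurableB mv mw).
have m3 := spinor_measurable_sq (spinor_measurableB mu_ mw).
rewrite -!ge0_integralZl_EFin //; last first.
all: try by [exact/measurable_EFinP|move=> x _; rewrite lee_fin spinor_sq_ge0].
rewrite -ge0_integralD //; last first.
all: try by move=> x _; rewrite -EFinM lee_fin mulr_ge0 // spinor_sq_ge0.
all: try by apply/measurable_EFinP; apply: measurable_funM.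
apply: ge0_le_integral => //.
- by move=> x _; rewrite lee_fin spinor_sq_ge0.
- exact/measurable_EFinP.
- by apply/measurable_EFinP; apply: measurable_funD; apply: measurable_funM.
- move=> x _; rewrite -!EFinM -EFinD lee_fin.
  by rewrite (_ : u x - w x = (u x - v x) + (v x - w x)) ?spinor_sqD // addrA subrK.
Qed.

Lemma mass_sym D u v : mass mu D (fun x => u x - v x) = mass mu D (fun x => v x - u x).
Proof. by apply: eq_integral => x _; rewrite -spinor_sqN opprB. Qed.

Lemma mass_subset D D' u : measurable D -> measurable D' -> D `<=` D' -> spinor_measurable D' u ->
  (mass mu D u <= mass mu D' u)%E.
Proof.
move=> mD mD' DD' mu_; apply: ge0_subset_integral => //.
- by apply/measurable_EFinP; exact: spinor_measurable_sq.
- by move=> x _; rewrite lee_fin spinor_sq_ge0.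
Qed.

Lemma mass_eq0 D u v : measurable D -> spinor_measurable D u -> spinor_measurable D v ->
  mass mu D (fun x => u x - v x) = 0%E -> {ae mu, forall x, D x -> u x = v x}.
Proof.
move=> mD mu_ mv h.
have m3 := spinor_measurable_sq (spinor_measurableB mu_ mv).
have /(ae_eq_integral_abs mu mD) : measurable_fun D (fun x => (spinor_sq (u x - v x))%:E) by exact/measurable_EFinP.
move=> [H _]; have /H : (\int[mu]_(x in D) `|(spinor_sq (u x - v x))%:E| = 0)%E.
  by rewrite -[RHS]h; apply: eq_integral => x _; rewrite gee0_abs // lee_fin spinor_sq_ge0.
by apply: filterS => x H' /H' [] /spinor_sq_eq0 /eqP; rewrite subr_eq0 => /eqP.
Qed.
End SpinorIntegrals.

(** * Fast Cauchy sequences in the mean converge almost everywhere *)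

Section FastL2.
Context {R : realType} {d : measure_display} {T : measurableType d}.
Context (mu : {measure set T -> \bar R}).
Implicit Types (D : set T) (f : nat -> T -> R).

Lemma sqr_diff_measurable D (g h : T -> R) : measurable_fun D g -> measurable_fun D h ->
  measurable_fun D (fun x => ((g x - h x) ^+ 2)%:E).
Proof. by move=> mg mh; apply/measurable_EFinP; apply: measurable_funX; apply: measurable_funB. Qed.

(** The series of the squares weighted by [4 ^ n] is integrable, hence finite almost
   everywhere; where it is finite, the increments are bounded by a multiple of [2 ^- n]. *)
Lemma ae_fast_cvg D f (C : R) : measurable D -> 0 <= C -> (forall n, measurable_fun D (f n)) ->
  (forall n, (\int[mu]_(x in D) ((f n.+1 x - f n x) ^+ 2)%:E <= (C * (16^-1) ^+ n)%:E)%E) ->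
  {ae mu, forall x, D x -> cvgn (f^~ x)}.
Proof.
move=> mD C0 mf H.
pose g n (x : T) : \bar R := (4 ^+ n * (f n.+1 x - f n x) ^+ 2)%:E.
have g0 n x : (0 <= g n x)%E by rewrite lee_fin; apply: mulr_ge0; [apply: exprn_ge0|exact: sqr_ge0].
have mg n : measurable_fun D (g n).
  by apply/measurable_EFinP; apply: measurable_funM => //; apply: measurable_funX; apply: measurable_funB.
pose G x := (\sum_(n <oo) g n x)%E.
have G0 x : (0 <= G x)%E by apply: nneseries_ge0.
have IG : (\int[mu]_(x in D) G x < +oo)%E.
  rewrite integral_nneseries //.
  have [S HS] : exists S : R, (\sum_(n <oo) (C * (4^-1) ^+ n)%:E = S%:E :> \bar R)%E.
    have cg : series (geometric C 4^-1) @ \oo --> C * (1 - 4^-1)^-1.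
      by apply: cvg_geometric_series; rewrite ger0_norm ?invr_ge0 // invf_lt1 // ltr1n.
    exists (C * (1 - 4^-1)^-1).
    apply/cvg_lim => //.
    rewrite (_ : (fun n => _) = (fun n => (series (geometric C 4^-1) n)%:E)) //.
      by apply: cvg_EFin cg; exact: nearW.
    by apply/funext => n; rewrite /series /= sumEFin.
  apply: (@le_lt_trans _ _ (S%:E)); last exact: ltry.
  rewrite -HS; apply: lee_nneseries => [n _ _|n _]; first by apply: integral_ge0.
  rewrite /g; under eq_integral do rewrite EFinM.
  rewrite ge0_integralZl_EFin ?exprn_ge0 //; last first.
  - exact: sqr_diff_measurable.
  - by move=> x _; rewrite lee_fin sqr_ge0.
  apply: le_trans (lee_wpmul2l _ (H n)) _; first by rewrite lee_fin exprn_ge0.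
  rewrite -EFinM lee_fin mulrCA -exprMn ler_wpM2l //.
  by rewrite (_ : 4 * 16^-1 = 4^-1) //; field.
have iG : mu.-integrable D G.
  apply/integrableP; split.
    by apply: ge0_emeasurable_sum => // n x _; exact: g0.
  by under eq_integral do rewrite gee0_abs //.
have := integrable_ae mD iG; apply: filterS => x HG Dx.
have {}HG := HG Dx.
pose K := fine (G x).
have GK : G x = K%:E by rewrite fineK.
have K0 : 0 <= K by rewrite -lee_fin -GK.
have gK n : 4 ^+ n * (f n.+1 x - f n x) ^+ 2 <= K.
  rewrite -lee_fin -GK; change (g n x <= G x)%E.
  apply: le_trans (@nneseries_lim_ge _ (fun k => g k x) xpredT 0%N n.+1 _); last by [].
  rewrite big_mkcond /= big_nat_recr //= leeDr //; apply: sume_ge0 => i _; exact: g0.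
apply: (@geometric_is_cvg _ _ (Num.sqrt K)) => n.
rewrite -(ger0_norm (half_pow_ge0 n : 0 <= (2^-1 : R) ^+ n)) -(ger0_norm (sqrtr_ge0 K)) -normrM -ler_sqr ?nnegrE // !real_normK ?num_real //.
rewrite exprMn sqr_sqrtr // -exprM mulnC exprM.
have -> : (2^-1 ^+ 2 : R) = 4^-1 by field.
rewrite exprVn ler_pdivlMr ?exprn_gt0 // mulrC; exact: gK.
Qed.

(** A choice of the pointwise limit that is measurable in all variables at once, whatever the
    null set on which the sequence diverges. *)
Definition lim_fun (f : nat -> T -> R) (x : T) : R := fine (limn_esup (fun n => (f n x)%:E)).

Lemma lim_fun_cvg f x : cvgn (f^~ x) -> lim_fun f x = limn (f^~ x).
Proof.
move=> cf; rewrite /lim_fun; have : (f n x)%:E @[n --> \oo] --> (limn (f^~ x))%:E.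
  by apply: cvg_EFin; [exact: nearW|exact: cf].
by move=> /cvg_limn_einf_sup [_ ->].
Qed.

Lemma lim_fun_measurable D f : (forall n, measurable_fun D (f n)) -> measurable_fun D (lim_fun f).
Proof.
move=> mf; apply: (@measurableT_comp _ _ _ _ _ _ fine) => //.
by apply: measurable_fun_limn_esup => n; exact/measurable_EFinP.
Qed.

Lemma limn_einf_measurable D (F : nat -> T -> \bar R) : (forall n, measurable_fun D (F n)) ->
  measurable_fun D (fun x => limn_einf (F^~ x)).
Proof.
move=> mF; rewrite (_ : (fun x => _) = (fun x => - limn_esup (fun n => - F n x))%E).
  apply: measurableT_comp => //; apply: (@measurable_fun_limn_esup _ _ _ _ (fun n x => - F n x)%E) => n.
  exact: measurableT_comp.
by apply/funext => x; rewrite -(oppeK (limn_einf _)) -limn_esupN.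
Qed.

(** Fatou's lemma along the tail of the sequence, whose almost everywhere limit is [lim_fun f]
    by [ae_fast_cvg]. *)
Lemma fast_L2_limit D f (C : R) (N : nat) : measurable D -> 0 <= C ->
  (forall n, measurable_fun D (f n)) ->
  (forall n k, (N <= n)%N -> (n <= k)%N ->
    (\int[mu]_(x in D) ((f k x - f n x) ^+ 2)%:E <= (C * (16^-1) ^+ n)%:E)%E) ->
  forall n, (N <= n)%N ->
    (\int[mu]_(x in D) ((f n x - lim_fun f x) ^+ 2)%:E <= (C * (16^-1) ^+ n)%:E)%E.
Proof.
move=> mD C0 mf H n Nn.
have aec : {ae mu, forall x, D x -> cvgn (f^~ x)}.
  have := @ae_fast_cvg D (fun k => f (k + N)%N) C mD C0 (fun k => mf _).
  have E k : (C * (16^-1) ^+ (k + N) <= C * (16^-1) ^+ k).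
    by rewrite ler_wpM2l // exprD ler_piMr ?exprn_ge0 ?exprn_ile1 ?invr_ge0 // invf_le1 // ler1n.
  move=> h; have := h (fun k => le_trans (H (k + N)%N (k + N).+1 (leq_addl _ _) (leqnSn _)) _).
  move=> /(_ (fun k => E k)); apply: filterS => x h' /h'.
  by move=> /cvg_ex[l hl]; apply/cvg_ex; exists l; rewrite -(cvg_shiftn N).
have mL := lim_fun_measurable mf.
rewrite (@ge0_ae_eq_integral _ _ _ mu D _ (fun x => limn_einf (fun k => ((f k x - f n x) ^+ 2)%:E))) //.
- apply: le_trans (fatou mu mD _ _) _.
  + by move=> k; exact: sqr_diff_measurable.
  + by move=> k x _; rewrite lee_fin sqr_ge0.
  rewrite limn_einf_lim; apply: lime_le; first exact: is_cvg_einfs.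
  near=> k.
  apply: ereal_inf_le; exists (\int[mu]_(x in D) ((f (maxn k n) x - f n x) ^+ 2)%:E)%E.
    by exists (maxn k n) => //=; exact: leq_maxl.
  by apply: H => //; exact: leq_maxr.
- exact: sqr_diff_measurable.
- apply: limn_einf_measurable => k; exact: sqr_diff_measurable.
- by move=> x _; rewrite lee_fin sqr_ge0.
- move=> x _; rewrite limn_einf_lim; apply: lime_ge; first exact: is_cvg_einfs.
  by apply: nearW => k; apply: le_ereal_inf_tmp => _ [j _ <-]; rewrite lee_fin sqr_ge0.
- apply: filterS aec => x h Dx; have cx := h Dx.
  have cl : ((f k x - f n x) ^+ 2)%:E @[k --> \oo] --> ((lim_fun f x - f n x) ^+ 2)%:E.
    apply: cvg_EFin; first by apply: nearW.
    rewrite lim_fun_cvg //.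
    have c1 : (fun k => f k x - f n x) @ \oo --> limn (f^~ x) - f n x.
      by apply: cvgB => //; exact: cvg_cst.
    exact: (cvgM c1 c1).
  by rewrite (cvg_limn_einf_sup cl).1; congr (_%:E); ring.
Unshelve. all: by end_near. Qed.
End FastL2.

(** * Masses of solutions on intervals *)

Definition line_mass {R : realType} (a b : R) (u : R -> spinor R) : \bar R :=
  mass (leb1 R) `[a, b]%classic u.
Arguments line_mass {R} (a b)%_R u.

Section LineMass.
Context {R : realType}.
Implicit Types (u v w : R -> spinor R).
Local Notation line_measurable := (spinor_measurable (T := measurableTypeR R)).

Lemma itv_sub (a b a' b' : R) : a' <= a -> b <= b' -> `[a, b]%classic `<=` `[a', b']%classic.
Proof. by move=> aa bb x /=; rewrite !in_itv /= => /andP[h1 h2]; apply/andP; split; lra. Qed.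

Lemma line_mass_subset (a b a' b' : R) u : a' <= a -> b <= b' -> line_measurable setT u ->
  (line_mass a b u <= line_mass a' b' u)%E.
Proof.
move=> aa bb mu_; apply: mass_subset; [exact: measurable_itv|exact: measurable_itv|exact: itv_sub|].
exact: spinor_measurableW mu_.
Qed.

Lemma line_mass_triangle (a b : R) u v w :
  line_measurable setT u -> line_measurable setT v -> line_measurable setT w ->
  (line_mass a b (fun x => u x - w x)%R <=
   2%:E * line_mass a b (fun x => u x - v x)%R + 2%:E * line_mass a b (fun x => v x - w x)%R)%E.
Proof.
move=> mu_ mv mw; apply: mass_triangle; first exact: measurable_itv.
all: by apply: (spinor_measurableW (D' := setT)).
Qed.

Lemma line_mass_le (a b : R) u v (e M : R) : line_measurable setT u -> line_measurable setT v ->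
  (line_mass a b (fun x => u x - v x)%R <= e%:E)%E -> (line_mass a b v <= M%:E)%E ->
  (line_mass a b u <= (2 * e + 2 * M)%:E)%E.
Proof.
move=> mu_ mv h1 h2.
have m0 : line_measurable setT (fun=> 0 : spinor R) by split; exact: measurable_cst.
have E w : line_mass a b (fun x => w x - 0)%R = line_mass a b w.
  by apply: eq_integral => x _; rewrite subr0.
rewrite -E; apply: le_trans (line_mass_triangle _ _ mu_ mv m0) _.
by rewrite !E (EFinD (2 * e)) (EFinM _ e) (EFinM _ M); apply: leeD; apply: lee_wpmul2l.
Qed.
End LineMass.

Section HalfSolutionMass.
Context {R : realType} {m : R}.
Implicit Types (s : half_solution m).
Local Notation plane := (measurableTypeR R * measurableTypeR R)%type.

Definition spin s (p : R * R) : spinor R := (fa s p +i* fb s p, fc s p +i* fd s p).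

Lemma spin_measurable_line s (t : R) (D : set R) :
  spinor_measurable (T := measurableTypeR R) D (fun x => spin s (x, t)).
Proof.
by split; apply: measurable_funTS; apply: continuous_measurable_fun;
  apply: continuous_slice1; exact: c1_continuous.
Qed.

Lemma spin_measurable_plane s (D : set (R * R)) :
  spinor_measurable (T := plane) D (spin s).
Proof.
by split; apply: measurable_funTS; apply: continuous_measurable2; exact: c1_continuous.
Qed.

Lemma mass_spin s (t a b : R) : a <= b ->
  line_mass a b (fun x => spin s (x, t)) = (RI (slice (density s) t) a b)%:E.
Proof.
by move=> ab; rewrite -RI_lebesgue //; apply: slice_continuous; exact: c1_continuous.
Qed.

Lemma mass_spinB s s' (t a b : R) : a <= b ->
  line_mass a b (fun x => spin s (x, t) - spin s' (x, t)) =
  (RI (slice (diff_density s s') t) a b)%:E.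
Proof.
by move=> ab; rewrite -RI_lebesgue //; apply: slice_continuous; exact: c1_continuous.
Qed.

(** Finite speed of propagation together with conservation of charge. *)
Lemma charge_mass s (t a b : R) : 0 <= t -> a <= b ->
  (line_mass a b (fun x => spin s (x, t)) <=
   line_mass (a - t) (b + t) (fun x => spin s (x, 0%R)))%E.
Proof.
move=> t0 ab; rewrite !mass_spin //; last lra.
have := @charge_le _ _ s (a - t) (b + t) t t0.
by rewrite /cone_mass subrK addrK addr0 subr0 lee_fin => ->.
Qed.

(** [stability] for Lebesgue integrals, on the rectangle of half width [L] and height [T] inside
    the cone. *)
Lemma stability_mass (L T M : R) : 0 <= L -> 0 <= T -> 0 <= M -> exists2 C : R, 0 <= C &
  forall s s' (eta E0 : R), 0 <= eta ->
  (line_mass (- (L + T)) (L + T) (fun x => spin s (x, 0%R)) <= M%:E)%E ->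
  (line_mass (- (L + T)) (L + T) (fun x => spin s' (x, 0%R)) <= M%:E)%E ->
  (forall mu y, `|y| <= L + T -> `|pot s mu (y, 0) - pot s' mu (y, 0)| <= eta /\
     `|pott s mu (y, 0) - pott s' mu (y, 0)| <= eta) ->
  (line_mass (- (L + T)) (L + T) (fun x => spin s (x, 0%R) - spin s' (x, 0%R))%R <= E0%:E)%E ->
  (forall t : R, 0 <= t <= T ->
    (line_mass (- L) L (fun x => spin s (x, t) - spin s' (x, t))%R
       <= (C * (E0 + eta ^+ 2))%:E)%E) /\
  (forall mu (x t : R), 0 <= t <= T -> `|x| <= L ->
     (pot s mu (x, t) - pot s' mu (x, t)) ^+ 2 <= C * (E0 + eta ^+ 2)).
Proof.
move=> L0 T0 M0; have [C C0 HC] := stability m T0 M0; exists C => // s s' eta E0 eta0.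
have LT : - (L + T) <= L + T by lra.
rewrite !mass_spin // mass_spinB // !lee_fin => hs hs' hp hE.
have [] := HC s s' (- (L + T)) (L + T) eta E0.
- by lra.
- by [].
- by rewrite /cone_mass addr0 subr0.
- by rewrite /cone_mass addr0 subr0.
- by move=> mu y yL; apply: hp; rewrite ler_norml.
- by rewrite /cone_mass addr0 subr0.
move=> h1 h2; split => [t tT|mu x t tT xL].
  have /andP[t0 tT'] := tT.
  apply: le_trans (line_mass_subset (a' := - (L + T) + t) (b' := L + T - t) _ _ _) _.
  - lra.
  - lra.
  - by apply: spinor_measurableB; exact: spin_measurable_line.
  by rewrite mass_spinB ?lee_fin; [exact: h1|lra].
have /andP[t0 tT'] := tT; move: xL; rewrite ler_norml => /andP[x1 x2].
by apply: h2 => //; apply/andP; split; lra.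
Qed.
End HalfSolutionMass.

(** * The limit of a fast approximating sequence *)

Lemma exists_nat_ge {R : realType} (x : R) : exists N : nat, x <= N%:R.
Proof. by exists (Num.truncn x).+1; apply: ltW; rewrite truncnS_gt. Qed.

Section FastApproximation.
Context {R : realType} {m : R}.
Context (psi : R -> spinor R) (a0 a1 : 'I_2 -> R -> R) (s : nat -> half_solution m).
Local Notation plane := (measurableTypeR R * measurableTypeR R)%type.

(** The rate [16 ^- n] leaves room for the weights [4 ^ n] of [ae_fast_cvg]. *)
Definition fast_data : Prop :=
  (forall n, (line_mass (- n.+1%:R) n.+1%:R (fun x => spin (s n) (x, 0%R) - psi x)%R
               <= ((16^-1) ^+ n)%:E)%E) /\
  (forall n mu (x : R), `|x| <= n.+1%:R ->
     `|pot (s n) mu (x, 0) - a0 mu x| <= (16^-1) ^+ n /\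
     `|pott (s n) mu (x, 0) - a1 mu x| <= (16^-1) ^+ n).

Context (psiL2 : inL2 psi).
Context (data : fast_data).

Let rate_ge0 n : 0 <= (16^-1 : R) ^+ n. Proof. by rewrite exprn_ge0. Qed.
Let rate_le n k : (n <= k)%N -> (16^-1 : R) ^+ k <= (16^-1) ^+ n.
Proof. by move=> nk; apply: ler_wiXn2l => //; lra. Qed.

Let psi_meas : spinor_measurable (T := measurableTypeR R) setT psi. Proof. by case: psiL2. Qed.

Lemma psi_charge : exists2 P : R, 0 <= P & mass (leb1 R) setT psi = P%:E.
Proof.
have [_] := psiL2; rewrite L2norm_lty => h.
have := mass_ge0 (leb1 R) setT psi.
by case: (mass _ _ _) h => // P _; rewrite lee_fin => P0; exists P.
Qed.

Lemma psi_line_mass (a b P : R) : mass (leb1 R) setT psi = P%:E -> (line_mass a b psi <= P%:E)%E.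
Proof. by move=> <-; apply: mass_subset => //; exact: measurable_itv. Qed.

Lemma data_line_mass L n : L <= n.+1%:R ->
  (line_mass (- L) L (fun x => spin (s n) (x, 0%R) - psi x)%R <= ((16^-1) ^+ n)%:E)%E.
Proof.
move=> Ln; apply: le_trans (data.1 n); apply: line_mass_subset; first by rewrite lerN2.
  by [].
by apply: spinor_measurableB => //; exact: spin_measurable_line.
Qed.

Lemma data_mass_bound : exists2 M : R, 0 <= M &
  forall L n, L <= n.+1%:R -> (line_mass (- L) L (fun x => spin (s n) (x, 0%R)) <= M%:E)%E.
Proof.
have [P P0 HP] := psi_charge; exists (2 * 1 + 2 * P); first by lra.
move=> L n Ln; apply: (line_mass_le (v := psi)) => //; first exact: spin_measurable_line.
  apply: le_trans (data_line_mass Ln) _; rewrite lee_fin -(expr0 (16^-1)); exact: rate_le.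
exact: psi_line_mass.
Qed.

(** Late approximants have almost equal data on large intervals and uniformly bounded charges,
    so [stability_mass] applies with one constant. *)
Lemma fast_cauchy (L T : R) : 0 <= L -> 0 <= T -> exists (C : R) (N : nat), 0 <= C /\
  forall n k, (N <= n)%N -> (n <= k)%N ->
  (forall t : R, 0 <= t <= T -> (line_mass (- L) L
     (fun x => spin (s k) (x, t) - spin (s n) (x, t))%R <= (C * (16^-1) ^+ n)%:E)%E) /\
  (forall mu (x t : R), 0 <= t <= T -> `|x| <= L ->
     (pot (s k) mu (x, t) - pot (s n) mu (x, t)) ^+ 2 <= C * (16^-1) ^+ n).
Proof.
move=> L0 T0; have [M M0 HM] := data_mass_bound.
have [C C0 HC] := @stability_mass R m L T M L0 T0 M0.
have [N HN] : exists N : nat, L + T <= N%:R.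
  exact: exists_nat_ge.
exists (C * 8), N; split; first by lra.
move=> n k Nn nk.
have Ln : L + T <= n.+1%:R by apply: le_trans HN _; rewrite ler_nat; exact: leqW.
have Lk : L + T <= k.+1%:R by apply: le_trans Ln _; rewrite ler_nat ltnS.
have kn := rate_le nk; have r0 := rate_ge0 n; have r1 := rate_ge0 k.
have r2 : (16^-1 : R) ^+ n <= 1 by rewrite -(expr0 (16^-1)); exact: rate_le.
have [] := HC (s k) (s n) (2 * (16^-1) ^+ n) (4 * (16^-1) ^+ n).
- by lra.
- exact: HM.
- exact: HM.
- move=> mu y yL.
  have [h1 h2] := data.2 n mu y (le_trans yL Ln); have [h3 h4] := data.2 k mu y (le_trans yL Lk).
  have tr (u v w : R) : `|u - w| <= `|u - v| + `|w - v|.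
    by have := ler_normD (u - v) (v - w); rewrite addrA subrK (distrC w).
  by split; [have := tr (pot (s k) mu (y, 0)) (a0 mu y) (pot (s n) mu (y, 0))|
             have := tr (pott (s k) mu (y, 0)) (a1 mu y) (pott (s n) mu (y, 0))]; lra.
- have mk := spin_measurable_line (s k) 0 setT; have mn := spin_measurable_line (s n) 0 setT.
  apply: le_trans (line_mass_triangle _ _ mk psi_meas mn) _.
  have -> : 4 * (16^-1 : R) ^+ n = 2 * (16^-1) ^+ n + 2 * (16^-1) ^+ n by lra.
  rewrite (EFinD (2 * _)) (EFinM 2); apply: leeD; apply: lee_wpmul2l => //.
    by apply: le_trans (data_line_mass Lk) _; rewrite lee_fin.
  rewrite /line_mass mass_sym; exact: data_line_mass.
have E : C * (4 * 16^-1 ^+ n + (2 * 16^-1 ^+ n) ^+ 2) <= C * 8 * 16^-1 ^+ n.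
  rewrite -mulrA ler_wpM2l //; set r := _ ^+ n in r0 r2 *.
  have -> : (2 * r) ^+ 2 = 4 * (r * r) by ring.
  have := ler_piMl r0 r2; lra.
move=> h1 h2; split => [t tT|mu x t tT xL]; last exact: le_trans (h2 _ _ _ tT xL) E.
by apply: le_trans (h1 t tT) _; rewrite lee_fin.
Qed.

Definition Psi_lim (p : R * R) : spinor R :=
  (lim_fun (fun n p => fa (s n) p) p +i* lim_fun (fun n p => fb (s n) p) p,
   lim_fun (fun n p => fc (s n) p) p +i* lim_fun (fun n p => fd (s n) p) p).

Definition A_lim (mu : 'I_2) (p : R * R) : R := limn (fun n => pot (s n) mu p).

Lemma Psi_lim_measurable : spinor_measurable (T := plane) setT Psi_lim.
Proof. by split; apply: lim_fun_measurable => n; apply: continuous_measurable2; exact: c1_continuous. Qed.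

Lemma Psi_lim_measurable_line (t : R) :
  spinor_measurable (T := measurableTypeR R) setT (fun x => Psi_lim (x, t)).
Proof.
have H (g : nat -> c1fun) : measurable_fun setT
    (fun x : measurableTypeR R => lim_fun (fun n (p : R * R) => g n p) (x, t)).
  apply: (@lim_fun_measurable _ _ _ _ (fun n (x : measurableTypeR R) => g n (x, t))) => n.
  by apply: continuous_measurable_fun; apply: continuous_slice1; exact: c1_continuous.
by split; exact: H.
Qed.

(** The L^2 bounds pass to the limit at each fixed time, with constants uniform in time. *)
Lemma fast_limit (L T : R) : 0 <= L -> 0 <= T -> exists (C : R) (N : nat), 0 <= C /\
  forall n, (N <= n)%N ->
  (forall t : R, 0 <= t <= T -> (line_mass (- L) L
     (fun x => spin (s n) (x, t) - Psi_lim (x, t))%R <= (C * (16^-1) ^+ n)%:E)%E) /\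
  (forall mu (x t : R), 0 <= t <= T -> `|x| <= L ->
     `|pot (s n) mu (x, t) - A_lim mu (x, t)| <= C * (2^-1) ^+ n).
Proof.
move=> L0 T0; have [C [N [C0 HC]]] := fast_cauchy L0 T0.
pose K := 5 * C + 1; have CK : 4 * C <= K by rewrite /K; lra.
have K0 : 0 <= K by rewrite /K; lra.
have mI : measurable (`[- L, L]%classic : set (measurableTypeR R)) by exact: measurable_itv.
have mline (g : c1fun) (t : R) : measurable_fun `[- L, L]%classic (fun x : measurableTypeR R => g (x, t)).
  by apply: measurable_funTS; apply: continuous_measurable_fun; apply: continuous_slice1; exact: c1_continuous.
exists K, N; split => // n Nn; split => [t tT|mu x t tT xL].
  have comp (g : half_solution m -> c1fun) :
      (forall s s' p, (g s p - g s' p) ^+ 2 <= spinor_sq (spin s p - spin s' p)) ->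
      (\int[leb1 R]_(x in `[(- L)%R, L]) ((g (s n) (x, t) - lim_fun (fun n p => g (s n) p) (x, t)) ^+ 2)%:E
        <= (C * (16^-1) ^+ n)%:E)%E.
    move=> Hg; apply: (@fast_L2_limit _ _ _ (leb1 R) _ (fun n x => g (s n) (x, t)) C N) => // [i|i j Ni ij]; first exact: mline.
    have [h _] := HC i j Ni ij; apply: le_trans (h t tT); apply: ge0_le_integral => //.
    - by move=> x _; rewrite lee_fin sqr_ge0.
    - exact: sqr_diff_measurable (mline _ _) (mline _ _).
    - apply/measurable_EFinP; apply: spinor_measurable_sq.
      by apply: spinor_measurableB; exact: spin_measurable_line.
    - by move=> x _; rewrite lee_fin.
  have Ha := comp (fun s => fa s) (fun s s' p => let: And4 h _ _ _ := spinor_sq_components (spin s p - spin s' p) in h).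
  have Hb := comp (fun s => fb s) (fun s s' p => let: And4 _ h _ _ := spinor_sq_components (spin s p - spin s' p) in h).
  have Hc := comp (fun s => fc s) (fun s s' p => let: And4 _ _ h _ := spinor_sq_components (spin s p - spin s' p) in h).
  have Hd := comp (fun s => fd s) (fun s s' p => let: And4 _ _ _ h := spinor_sq_components (spin s p - spin s' p) in h).
  apply: le_trans (@mass_le_components _ _ _ (leb1 R) `[- L, L]%classic
    (fun x : R => spin (s n) (x, t) - Psi_lim (x, t)) _ mI _ Ha Hb Hc Hd) _.
    apply: spinor_measurableB; first exact: spin_measurable_line.
    exact: spinor_measurableW (Psi_lim_measurable_line t).
  by rewrite lee_fin mulrA; exact: ler_wpM2r.
have H i j : (N <= i)%N -> (i <= j)%N -> `|pot (s j) mu (x, t) - pot (s i) mu (x, t)| <= K * (2^-1) ^+ i.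
  move=> Ni ij; have [_ h] := HC i j Ni ij; have {}h := h mu x t tT xL.
  have b0 := half_pow_ge0 i : 0 <= (2^-1 : R) ^+ i.
  have h1 : (16^-1 : R) ^+ i <= ((2^-1) ^+ i) ^+ 2.
    rewrite -exprM mulnC exprM; apply: lerXn2r; rewrite ?nnegrE ?exprn_ge0 ?invr_ge0 //; lra.
  rewrite -ler_sqr ?nnegrE ?mulr_ge0 // real_normK ?num_real //; apply: le_trans h _.
  apply: le_trans (ler_wpM2l C0 h1) _; rewrite exprMn; apply: ler_wpM2r; first exact: sqr_ge0.
  by rewrite /K; have := mulr_ge0 C0 C0; rewrite (_ : (5 * C + 1) ^+ 2 = 25 * (C * C) + 10 * C + 1); [lra|ring].
have cv : (fun k => pot (s k) mu (x, t)) @ \oo --> A_lim mu (x, t).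
  have : cvgn (fun k => pot (s (k + N)%N) mu (x, t)).
    apply: (@geometric_is_cvg _ _ K) => k; apply: le_trans (H _ _ (leq_addl _ _) (leqnSn _)) _.
    by rewrite ler_wpM2l // exprD ler_piMr ?half_pow_ge0 // exprn_ile1 ?invr_ge0 // invf_le1 // ler1n.
  move=> /cvg_ex[l]; rewrite (cvg_shiftn N (fun k => pot (s k) mu (x, t))) => hl.
  by apply/cvg_ex; exists l.
apply/ler_addgt0Pr => e e0; have /cvgrPdist_le/(_ _ e0)[k _ Hk] := cv.
have := Hk (maxn n k) (leq_maxr n k); have := H n (maxn n k) Nn (leq_maxl n k).
have := ler_normD (pot (s n) mu (x, t) - pot (s (maxn n k)) mu (x, t))
  (pot (s (maxn n k)) mu (x, t) - A_lim mu (x, t)); rewrite addrA subrK.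
rewrite (distrC (pot (s n) mu (x, t)) (pot (s (maxn n k)) mu (x, t))) (distrC (A_lim _ _)); lra.
Qed.
End FastApproximation.

(** * Tails *)

Section Tails.
Context {R : realType}.
Implicit Types (u v w : R -> spinor R).
Local Notation line_measurable := (spinor_measurable (T := measurableTypeR R)).

Definition tail_mass (k : R) u : \bar R := mass (leb1 R) (~` `[- k, k]%classic) u.

Lemma measurable_tail (k : R) : measurable (~` `[- k, k]%classic : set (measurableTypeR R)).
Proof. by apply: measurableC; exact: measurable_itv. Qed.

Lemma mass_split (k : R) u : line_measurable setT u ->
  mass (leb1 R) setT u = (line_mass (- k) k u + tail_mass k u)%E.
Proof.
move=> mu_; rewrite /line_mass /tail_mass /mass -ge0_integral_setU //.
- by rewrite setUv.
- exact: measurable_tail.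
- by rewrite setUv; apply/measurable_EFinP; exact: spinor_measurable_sq.
- by move=> x _; rewrite lee_fin spinor_sq_ge0.
- by apply/disj_set2P; rewrite setICr.
Qed.

Lemma mass_exhaust (F : nat -> set R) u (M : \bar R) : line_measurable setT u ->
  nondecreasing_seq F -> (forall k, measurable (F k : set (measurableTypeR R))) ->
  (forall k, (mass (leb1 R) (F k) u <= M)%E) -> (mass (leb1 R) (\bigcup_k F k) u <= M)%E.
Proof.
move=> mu_ nF mF H.
have c : mass (leb1 R) (F k) u @[k --> \oo] --> mass (leb1 R) (\bigcup_k F k) u.
  apply: ge0_nondecreasing_set_cvg_integral => // [k|k x _]; last by rewrite lee_fin spinor_sq_ge0.
  apply/measurable_EFinP; apply: spinor_measurable_sq; exact: (spinor_measurableW (D' := setT)).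
rewrite -(cvg_lim _ c) //; apply: lime_le; first by apply/cvg_ex; eexists; exact: c.
by apply: nearW => k; exact: H.
Qed.

Lemma mass_setT_le u (M : \bar R) : line_measurable setT u ->
  (forall k : nat, (line_mass (- k%:R) k%:R u <= M)%E) -> (mass (leb1 R) setT u <= M)%E.
Proof.
move=> mu_ H; rewrite (_ : setT = \bigcup_(k : nat) `[- k%:R, k%:R]%classic); last first.
  apply/seteqP; split => // x _; have [k Hk] := exists_nat_ge `|x|.
  by exists k => //=; rewrite in_itv /= -ler_norml.
apply: mass_exhaust => // k j kj.
by apply/subsetPset; apply: itv_sub; rewrite ?lerN2 ler_nat.
Qed.

(** The two half lines are exhausted by bounded intervals, to which the hypothesis applies;
    widening them by [q] keeps them outside [- k, k] because they start at distance [k + q + 1].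
    *)
Lemma tail_mass_le u v (k q c : R) : 0 <= k -> 0 <= q -> 0 <= c ->
  line_measurable setT u -> line_measurable setT v ->
  (forall a b : R, a <= b -> (line_mass a b u <= c%:E * line_mass (a - q) (b + q) v)%E) ->
  (tail_mass (k + q + 1) u <= (2 * c)%:E * tail_mass k v)%E.
Proof.
move=> k0 q0 c0 mu_ mv H; set r := k + q + 1.
have r0 : 0 < r by rewrite /r; lra.
pose F (j : nat) : set R := `[- (r + j%:R), - r]%classic `|` `[r, r + j%:R]%classic.
have mF j : measurable (F j : set (measurableTypeR R)).
  by apply: measurableU; [exact: (measurable_itv `[- (r + j%:R), - r])|exact: (measurable_itv `[r, r + j%:R])].
apply: (@le_trans _ _ (mass (leb1 R) (\bigcup_j F j) u)).
  apply: mass_subset.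
  - exact: measurable_tail.
  - by apply: bigcupT_measurable => j; exact: mF.
  - move=> x /=; rewrite in_itv /= => xr.
    have [j Hj] := exists_nat_ge `|x|; exists j => //; rewrite /F /= !in_itv /=.
    move: Hj; rewrite ler_norml => /andP[h1 h2].
    by have [x0|x0] := leP 0 x; [right|left]; apply/andP; split; lra.
  - exact: (spinor_measurableW (D' := setT)).
apply: mass_exhaust => // [i j ij|j].
  have ij' : i%:R <= j%:R :> R by rewrite ler_nat.
  by apply/subsetPset; apply: setUSS; apply: itv_sub; lra.
have j0 : 0 <= j%:R :> R by exact: ler0n.
have T a b : (forall x, a <= x <= b -> k < `|x|) -> (line_mass a b v <= tail_mass k v)%E.
  move=> h; apply: mass_subset.
  - exact: (measurable_itv `[a, b]).
  - exact: measurable_tail.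
  - move=> x /=; rewrite !in_itv /= => /h; rewrite ltNge => /negP xk; apply/negP.
    by rewrite -ler_norml; exact/negP.
  - exact: (spinor_measurableW (D' := setT)).
rewrite /mass ge0_integral_setU; first last.
- apply/disj_set2P; rewrite -subset0 => x /=; rewrite !in_itv /=; lra.
- by move=> x _; rewrite lee_fin spinor_sq_ge0.
- apply/measurable_EFinP; apply: spinor_measurable_sq; exact: (spinor_measurableW (D' := setT)).
- exact: (measurable_itv `[r, r + j%:R]).
- exact: (measurable_itv `[- (r + j%:R), - r]).
have h1 : (line_mass (- (r + j%:R)) (- r) u <= c%:E * tail_mass k v)%E.
  apply: le_trans (H _ _ _) _; first lra.
  apply: lee_wpmul2l => //; apply: T => x /andP[x1 x2]; rewrite ltr0_norm; rewrite /r in x1 x2; lra.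
have h2 : (line_mass r (r + j%:R) u <= c%:E * tail_mass k v)%E.
  apply: le_trans (H _ _ _) _; first lra.
  apply: lee_wpmul2l => //; apply: T => x /andP[x1 x2]; rewrite gtr0_norm; rewrite /r in x1 x2; lra.
apply: le_trans (leeD h1 h2) _.
by rewrite EFinM -muleA -mule2n -mule_natl.
Qed.

Lemma tail_mass_small u (P e : R) : line_measurable setT u -> mass (leb1 R) setT u = P%:E -> 0 < e ->
  exists2 k : R, 0 <= k & (tail_mass k u <= e%:E)%E.
Proof.
move=> mu_ HP e0.
have [k Hk] : exists k : nat, ((P - e)%:E <= line_mass (- k%:R) k%:R u)%E.
  apply/not_existsP => H.
  have : (mass (leb1 R) setT u <= (P - e)%:E)%E.
    apply: mass_setT_le => // k; apply: ltW; rewrite ltNge; apply/negP; exact: H.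
  by rewrite HP lee_fin; lra.
exists k%:R => //.
have := mass_split k%:R mu_; rewrite HP; move: Hk; rewrite /line_mass.
have := mass_ge0 (leb1 R) (~` `[- k%:R, k%:R]%classic) u; rewrite -/(tail_mass k%:R u).
have := mass_ge0 (leb1 R) (`[- k%:R, k%:R]%classic) u.
case: (mass _ _ _) => [a| |] //; case: (tail_mass _ _) => [b| |] // _ _.
by rewrite -EFinD !lee_fin => h [h']; lra.
Qed.

Lemma tail_mass_triangle (k : R) u v : line_measurable setT u -> line_measurable setT v ->
  (tail_mass k (fun x => u x - v x)%R <= 2%:E * tail_mass k u + 2%:E * tail_mass k v)%E.
Proof.
move=> mu_ mv; have mT := measurable_tail k.
have W w : line_measurable setT w -> spinor_measurable (T := measurableTypeR R) (~` `[- k, k]%classic) w.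
  exact: (spinor_measurableW (D' := setT)).
have m0 : line_measurable setT (fun=> 0 : spinor R) by split; exact: measurable_cst.
have := mass_triangle (leb1 R) mT (W _ mu_) (W _ m0) (W _ mv).
rewrite [X in (2%:E * X + _)%E](_ : _ = tail_mass k u); last by apply: eq_integral => x _; rewrite subr0.
rewrite [X in (_ + 2%:E * X)%E](_ : _ = tail_mass k v) //.
by apply: eq_integral => x _; rewrite sub0r spinor_sqN.
Qed.
End Tails.

(** * Time continuity of the limit *)

Section LimitRegularity.
Context {R : realType} {m : R}.
Context (psi : R -> spinor R) (a0 a1 : 'I_2 -> R -> R) (s : nat -> half_solution m).
Context (psiL2 : inL2 psi) (data : fast_data psi a0 a1 s).
Local Notation Psi := (Psi_lim s).
Local Notation A := (A_lim s).

Let psi_meas : spinor_measurable (T := measurableTypeR R) setT psi. Proof. by case: psiL2. Qed.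
Let mspin n t : spinor_measurable (T := measurableTypeR R) setT (fun x => spin (s n) (x, t)).
Proof. exact: spin_measurable_line. Qed.
Let mPsi t : spinor_measurable (T := measurableTypeR R) setT (fun x => Psi (x, t)).
Proof. exact: Psi_lim_measurable_line. Qed.

Lemma rate_small (C e : R) (N : nat) : 0 < e -> exists2 n, (N <= n)%N & C * (16^-1) ^+ n <= e.
Proof.
move=> e0; have [k Hk] := half_pow_small `|C| e0; exists (N + k)%N; first exact: leq_addr.
apply: le_trans Hk; apply: le_trans (ler_wpM2r _ (ler_norm C)) _; first by rewrite exprn_ge0.
apply: ler_wpM2l => //.
have le1 (x : R) j : 0 <= x -> x <= 1 -> x ^+ j <= 1 by move=> *; exact: exprn_ile1.
rewrite exprD; apply: (@le_trans _ _ (1 * (16^-1) ^+ k)).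
  by apply: ler_wpM2r; [rewrite exprn_ge0|apply: le1; lra].
by rewrite mul1r; apply: lerXn2r; rewrite ?nnegrE; lra.
Qed.

Lemma psi_line_massE (a b : R) : exists2 Q : R, 0 <= Q & line_mass a b psi = Q%:E.
Proof.
have [P P0 HP] := psi_charge psiL2; have := psi_line_mass psiL2 a b HP.
have := mass_ge0 (leb1 R) `[a, b]%classic psi; rewrite -/(line_mass a b psi).
by case: (line_mass a b psi) => // Q; rewrite lee_fin => Q0 _; exists Q.
Qed.

(** [charge_mass] for the approximants passes to the limit. Each of the two passages, from the
    limit to an approximant and from its data to [psi], costs a factor two in the triangle
    inequality for squares. *)
Lemma limit_charge (t a b : R) : 0 <= t -> a <= b ->
  (line_mass a b (fun x => Psi (x, t)) <= 4%:E * line_mass (a - t) (b + t) psi)%E.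
Proof.
move=> t0 ab; apply/lee_addgt0Pr => e e0.
pose L := `|a| + `|b| + t.
have na := ler_norm a; have nb := ler_norm b; have na' := ler_norm (- a); have nb' := ler_norm (- b).
rewrite !normrN in na' nb'; have n0 := normr_ge0 a; have n1 := normr_ge0 b.
have L0 : 0 <= L by rewrite /L; lra.
have [C [N [C0 HC]]] := fast_limit psiL2 data L0 t0.
have [N' HN'] := exists_nat_ge L.
have [n Nn Hn] := rate_small (2 * C + 4) (maxn N N') e0.
have Ln : L <= n.+1%:R.
  by apply: le_trans HN' _; rewrite ler_nat; apply: leq_trans (leq_maxr N N') (leq_trans Nn _).
have [h1 _] := HC n (leq_trans (leq_maxl N N') Nn).
have {}h1 : (line_mass a b (fun x => spin (s n) (x, t) - Psi (x, t))%R <= (C * (16^-1) ^+ n)%:E)%E.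
  apply: le_trans (h1 t _); last by rewrite t0 lexx.
  by apply: line_mass_subset; [rewrite /L; lra|rewrite /L; lra|exact: spinor_measurableB].
have h2 := charge_mass (s n) t0 ab.
have h3 : (line_mass (a - t) (b + t) (fun x => spin (s n) (x, 0%R) - psi x)%R <= ((16^-1) ^+ n)%:E)%E.
  apply: le_trans (data_line_mass psiL2 data Ln).
  by apply: line_mass_subset; [rewrite /L; lra|rewrite /L; lra|exact: spinor_measurableB].
have [Q Q0 HQ] := psi_line_massE (a - t) (b + t).
rewrite HQ -EFinM -EFinD.
have h4 := line_mass_le (mspin n 0) psi_meas h3 (eq_ind _ (fun z => z <= Q%:E)%E (lexx _) _ (esym HQ)).
have h5 : (line_mass a b (fun x => Psi (x, t) - spin (s n) (x, t))%R <= (C * (16^-1) ^+ n)%:E)%E.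
  by rewrite /line_mass mass_sym.
apply: le_trans (line_mass_le (mPsi t) (mspin n t) h5 (le_trans h2 h4)) _.
rewrite lee_fin; lra.
Qed.

Lemma limit_inL2 (t : R) : 0 <= t -> inL2 (fun x => Psi (x, t)).
Proof.
move=> t0; split; first exact: mPsi.
have [P P0 HP] := psi_charge psiL2.
rewrite L2norm_lty; apply: (@le_lt_trans _ _ (4 * P)%:E); last exact: ltry.
apply: mass_setT_le => // k; apply: le_trans (limit_charge t0 _) _.
  by have := ler0n R k; lra.
by rewrite EFinM; apply: lee_wpmul2l => //; exact: psi_line_mass.
Qed.

(** No charge escapes to infinity in bounded time. *)
Lemma limit_tail (T e : R) : 0 <= T -> 0 < e -> exists2 k : R, 0 <= k &
  forall t : R, 0 <= t <= T -> (tail_mass k (fun x => Psi (x, t)) <= e%:E)%E.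
Proof.
move=> T0 e0; have [P P0 HP] := psi_charge psiL2.
have e1 : 0 < e / 8 by lra.
have [k k0 Hk] := tail_mass_small psi_meas HP e1.
exists (k + T + 1); first lra.
move=> t /andP[t0 tT].
apply: le_trans (tail_mass_le (c := 4) k0 T0 _ (mPsi t) psi_meas _) _; last first.
- by apply: le_trans (lee_wpmul2l _ Hk) _ => //; rewrite -EFinM lee_fin; lra.
- move=> a b ab; apply: le_trans (limit_charge t0 ab) _; apply: lee_wpmul2l => //.
  by apply: line_mass_subset => //; lra.
- by [].
Qed.

Lemma spin_continuous_mass n (L t0 : R) : 0 <= L ->
  forall e : R, 0 < e -> \forall t \near t0,
  (line_mass (- L) L (fun x => spin (s n) (x, t) - spin (s n) (x, t0))%R <= e%:E)%E.
Proof.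
move=> L0 e e0.
pose h (p : R * R) : R := spinor_sq (spin (s n) p - spin (s n) (p.1, t0)).
have cg (g : c1fun) : continuous (fun p : R * R => g p - g (p.1, t0)).
  apply: plane_continuousB; first exact: c1_continuous.
  apply: (@continuous_pair _ _ g fst (fun=> t0)) => x; [exact: c1_continuous|exact: cvg_fst|exact: cvg_cst].
have ch : continuous h.
  have sq (g : c1fun) : continuous (fun p : R * R => (g p - g (p.1, t0)) ^+ 2) .
    by under eq_fun do rewrite expr2; apply: plane_continuousM.
  exact: (plane_continuousD (plane_continuousD (sq (fa _)) (sq (fb _))) (plane_continuousD (sq (fc _)) (sq (fd _)))).
have cI : continuous (fun t => RI (slice h t) (- L) L).
  by apply: (@RI_slice_continuous _ h (fun=> - L) (fun=> L)) => // t; exact: cvg_cst.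
have I0 : RI (slice h t0) (- L) L = 0.
  rewrite (_ : slice h t0 = fun=> 0) ?RI_cst ?mul0r //.
  by apply/funext => x; rewrite /slice /h subrr /spinor_sq /= !expr2 !mulr0 !addr0.
have [d d0 Hd] := (continuous1P _ _).1 (cI t0) e e0.
apply/nbhs_ballP; exists d => //= t /= td.
rewrite /line_mass /mass (RI_lebesgue (f := slice h t)) //; last exact: slice_continuous.
  rewrite lee_fin; have := Hd t; rewrite I0 subr0 distrC => /(_ td) h1.
  exact: le_trans (ler_norm _) h1.
lra.
Qed.

(** Tails are uniformly small in time, and on bounded intervals the limit is uniformly close to
    a smooth solution, which is continuous in time. *)
Theorem limit_inCL2 : inCL2 Psi.
Proof.
split => [t t0|t0 t00]; first exact: limit_inL2.
apply/L2norm_cvg0 => e e0.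
have T0 : 0 <= t0 + 1 by lra.
have e1 : 0 < e / 8 by lra.
have [L L0 HL] := limit_tail T0 e1.
have [C [N [C0 HC]]] := fast_limit psiL2 data L0 T0.
have e2 : 0 < e / 48 by lra.
have [n Nn Hn] := rate_small C N e2.
have [h1 _] := HC n Nn.
have near1 : \forall t \near t0, `|t0 - t| < 1.
  by apply/nbhs_ballP; exists 1 => //=.
suff : \forall t \near t0, 0 <= t ->
    (mass (leb1 R) setT (fun x => Psi (x, t) - Psi (x, t0))%R <= e%:E)%E by [].
have near2 := spin_continuous_mass n t0 L0 e2.
near=> t => tt.
have td : `|t0 - t| < 1 by near: t.
have h3 : (line_mass (- L) L (fun x => spin (s n) (x, t) - spin (s n) (x, t0))%R <= (e / 48)%:E)%E.
  by near: t.
have tT : 0 <= t <= t0 + 1.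
  by move: td; rewrite ltr_norml tt /= => /andP[]; lra.
have tT0 : 0 <= t0 <= t0 + 1 by rewrite t00; lra.
have E (u : R) : 0 <= u <= t0 + 1 ->
    (line_mass (- L) L (fun x => spin (s n) (x, u) - Psi (x, u))%R <= (e / 48)%:E)%E.
  by move=> uT; apply: le_trans (h1 u uT) _; rewrite lee_fin.
have h4 : (line_mass (- L) L (fun x => spin (s n) (x, t) - Psi (x, t0))%R <= (e / 12)%:E)%E.
  apply: le_trans (line_mass_triangle _ _ (mspin n t) (mspin n t0) (mPsi t0)) _.
  apply: le_trans (leeD (lee_wpmul2l _ h3) (lee_wpmul2l _ (E t0 tT0))) _ => //.
  by rewrite -!EFinM -EFinD lee_fin; lra.
have h5 : (line_mass (- L) L (fun x => Psi (x, t) - Psi (x, t0))%R <= (e / 2)%:E)%E.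
  apply: le_trans (line_mass_triangle _ _ (mPsi t) (mspin n t) (mPsi t0)) _.
  have h6 := E t tT; rewrite /line_mass mass_sym -/(line_mass (- L) L _) in h6.
  apply: le_trans (leeD (lee_wpmul2l _ h6) (lee_wpmul2l _ h4)) _ => //.
  by rewrite -!EFinM -EFinD lee_fin; lra.
rewrite (mass_split L); last exact: spinor_measurableB.
have h7 : (tail_mass L (fun x => Psi (x, t) - Psi (x, t0))%R <= (e / 2)%:E)%E.
  apply: le_trans (tail_mass_triangle _ (mPsi t) (mPsi t0)) _.
  apply: le_trans (leeD (lee_wpmul2l _ (HL t tT)) (lee_wpmul2l _ (HL t0 tT0))) _ => //.
  by rewrite -!EFinM -EFinD lee_fin; lra.
by apply: le_trans (leeD h5 h7) _; rewrite -EFinD lee_fin; lra.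
Unshelve. all: by end_near. Qed.

Lemma compact_in_box (K : set (R * R)) : compact K -> K `<=` halfplane R ->
  exists2 L : R, 0 < L & K `<=` `[- L, L]%classic `*` `[0, L]%classic.
Proof.
move=> cK Kh.
have c1 : continuous (fun p : R * R => p.1) by move=> p; exact: cvg_fst.
have c2 : continuous (fun p : R * R => p.2) by move=> p; exact: cvg_snd.
have [M1 M10 H1] := compact_bound c1 cK; have [M2 M20 H2] := compact_bound c2 cK.
exists (M1 + M2 + 1) => [|p Kp]; first lra.
have := H1 p Kp; have := H2 p Kp; have := Kh p Kp; rewrite /halfplane /= !ler_norml => h0 /andP[h1 h2] /andP[h3 h4].
by split; rewrite /= in_itv /=; apply/andP; split; lra.
Qed.

End LimitRegularity.

(** * The limit is a strong solution *)

Section ExtendedNorms.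
Context {R : realType}.

Lemma supnorm_ge0 (T : Type) (D : set T) (f : T -> R) : (0 <= supnorm D f)%E.
Proof. by apply: ereal_sup_ubound; left. Qed.

Lemma le_supnorm (T : Type) (D : set T) (f : T -> R) x : D x -> (`|f x|%:E <= supnorm D f)%E.
Proof. by move=> Dx; apply: ereal_sup_ubound; right; exists x. Qed.

Lemma supnorm_le (T : Type) (D : set T) (f : T -> R) (M : R) : 0 <= M ->
  (forall x, D x -> `|f x| <= M) -> (supnorm D f <= M%:E)%E.
Proof. by move=> M0 H; apply: ge_ereal_sup => _ [->|[x Dx <-]]; rewrite lee_fin // H. Qed.

Lemma sum3_cvg0 (u v w : nat -> \bar R) :
  (forall n, (0 <= u n)%E) -> (forall n, (0 <= v n)%E) -> (forall n, (0 <= w n)%E) ->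
  ((u n + v n + w n)%E @[n --> \oo] --> 0%E) <->
  [/\ u @ \oo --> 0%E, v @ \oo --> 0%E & w @ \oo --> 0%E].
Proof.
move=> u0 v0 w0; split=> [h|[hu hv hw]]; last first.
  rewrite -[0%E]adde0 -[X in _ --> (X + _)%E]adde0.
  by apply: cvgeD => //; apply: cvgeD.
move/(ecvg0P (fun n => adde_ge0 (adde_ge0 (u0 n) (v0 n)) (w0 n))): h => h.
split; apply/ecvg0P => // e e0; move: (h e e0); apply: filterS => n; apply: le_trans.
- by rewrite -addeA leeDl // adde_ge0.
- by rewrite addeAC leeDr // adde_ge0.
- by rewrite leeDr // adde_ge0.
Qed.
End ExtendedNorms.

Section PlaneMass.
Context {R : realType}.
Local Notation plane := (measurableTypeR R * measurableTypeR R)%type.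

Lemma plane_mass_le (K : set (R * R)) (u : R * R -> spinor R) (L e : R) : 0 <= L -> 0 <= e ->
  measurable (K : set plane) -> K `<=` `[- L, L]%classic `*` `[0, L]%classic ->
  spinor_measurable (T := plane) setT u ->
  (forall t : R, 0 <= t <= L -> (line_mass (- L) L (fun x => u (x, t)) <= e%:E)%E) ->
  (mass (leb2 R) K u <= (e * L)%:E)%E.
Proof.
move=> L0 e0 mK KL mu_ H.
apply: (@le_trans _ _ (mass (leb2 R) (`[- L, L]%classic `*` `[0, L]%classic) u)).
  apply: mass_subset => //; first exact: measurable_box.
  exact: (spinor_measurableW (D' := setT)).
have := @box_integral_le R (fun p : plane => spinor_sq (u p)) (- L) L 0 L e L0 e0.
rewrite subr0; apply => //; first exact: spinor_measurable_sq.
by move=> p; exact: spinor_sq_ge0.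
Qed.
End PlaneMass.

Section Representation.
Context {R : realType} {m : R}.

(** The field [spin s] agrees with [Psi] on the closed half plane but is continuous on the whole
    plane; measurability is therefore immediate for [spin s]. *)
Definition represents (s : half_solution m) (Psi : R * R -> spinor R) (A : 'I_2 -> R * R -> R) : Prop :=
  (forall p, halfplane R p -> spin s p = Psi p) /\
  (forall mu p, halfplane R p -> pot s mu p = A mu p /\ pott s mu p = dt (A mu) p).

Lemma smooth_represents Psi A : smooth_solution m Psi A -> exists s, represents s Psi A.
Proof.
move=> /half_of_smooth[s [h1 h2 h3 h4]]; exists s; split => [p p0|mu p p0].
  by rewrite /spin (h1 p).1 (h1 p).2 (h2 p).1 (h2 p).2 !reflect_tE //; case: (Psi p) => [[? ?] [? ?]].
by rewrite h3 h4 !reflect_tE.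
Qed.
End Representation.

Section LimitSolution.
Context {R : realType} {m : R}.
Context (psi : R -> spinor R) (a0 a1 : 'I_2 -> R -> R) (s : nat -> half_solution m).
Context (psiL2 : inL2 psi) (data : fast_data psi a0 a1 s).
Local Notation Psi := (Psi_lim s).
Local Notation A := (A_lim s).

(** Cavalieri's principle integrates the bounds at fixed times. *)
Lemma limit_on_compact (K : set (R * R)) : compact K -> K `<=` halfplane R ->
  exists (C : R) (N : nat), 0 <= C /\ forall n, (N <= n)%N ->
    (mass (leb2 R) K (fun p => spin (s n) p - Psi p)%R <= (C * (16^-1) ^+ n)%:E)%E /\
    (forall mu p, K p -> `|pot (s n) mu p - A mu p| <= C * (2^-1) ^+ n).
Proof.
move=> cK Kh; have [L L0 KL] := compact_in_box cK Kh.
have [C [N [C0 HC]]] := fast_limit psiL2 data (ltW L0) (ltW L0).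
exists (C * (L + 1)), N; split; first by rewrite mulr_ge0 //; lra.
move=> n Nn; have [h1 h2] := HC n Nn; split.
  apply: (@le_trans _ _ (C * (16^-1) ^+ n * L)%:E).
    apply: plane_mass_le => //; [exact: ltW|by rewrite mulr_ge0 // exprn_ge0|exact: compact_measurable2|].
    by apply: spinor_measurableB; [exact: spin_measurable_plane|exact: Psi_lim_measurable].
  rewrite lee_fin mulrAC; apply: ler_wpM2r; first by rewrite exprn_ge0.
  by apply: ler_wpM2l => //; lra.
move=> mu [x t] /KL [] /=; rewrite !in_itv /= => xL tL.
apply: le_trans (h2 mu x t tL _) _; first by rewrite ler_norml.
apply: ler_wpM2r; first exact: half_pow_ge0.
by rewrite ler_peMr //; lra.
Qed.

Lemma limit_inL2loc : inL2loc Psi.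
Proof.
have [m1 m2 m3 m4] := Psi_lim_measurable s.
split; first by split; exact: measurable_funTS.
move=> K cK Ko; have Kh : K `<=` halfplane R by move=> p /Ko; rewrite /open_halfplane /halfplane /=; exact: ltW.
have [L L0 KL] := compact_in_box cK Kh.
have [P P0 HP] := psi_charge psiL2.
rewrite L2norm_lty; apply: (@le_lt_trans _ _ (4 * P * L)%:E); last exact: ltry.
apply: plane_mass_le => //; [exact: ltW|by rewrite mulr_ge0|exact: compact_measurable2|].
move=> t /andP[t0 tL]; apply: le_trans (limit_charge psiL2 data t0 _) _; first lra.
by rewrite EFinM; apply: lee_wpmul2l => //; exact: psi_line_mass.
Qed.

(** Uniform convergence on cones, after even reflection in time. *)
Lemma limit_potential_continuous mu : {within halfplane R, continuous (A mu)}.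
Proof.
pose W n := reflect_t (pot (s n) mu).
have cw : continuous (reflect_t (A mu)).
  apply: (@uniform_limit_continuous _ W) => [n|L].
    by apply: reflect_t_continuous; apply: continuous_subspaceT; exact: c1_continuous.
  have L0 : 0 <= `|L| by [].
  have [C [N [C0 HC]]] := fast_limit psiL2 data L0 L0; exists C, N => n p Nn pL.
  have := ler_norm L; move: pL; rewrite /cone /= => pL LL.
  have p1 := normr_ge0 p.1; have p2 := normr_ge0 p.2.
  have [_ h] := HC n Nn; apply: h; last lra.
  by rewrite p2; lra.
apply: (@subspace_eq_continuous _ _ _ (reflect_t (A mu))); last exact: continuous_subspaceT.
by move=> p; rewrite inE => p0; rewrite reflect_tE.
Qed.

Theorem limit_strong_solution (Psin : nat -> R * R -> spinor R) (An : nat -> 'I_2 -> R * R -> R) :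
  (forall n, smooth_solution m (Psin n) (An n)) -> (forall n, represents (s n) (Psin n) (An n)) ->
  strong_solution m psi a0 a1 Psi A.
Proof.
move=> smo rep; split; [exact: limit_inL2loc|exact: limit_potential_continuous|].
exists Psin, An; split => //.
- move=> K cK Kh; have [C [N [C0 HC]]] := limit_on_compact cK Kh.
  apply/sum3_cvg0; [by move=> n; exact: L2norm_ge0|by move=> n; exact: supnorm_ge0..|].
  have sup mu : supnorm K (fun p => An n mu p - A mu p)%R @[n --> \oo] --> 0%E.
    apply/ecvg0P => [n|e e0]; first exact: supnorm_ge0.
    have [k Hk] := half_pow_small C e0; exists (maxn N k) => // n /= nk.
    have [_ h] := HC n (leq_trans (leq_maxl _ _) nk).
    apply: supnorm_le => [|p Kp]; first exact: ltW.
    rewrite -(((rep n).2 mu p (Kh p Kp)).1); apply: le_trans (h mu p Kp) _; apply: le_trans Hk.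
    apply: ler_wpM2l => //; apply: ler_wiXn2l; [lra|lra|exact: leq_trans (leq_maxr N k) nk].
  split; [|exact: sup..].
  apply/L2norm_cvg0 => e e0.
  have [k Nk Hk] := rate_small C N e0; exists k => // n /= nk.
  have [h _] := HC n (leq_trans Nk nk).
  rewrite (_ : mass _ _ _ = mass (leb2 R) K (fun p => spin (s n) p - Psi p)%R); last first.
    by apply: eq_integral => p; rewrite inE => Kp; rewrite (rep n).1 //; exact: Kh.
  apply: le_trans h _; rewrite lee_fin; apply: le_trans Hk; apply: ler_wpM2l => //.
  by apply: ler_wiXn2l => //; lra.
- move=> mu a b.
  have [N HN] := exists_nat_ge (`|a| + `|b|).
  have na := ler_norm a; have nb := ler_norm b; have na' := ler_norm (- a); have nb' := ler_norm (- b).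
  rewrite !normrN in na' nb'; have n0 := normr_ge0 a; have n1 := normr_ge0 b.
  have abN n : (N <= n)%N -> `|a| + `|b| <= n.+1%:R.
    by move=> Nn; apply: le_trans HN _; rewrite ler_nat; exact: leqW.
  have p0 (x : R) : halfplane R (x, 0) by rewrite /halfplane /=.
  have small (e : R) : 0 < e -> \forall n \near \oo, (N <= n)%N /\ (16^-1 : R) ^+ n <= e.
    move=> e0; have [k Nk Hk] := rate_small 1 N e0; exists k => // n /= nk.
    split; first exact: leq_trans Nk nk.
    rewrite mul1r in Hk; apply: le_trans Hk.
    by apply: ler_wiXn2l => //; lra.
  have xab n (x : R) : (N <= n)%N -> `[a, b]%classic x -> `|x| <= n.+1%:R.
    move=> Nn; rewrite /= in_itv /= => /andP[h1 h2]; have := abN n Nn => h3.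
    by rewrite ler_norml; apply/andP; split; lra.
  apply/sum3_cvg0; [by move=> n; exact: L2norm_ge0|by move=> n; exact: supnorm_ge0..|]; split.
  + apply/L2norm_cvg0 => e e0; move: (small e e0); apply: filterS => n [Nn ne].
    rewrite (_ : mass _ _ _ = line_mass a b (fun x => spin (s n) (x, 0%R) - psi x)%R); last first.
      by apply: eq_integral => x _; rewrite (rep n).1.
    have h := data_line_mass psiL2 data (abN n Nn).
    apply: le_trans (le_trans h _); last by rewrite lee_fin.
    apply: line_mass_subset; [lra|lra|].
    by apply: spinor_measurableB; [exact: spin_measurable_line|case: psiL2].
  + apply/ecvg0P => [n|e e0]; first exact: supnorm_ge0.
    move: (small e e0); apply: filterS => n [Nn ne]; apply: supnorm_le => [|x xx]; first exact: ltW.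
    have [h _] := data.2 n mu x (xab n x Nn xx).
    by rewrite -(((rep n).2 mu _ (p0 x)).1); exact: le_trans h ne.
  + apply/ecvg0P => [n|e e0]; first exact: supnorm_ge0.
    move: (small e e0); apply: filterS => n [Nn ne]; apply: supnorm_le => [|x xx]; first exact: ltW.
    have [_ h] := data.2 n mu x (xab n x Nn xx).
    by rewrite -(((rep n).2 mu _ (p0 x)).2); exact: le_trans h ne.
Qed.
End LimitSolution.

(** * Approximation of the data and merging of approximants *)

Section Data.
Context {R : realType} (m : R).
Context (psi : R -> spinor R) (a0 a1 : 'I_2 -> R -> R).

(** Each real component of the spinor is approximated in L^2 and each potential uniformly by
    polynomials, from which [smooth_solution_exists] starts. *)
Lemma approximate_data (L e : R) : 0 < L -> 0 < e -> inL2 psi ->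
  (forall mu, continuous (a0 mu)) -> (forall mu, continuous (a1 mu)) ->
  exists (z : (R * R -> spinor R) * ('I_2 -> R * R -> R) * half_solution m),
  [/\ smooth_solution m z.1.1 z.1.2, represents z.2 z.1.1 z.1.2,
      (line_mass (- L) L (fun x => spin z.2 (x, 0%R) - psi x)%R <= e%:E)%E &
      forall mu (x : R), `|x| <= L -> `|pot z.2 mu (x, 0) - a0 mu x| <= e /\
         `|pott z.2 mu (x, 0) - a1 mu x| <= e].
Proof.
move=> L0 e0 psiL2 c0 c1; have [[m1 m2 m3 m4] fin] := psiL2.
have e4 : 0 < e / 4 by lra.
have mI : measurable (`[- L, L]%classic : set (measurableTypeR R)) by exact: measurable_itv.
have comp (f : R -> R) : measurable_fun (setT : set (measurableTypeR R)) f ->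
    (forall x, f x ^+ 2 <= spinor_sq (psi x)) -> exists p : {poly R},
    (\int[leb1 R]_(x in `[(- L)%R, L]) ((p.[x] - f x) ^+ 2)%:E <= (e / 4)%:E)%E.
  move=> mf fle.
  have fi : (\int[@lebesgue_measure R]_(x in `[(- L)%R, L]) (f x ^+ 2)%:E < +oo)%E.
    rewrite L2norm_lty in fin; apply: le_lt_trans fin.
    apply: (@le_trans _ _ (mass (leb1 R) `[- L, L]%classic psi)); last first.
      by apply: mass_subset.
    apply: ge0_le_integral => //.
    - by move=> x _; rewrite lee_fin sqr_ge0.
    - by apply/measurable_EFinP; apply: measurable_funX; exact: measurable_funTS.
    - by apply/measurable_EFinP; apply: spinor_measurable_sq; exact: (spinor_measurableW (D' := setT)).
    - by move=> x _; rewrite lee_fin.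
  have [p Hp] := L2_poly_dense L0 e4 mf fi; exists p; apply: le_trans Hp.
  rewrite le_eqVlt; apply/orP; left; apply/eqP; apply: eq_integral => x _.
  by congr (_%:E); ring.
have [qa Ha] := comp _ m1 (fun x => let: And4 h _ _ _ := spinor_sq_components (psi x) in h).
have [qb Hb] := comp _ m2 (fun x => let: And4 _ h _ _ := spinor_sq_components (psi x) in h).
have [qc Hc] := comp _ m3 (fun x => let: And4 _ _ h _ := spinor_sq_components (psi x) in h).
have [qd Hd] := comp _ m4 (fun x => let: And4 _ _ _ h := spinor_sq_components (psi x) in h).
have /choice[p0 Hp0] : forall mu, exists p : {poly R}, forall x : R, `|x| <= L -> `|a0 mu x - p.[x]| <= e.
  by move=> mu; exact: weierstrass.
have /choice[p1 Hp1] : forall mu, exists p : {poly R}, forall x : R, `|x| <= L -> `|a1 mu x - p.[x]| <= e.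
  by move=> mu; exact: weierstrass.
have [Psi [A [sol dPsi dA0 dA1]]] := smooth_solution_exists m qa qb qc qd p0 p1.
have [s rep] := smooth_represents sol.
have h0 (x : R) : halfplane R (x, 0) by rewrite /halfplane /=.
exists (Psi, A, s); split => //=; last first.
  move=> mu x xL; have [-> ->] := rep.2 mu _ (h0 x); rewrite dA0 dA1.
  by split; rewrite distrC; [exact: Hp0|exact: Hp1].
have -> : e = 4 * (e / 4) by field.
apply: mass_le_components => //.
  apply: spinor_measurableB; first exact: spin_measurable_line.
  exact: (spinor_measurableW (D' := setT)).
- by apply: le_trans Ha; rewrite le_eqVlt; apply/orP; left; apply/eqP; apply: eq_integral => x _;
    rewrite rep.1 // dPsi; case: (psi x) => [[? ?] [? ?]].
- by apply: le_trans Hb; rewrite le_eqVlt; apply/orP; left; apply/eqP; apply: eq_integral => x _;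
    rewrite rep.1 // dPsi; case: (psi x) => [[? ?] [? ?]].
- by apply: le_trans Hc; rewrite le_eqVlt; apply/orP; left; apply/eqP; apply: eq_integral => x _;
    rewrite rep.1 // dPsi; case: (psi x) => [[? ?] [? ?]].
- by apply: le_trans Hd; rewrite le_eqVlt; apply/orP; left; apply/eqP; apply: eq_integral => x _;
    rewrite rep.1 // dPsi; case: (psi x) => [[? ?] [? ?]].
Qed.

Lemma fast_data_exists : inL2 psi ->
  (forall mu, continuous (a0 mu)) -> (forall mu, continuous (a1 mu)) ->
  exists (Psin : nat -> R * R -> spinor R) (An : nat -> 'I_2 -> R * R -> R) (s : nat -> half_solution m),
  [/\ forall n, smooth_solution m (Psin n) (An n), forall n, represents (s n) (Psin n) (An n) &
      fast_data psi a0 a1 s].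
Proof.
move=> psiL2 c0 c1.
have /choice[z Hz] : forall n : nat, exists z : (R * R -> spinor R) * ('I_2 -> R * R -> R) * half_solution m,
  [/\ smooth_solution m z.1.1 z.1.2, represents z.2 z.1.1 z.1.2,
      (line_mass (- n.+1%:R) n.+1%:R (fun x => spin z.2 (x, 0%R) - psi x)%R <= ((16^-1) ^+ n)%:E)%E &
      forall mu (x : R), `|x| <= n.+1%:R -> `|pot z.2 mu (x, 0) - a0 mu x| <= (16^-1) ^+ n /\
         `|pott z.2 mu (x, 0) - a1 mu x| <= (16^-1) ^+ n].
  by move=> n; apply: approximate_data => //; rewrite ?ltr0n // exprn_gt0.
exists (fun n => (z n).1.1), (fun n => (z n).1.2), (fun n => (z n).2).
by split=> [n|n|]; [case: (Hz n)|case: (Hz n)|split => [n|n]; case: (Hz n)].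
Qed.
End Data.

Section Uniqueness.
Context {R : realType} {m : R}.
Context (psi : R -> spinor R) (a0 a1 : 'I_2 -> R -> R) (psiL2 : inL2 psi).

Definition data_converge (s : nat -> half_solution m) : Prop := forall L e : R, 0 < e ->
  \forall n \near \oo,
  (line_mass (- L) L (fun x => spin (s n) (x, 0%R) - psi x)%R <= e%:E)%E /\
  (forall mu (x : R), `|x| <= L ->
    `|pot (s n) mu (x, 0) - a0 mu x| <= e /\ `|pott (s n) mu (x, 0) - a1 mu x| <= e).

(** Two sequences of solutions whose data have the same limit have eventually bounded charges
    and data that are arbitrarily close, so [stability_mass] applies to the pair of [n]-th
    terms. *)
Lemma same_data_merge (s s' : nat -> half_solution m) (L e : R) : data_converge s -> data_converge s' ->
  0 <= L -> 0 < e -> \forall n \near \oo,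
  (forall t : R, 0 <= t <= L ->
     (line_mass (- L) L (fun x => spin (s n) (x, t) - spin (s' n) (x, t))%R <= e%:E)%E) /\
  (forall mu (x t : R), 0 <= t <= L -> `|x| <= L -> (pot (s n) mu (x, t) - pot (s' n) mu (x, t)) ^+ 2 <= e).
Proof.
move=> cs cs' L0 e0.
have [P P0 HP] := psi_charge psiL2.
have psi_meas : spinor_measurable (T := measurableTypeR R) setT psi by case: psiL2.
have M0 : 0 <= 2 * 1 + 2 * P by lra.
have [C C0 HC] := @stability_mass R m L L _ L0 L0 M0.
(* small enough for [C * (4 * d + (2 * d) ^ 2) <= e] *)
pose d := Num.min 1 (e / (8 * (C + 1))).
have d0 : 0 < d by rewrite lt_min ltr01 divr_gt0 // mulr_gt0 //; lra.
have d1 : d <= 1 by rewrite ge_min lexx.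
have d2 : C * (8 * d) <= e.
  have : d <= e / (8 * (C + 1)) by rewrite ge_min lexx orbT.
  rewrite ler_pdivlMr; last by rewrite mulr_gt0 //; lra.
  have := mulr_ge0 C0 (ltW d0); lra.
have dd : (2 * d) ^+ 2 <= 4 * d.
  by rewrite (_ : (2 * d) ^+ 2 = 4 * (d * d)); [have := ler_piMl (ltW d0) d1; lra|ring].
apply: filterS2 (cs (L + L) d d0) (cs' (L + L) d d0) => n [h1 h2] [h1' h2'].
have ms (z : nat -> half_solution m) : spinor_measurable (T := measurableTypeR R) setT (fun x => spin (z n) (x, 0)).
  exact: spin_measurable_line.
have bound (z : nat -> half_solution m) :
    (line_mass (- (L + L)) (L + L) (fun x => spin (z n) (x, 0%R) - psi x)%R <= d%:E)%E ->
    (line_mass (- (L + L)) (L + L) (fun x => spin (z n) (x, 0%R)) <= (2 * 1 + 2 * P)%:E)%E.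
  move=> h; apply: (line_mass_le (v := psi)) => //; first by apply: le_trans h _; rewrite lee_fin.
  exact: psi_line_mass.
have [] := HC (s n) (s' n) (2 * d) (4 * d).
- lra.
- exact: bound.
- exact: bound.
- move=> mu y yL; have [k1 k2] := h2 mu y yL; have [k3 k4] := h2' mu y yL.
  have tr (u v w : R) : `|u - w| <= `|u - v| + `|w - v|.
    by have := ler_normD (u - v) (v - w); rewrite addrA subrK (distrC w).
  by split; [have := tr (pot (s n) mu (y, 0)) (a0 mu y) (pot (s' n) mu (y, 0))|
             have := tr (pott (s n) mu (y, 0)) (a1 mu y) (pott (s' n) mu (y, 0))]; lra.
- apply: le_trans (line_mass_triangle _ _ (ms s) psi_meas (ms s')) _.
  rewrite [X in (_ + 2%:E * X)%E]/line_mass mass_sym -/(line_mass _ _ _).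
  apply: le_trans (leeD (lee_wpmul2l _ h1) (lee_wpmul2l _ h1')) _ => //.
  by rewrite -!EFinM -EFinD lee_fin; lra.
have E : C * (4 * d + (2 * d) ^+ 2) <= e by apply: le_trans d2; apply: ler_wpM2l => //; lra.
move=> k1 k2; split => [t tL|mu x t tL xL]; last exact: le_trans (k2 _ _ _ tL xL) E.
by apply: le_trans (k1 t tL) _; rewrite lee_fin.
Qed.

Lemma strong_data_converge (Psin : nat -> R * R -> spinor R) (An : nat -> 'I_2 -> R * R -> R) s :
  (forall n, represents (s n) (Psin n) (An n)) ->
  (forall (mu : 'I_2) (a b : R),
     (L2norm (leb1 R) `[a, b]%classic (fun x : R => Psin n (x, 0) - psi x)%R
      + supnorm `[a, b]%classic (fun x => An n mu (x, 0) - a0 mu x)%R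
      + supnorm `[a, b]%classic (fun x => dt (An n mu) (x, 0) - a1 mu x)%R)%E @[n --> \oo] --> 0%E) ->
  data_converge s.
Proof.
move=> rep H L e e0.
have h0 (x : R) : halfplane R (x, 0) by rewrite /halfplane /=.
have K mu : \forall n \near \oo,
  (line_mass (- L) L (fun x => spin (s n) (x, 0%R) - psi x)%R <= e%:E)%E /\
  (forall x : R, `|x| <= L ->
    `|pot (s n) mu (x, 0) - a0 mu x| <= e /\ `|pott (s n) mu (x, 0) - a1 mu x| <= e).
  have [] := (sum3_cvg0 (fun n => L2norm_ge0 (leb1 R) `[- L, L]%classic (fun x : R => Psin n (x, 0) - psi x)%R)
    (fun n => supnorm_ge0 `[- L, L]%classic (fun x => An n mu (x, 0) - a0 mu x))
    (fun n => supnorm_ge0 `[- L, L]%classic (fun x => dt (An n mu) (x, 0) - a1 mu x))).1 (H mu (- L) L).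
  move=> /L2norm_cvg0 /(_ e e0) n1 /ecvg0P c2 /ecvg0P c3.
  have n2 := c2 (fun n => supnorm_ge0 _ _) e e0; have n3 := c3 (fun n => supnorm_ge0 _ _) e e0.
  apply: filterS3 n1 n2 n3 => n k1 k2 k3; split => [|x xL].
    rewrite (_ : line_mass _ _ _ = mass (leb1 R) `[- L, L]%classic (fun x => Psin n (x, 0) - psi x)%R) //.
    by apply: eq_integral => x _; rewrite (rep n).1.
  have [-> ->] := (rep n).2 mu _ (h0 x).
  have xI : `[- L, L]%classic x by rewrite /= in_itv /= -ler_norml.
  split; rewrite -lee_fin.
    exact: le_trans (le_supnorm (fun x => An n mu (x, 0) - a0 mu x) xI) k2.
  exact: le_trans (le_supnorm (fun x => dt (An n mu) (x, 0) - a1 mu x) xI) k3.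
apply: filterS2 (K 0) (K 1) => n [h1 h2] [_ h3]; split => // mu.
by case: (eqVneq mu 0) => [->//|mu0]; have -> : mu = 1 by apply/val_inj; case: mu mu0 => [[|[|]]].
Qed.

End Uniqueness.

(** * Uniqueness of strong solutions *)

Section UniquenessTheorem.
Context {R : realType} {m : R}.
Context (psi : R -> spinor R) (a0 a1 : 'I_2 -> R -> R) (psiL2 : inL2 psi).
Local Notation plane := (measurableTypeR R * measurableTypeR R)%type.

Definition converges_to (s : nat -> half_solution m) (Psi : R * R -> spinor R) (A : 'I_2 -> R * R -> R) : Prop :=
  forall (K : set (R * R)) (e : R), compact K -> K `<=` halfplane R -> 0 < e -> \forall n \near \oo,
  (mass (leb2 R) K (fun p => spin (s n) p - Psi p)%R <= e%:E)%E /\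
  (forall mu p, K p -> `|pot (s n) mu p - A mu p| <= e).

Lemma strong_solution_approx Psi A : strong_solution m psi a0 a1 Psi A ->
  exists2 s : nat -> half_solution m, data_converge psi a0 a1 s & converges_to s Psi A.
Proof.
move=> [_ _ [Psin [An [sol HK Hdata]]]].
have /choice[s rep] := fun n => smooth_represents (sol n).
exists s; first exact: strong_data_converge rep Hdata.
move=> K e cK Kh e0.
have [] := (sum3_cvg0 (fun n => L2norm_ge0 (leb2 R) K (fun p : R * R => Psin n p - Psi p)%R)
  (fun n => supnorm_ge0 K (fun p => An n 0 p - A 0 p)) (fun n => supnorm_ge0 K (fun p => An n 1 p - A 1 p))).1 (HK K cK Kh).
move=> /L2norm_cvg0 /(_ e e0) n1 /ecvg0P c2 /ecvg0P c3.
have n2 := c2 (fun n => supnorm_ge0 _ _) e e0; have n3 := c3 (fun n => supnorm_ge0 _ _) e e0.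
apply: filterS3 n1 n2 n3 => n k1 k2 k3; split => [|mu p Kp].
  rewrite (_ : mass _ _ _ = mass (leb2 R) K (fun p => Psin n p - Psi p)%R) //.
  by apply: eq_integral => p; rewrite inE => Kp; rewrite (rep n).1 //; exact: Kh.
have [-> _] := (rep n).2 mu _ (Kh p Kp); rewrite -lee_fin.
case: (eqVneq mu 0) => [->|mu0]; first exact: le_trans (le_supnorm (fun p => An n 0 p - A 0 p) Kp) k2.
have -> : mu = 1 by apply/val_inj; case: mu mu0 => [[|[|]]].
exact: le_trans (le_supnorm (fun p => An n 1 p - A 1 p) Kp) k3.
Qed.

Lemma measurable_open_halfplane : measurable (open_halfplane R : set plane).
Proof.
apply: open_measurable2; apply: (@open_comp _ _ snd [set t : R | 0 < t]); last exact: open_gt.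
by move=> p _; exact: cvg_snd.
Qed.

(** Both solutions are limits of smooth solutions whose data converge to the same data, and
    [same_data_merge] brings the two approximating sequences together on compact sets.
    Rectangles of half width [n] between the times [1 / n] and [n] exhaust the open half plane.
    *)
Theorem strong_solution_unique Psi A Psi' A' :
  strong_solution m psi a0 a1 Psi A -> strong_solution m psi a0 a1 Psi' A' ->
  {ae leb2 R, forall p, open_halfplane R p -> Psi' p = Psi p} /\
  (forall mu p, halfplane R p -> A' mu p = A mu p).
Proof.
move=> S S'.
have [s ds cs] := strong_solution_approx S; have [s' ds' cs'] := strong_solution_approx S'.
split; last first.
  move=> mu p p0; apply/eqP; rewrite -subr_eq0 -normr_le0; apply/ler_addgt0Pr => e e0; rewrite add0r.
  have K1 : compact [set p] by exact: compact_set1.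
  have K2 : [set p] `<=` halfplane R by move=> q ->.
  have e3 : 0 < e / 3 by lra.
  have L0 : 0 <= `|p.1| + p.2 by rewrite addr_ge0.
  have near3 := same_data_merge psiL2 ds ds' L0 (exprn_gt0 2 e3).
  have [n [[_ h1] [[_ h2] [_ h3]]]] := filter_ex (filterI (cs _ _ K1 K2 e3) (filterI (cs' _ _ K1 K2 e3) near3)).
  have {}h1 := h1 mu p erefl; have {}h2 := h2 mu p erefl.
  have p1 := normr_ge0 p.1; have p0' : 0 <= p.2 by [].
  have {h3} : (pot (s n) mu p - pot (s' n) mu p) ^+ 2 <= (e / 3) ^+ 2.
    have := h3 mu p.1 p.2; rewrite -surjective_pairing; apply; [apply/andP; split|]; lra.
  rewrite -real_normK ?num_real // ler_sqr ?nnegrE //; last by rewrite ltW.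
  move=> h3; have := ler_normD (A' mu p - pot (s' n) mu p) (pot (s n) mu p - A mu p).
  have := ler_normD ((A' mu p - pot (s' n) mu p) + (pot (s n) mu p - A mu p)) (pot (s' n) mu p - pot (s n) mu p).
  rewrite (_ : (A' mu p - pot (s' n) mu p) + (pot (s n) mu p - A mu p) + (pot (s' n) mu p - pot (s n) mu p) =
     A' mu p - A mu p); last by ring.
  rewrite (distrC (A' mu p) (pot (s' n) mu p)) (distrC (pot (s' n) mu p) (pot (s n) mu p)); lra.
pose K (j : nat) : set (R * R) := box_set (- j.+1%:R) j.+1%:R j.+1%:R^-1 j.+1%:R.
have KP j : K j `<=` open_halfplane R.
  move=> p /box_setP[_ /andP[h _]]; rewrite /open_halfplane /=; apply: lt_le_trans h.
  by rewrite invr_gt0 ltr0n.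
have Kh j : K j `<=` halfplane R by move=> p /KP; rewrite /open_halfplane /halfplane /=; exact: ltW.
have cK j : compact (K j) by exact: box_compact.
have mK j := compact_measurable2 (cK j).
have mH := measurable_open_halfplane.
have meas (j : nat) (P : R * R -> spinor R) B : strong_solution m psi a0 a1 P B -> spinor_measurable (T := plane) (K j) P.
  by move=> [[h _] _ _]; exact: (spinor_measurableW mH (@KP j) h).
have zero j : mass (leb2 R) (K j) (fun p => Psi' p - Psi p)%R = 0%E.
  apply/eqP; rewrite eq_le mass_ge0 andbT; apply/lee_addgt0Pr => e e0; rewrite add0e.
  pose L : R := j.+1%:R; have L0 : 0 <= L by rewrite ler0n.
  have L1 : 0 < L by rewrite ltr0n.
  have e1 : 0 < e / 12 by lra.
  have e2 : 0 < e / (12 * L) by rewrite divr_gt0 // mulr_gt0.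
  have near3 := same_data_merge psiL2 ds ds' L0 e2.
  have [n [[h1 _] [[h2 _] [h3 _]]]] := filter_ex (filterI (cs _ _ (cK j) (@Kh j) e1) (filterI (cs' _ _ (cK j) (@Kh j) e1) near3)).
  have h4 : (mass (leb2 R) (K j) (fun p => spin (s n) p - spin (s' n) p)%R <= (e / (12 * L) * L)%:E)%E.
    apply: plane_mass_le => //; [exact: ltW| |].
    - move=> p /box_setP[xL /andP[t1 t2]]; split; rewrite /= in_itv /=; first by [].
      apply/andP; split => //; apply: le_trans t1; by rewrite invr_ge0 ler0n.
    - by apply: spinor_measurableB; exact: spin_measurable_plane.
  have E : e / (12 * L) * L = e / 12 by field; rewrite lt0r_neq0.
  rewrite E in h4; rewrite mass_sym in h2; rewrite mass_sym in h4.
  have ms (z : nat -> half_solution m) := spin_measurable_plane (z n) (K j).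
  have h5 : (mass (leb2 R) (K j) (fun p => spin (s' n) p - Psi p)%R <= (e / 3)%:E)%E.
    apply: le_trans (mass_triangle _ (mK j) (ms s') (ms s) (meas j _ _ S)) _.
    apply: le_trans (leeD (lee_wpmul2l _ h4) (lee_wpmul2l _ h1)) _ => //.
    by rewrite -!EFinM -EFinD lee_fin; lra.
  apply: le_trans (mass_triangle _ (mK j) (meas j _ _ S') (ms s') (meas j _ _ S)) _.
  apply: le_trans (leeD (lee_wpmul2l _ h2) (lee_wpmul2l _ h5)) _ => //.
  by rewrite -!EFinM -EFinD lee_fin; lra.
have : \forall p \ae leb2 R, forall j, K j p -> Psi' p = Psi p.
  by apply: ae_foralln => j; exact: (mass_eq0 (mK j) (meas j _ _ S') (meas j _ _ S) (zero j)).
apply: (@filterS _ _ (ae_filter_ringOfSetsType (leb2 R))) => p H p0; rewrite /open_halfplane /= in p0.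
have [j Hj] := exists_nat_ge (`|p.1| + p.2 + p.2^-1); apply: (H j).
have q0 : 0 < p.2^-1 by rewrite invr_gt0.
have p1 := normr_ge0 p.1.
have jj : j%:R <= j.+1%:R :> R by rewrite ler_nat.
apply/box_setP; split; first by rewrite -ler_norml; lra.
apply/andP; split; last lra.
by rewrite -(invrK p.2) lef_pV2 ?posrE //; lra.
Qed.

End UniquenessTheorem.

Theorem theorem1p1 (R : realType) (m : R) (psi : R -> spinor R)
    (a0 a1 : 'I_2 -> R -> R) :
  0 <= m ->
  inL2 psi ->
  (forall mu, continuous (a0 mu)) ->
  (forall mu, continuous (a1 mu)) ->
  exists (Psi : R * R -> spinor R) (A : 'I_2 -> R * R -> R),
    [/\ strong_solution m psi a0 a1 Psi A,
        inCL2 Psi,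
        forall mu, {within halfplane R, continuous (A mu)} &
        forall (Psi' : R * R -> spinor R) (A' : 'I_2 -> R * R -> R),
          strong_solution m psi a0 a1 Psi' A' ->
          {ae leb2 R, forall p, open_halfplane R p -> Psi' p = Psi p} /\
          (forall mu p, halfplane R p -> A' mu p = A mu p)].
Proof.
move=> _ psiL2 c0 c1.
have [Psin [An [s [sol rep data]]]] := fast_data_exists m psiL2 c0 c1.
have strong := limit_strong_solution psiL2 data sol rep.
exists (Psi_lim s), (A_lim s); split => //.
- exact: limit_inCL2 psiL2 data.
- exact: limit_potential_continuous psiL2 data.
- by move=> Psi' A' S'; exact: (strong_solution_unique psiL2 strong S').
Qed.
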